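(* Fix a positive integer $N$ and let $L_1\geq L_2\geq\cdots\geq L_K$ be nonnegative integers with $L_1\leq N$. Let $M:=\sum_{i=1}^K L_i$ and $\alpha:=M/N$. The following are equivalent: (1) $(L_1,\ldots,L_K)\in \mathrm{TFF}(\alpha,N)$, i.e. there exist orthogonal projections $P_1,\ldots,P_K$ on $\mathbb{R}^N$ with $\operatorname{rank}P_i=L_i$ and $\sum_{i=1}^K P_i=\alpha\mathbf I$; (2) the Littlewood–Richardson coefficient $c\big((N^{L_1}),\ldots,(N^{L_K});(M^N)\big)\neq 0$.
   Context: For a partition $\lambda$, $s_\lambda$ denotes the Schur polynomial (symmetric function). For partitions $\lambda^1,\ldots,\lambda^K$, the Littlewood–Richardson coefficients $c(\lambda^1,\ldots,\lambda^K;\mu)$ are defined by $\prod_{i=1}^K s_{\lambda^i}=\sum_\mu c(\lambda^1,\ldots,\lambda^K;\mu)\,s_\mu$. For positive integers $a$ and integers $b\ge 0$, $(a^b)$ denotes the rectangular partition $(a,\ldots,a)$ with $b$ parts ($(a^0)$ is the empty partition, with $s_{(a^0)}=1$). $\mathbf I$ is the identity on $\mathbb{R}^N$; a rank-zero projection is the zero operator. *)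

(* Defs.v *)
From HB Require Import structures.
From mathcomp Require Import all_boot all_order all_algebra.
From mathcomp Require Import mpoly.
From mathcomp Require Import reals.
From Stdlib Require Import ClassicalEpsilon.

Set Implicit Arguments.
Unset Strict Implicit.
Unset Printing Implicit Defensive.

Import Order.TTheory GRing.Theory Num.Theory.
Local Open Scope ring_scope.

Definition is_part (la : seq nat) : bool :=
  sorted geq la && (0%N \notin la).

Definition rect (a b : nat) : seq nat := if a is 0 then [::] else nseq b a.

Definition in_shape (la : seq nat) (r c : nat) : bool := (c < nth 0 la r)%N.

Definition oval n (o : option 'I_n) : nat := if o is Some v then nat_of_ord v else 0%N.

(* Fillings of the bounding box of la by entries in 'I_n (None = outside la). *)
Definition filling (n : nat) (la : seq nat) : finType :=
  {ffun 'I_(size la) * 'I_(foldr maxn 0%N la) -> option 'I_n}.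

Definition is_ssyt n (la : seq nat) (t : filling n la) : bool :=
  [forall x : 'I_(size la) * 'I_(foldr maxn 0%N la), (t x != None) == in_shape la x.1 x.2] &&
  [forall x : 'I_(size la) * 'I_(foldr maxn 0%N la),
   forall y : 'I_(size la) * 'I_(foldr maxn 0%N la),
     (in_shape la x.1 x.2 && in_shape la y.1 y.2) ==>
     [&& ((x.1 == y.1 :> nat) && (x.2 < y.2)%N) ==> (oval (t x) <= oval (t y))%N
       & ((x.2 == y.2 :> nat) && (x.1 < y.1)%N) ==> (oval (t x) < oval (t y))%N]].

Definition schur (n : nat) (la : seq nat) : {mpoly int[n]} :=
  \sum_(t : filling n la | is_ssyt t)
     \prod_(x : 'I_(size la) * 'I_(foldr maxn 0%N la))
        (if t x is Some v then 'X_v else 1).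

Definition schur_expansion (n : nat) (f : {mpoly int[n]}) (c : seq nat -> int) : Prop :=
  exists S : seq (seq nat),
    [/\ uniq S, all (fun la => is_part la && (size la <= n)%N) S,
        (forall la, la \notin S -> c la = 0)
      & f = \sum_(la <- S) c la *: schur n la].

(* Littlewood-Richardson coefficient c(lams; mu): coefficient of s_mu in
   prod_i s_(lams_i), computed in n = size mu variables (which is enough,
   since the specialization to n >= l(mu) variables is injective on the
   span of the s_nu with l(nu) <= n and kills the others). *)
Definition LRcoef (lams : seq (seq nat)) (mu : seq nat) : int :=
  let n := size mu in
  epsilon (inhabits (fun _ => 0))
    (fun c => schur_expansion (\prod_(la <- lams) schur n la) c) mu.

(* Main.v *)
(* Both conditions are equivalent to the existence of a nonzero polynomial f on
   N x M matrices A = (A_1 | ... | A_K), A_k of size N x L_k, that is multiplied by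
   det^M under the left action of GL_N and by det^N under each right action of
   GL_(L_k); invariance is expressed through the operators sum_u,v G_uv x_u d/dx_v.

   Littlewood-Richardson side. The bialternant and Jacobi-Trudi formulas turn the
   coefficient into a signed count of monomials of degree NM in the entries of A,
   the signs being Weyl-type signs of the row and column degrees. Multiplication by
   the Vandermonde product turns the Casimir operator into a Laplacian, so this
   count, read as a trace, is unchanged by inserting any polynomial in the total
   Casimir operator that takes the value 1 at its eigenvalue on invariants. The
   generalized eigenspace of that eigenvalue consists of invariants, so inserting
   the projection onto it identifies the count with its dimension.

   From f to projections (Kempf-Ness): a matrix of minimal norm on a level set
   {f = c}, c <> 0, has orthogonal rows of equal norm and orthonormal columns in
   each block, so that P_k = A_k A_k^T is a solution.

   From projections to f (King, Schofield, Derksen-Weyman): f is the determinant of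
   the linear map tau(A, B) : z |-> A X(z) B for a suitable constant matrix B. If
   the generic rank of tau were deficient, every A would admit a destabilizing
   quotient p A = A' q with q block diagonal; when the A_k have orthonormal columns
   and A A^T = M/N, comparing traces shows that no such quotient exists. *)

Require Import Defs.
From HB Require Import structures.
From mathcomp Require Import all_boot all_order all_algebra.
From mathcomp Require Import reals.
From mathcomp Require Import fingroup perm mpoly ring lra zify.
From Stdlib Require Import ClassicalEpsilon Classical_Prop.

Set Implicit Arguments.
Unset Strict Implicit.
Unset Printing Implicit Defensive.

Import Order.TTheory GRing.Theory Num.Theory.
Local Open Scope ring_scope.

(** * Semistandard tableaux and the bialternant formula *)

(** The coefficient becomes a trace of the identity on polynomials of degree NM, the basis monomials
    being weighted by products of [sgcount]. In such a weighted trace, against any operator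
    commuting with the Lie algebras, the total Casimir acts as the scalar [wmin] = N M^2 + M N^2. By
    Cauchy-Schwarz this is the least squared norm of a weight in degree NM, attained only by the
    balanced weight. This extremality replaces complete reducibility and highest weight theory: a
    generalized eigenvector for [wmin] can only have the balanced weight, hence is invariant. In the
    last implication the matrix built from the projections need not be generic, whereas the tangent
    arguments produce quotients only at well chosen pairs (A, B). Along the line from A to the given
    matrix all but finitely many points are well chosen, so quotients are pushed to the end point by
    compactness; orthonormal bases keep the limit from losing rank. *)

Section Tableaux.
Variables (S : comPzRingType) (y : nat -> S) (a b : nat).
Implicit Types (lam : nat -> nat) (n : nat).

(** The box is fixed and the shape is a function on row indices, so that the induction on the number
    of values can shrink the shape without changing the type of tableaux. With the bounding box and
    [nth 0 la] this is [is_ssyt]. *)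
Definition box_tableau n lam (t : {ffun 'I_a * 'I_b -> option 'I_n}) : bool :=
  [forall x : 'I_a * 'I_b, (t x != None) == (x.2 < lam x.1)%N] &&
  [forall x : 'I_a * 'I_b, forall z : 'I_a * 'I_b,
     ((x.2 < lam x.1)%N && (z.2 < lam z.1)%N) ==>
     [&& ((x.1 == z.1 :> nat) && (x.2 < z.2)%N) ==> (oval (t x) <= oval (t z))%N
       & ((x.2 == z.2 :> nat) && (x.1 < z.1)%N) ==> (oval (t x) < oval (t z))%N]].

Definition tab_weight n (t : {ffun 'I_a * 'I_b -> option 'I_n}) : S :=
  \prod_x (if t x is Some v then y v else 1).

Definition tab_sum n lam : S :=
  \sum_(t : {ffun 'I_a * 'I_b -> option 'I_n} | box_tableau lam t) tab_weight t.

Lemma box_tableauP n lam (t : {ffun 'I_a * 'I_b -> option 'I_n}) :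
  reflect [/\ forall (r : 'I_a) (c : 'I_b), (t (r, c) != None) = (c < lam r)%N,
    forall (r : 'I_a) (c c' : 'I_b), (c < c')%N -> (c < lam r)%N -> (c' < lam r)%N ->
      (oval (t (r, c)) <= oval (t (r, c')))%N
  & forall (r r' : 'I_a) (c : 'I_b), (r < r')%N -> (c < lam r)%N -> (c < lam r')%N ->
      (oval (t (r, c)) < oval (t (r', c)))%N]
  (box_tableau lam t).
Proof.
apply: (iffP andP) => [[/forallP h1 /forallP h2]|[h1 h2 h3]]; split.
- by move=> r c; rewrite (eqP (h1 (r, c))).
- move=> r c c' lt_c h h'; have /forallP/(_ (r, c')) := h2 (r, c).
  by rewrite /= h h' eqxx lt_c /= => /andP[].
- move=> r r' c lt_r h h'; have /forallP/(_ (r', c)) := h2 (r, c).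
  by rewrite /= h h' eqxx lt_r /= => /andP[].
- by apply/forallP => -[r c]; rewrite h1.
- apply/forallP => -[r c]; apply/forallP => -[r' c'] /=.
  apply/implyP => /andP[hr hr']; apply/andP; split; apply/implyP.
    move=> /andP[/eqP/val_inj e lt_c]; rewrite -e in hr' *; exact: h2.
  move=> /andP[/eqP/val_inj e lt_r]; rewrite -e in hr' *; exact: h3.
Qed.

Lemma card_lt_ord k : (k <= b)%N -> #|[pred c : 'I_b | (c < k)%N]| = k.
Proof.
move=> le_k; rewrite -[RHS]card_ord -(card_image (f := widen_ord le_k)); last by move=> u v /(congr1 val) /= /val_inj.
apply: eq_card => x; rewrite !inE; apply/idP/imageP => [lt_x|[z _ ->]].
  by exists (Ordinal lt_x) => //; apply: val_inj.
exact: (ltn_ord z).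
Qed.

(** A down-closed set of columns is an initial segment; this recovers a row of the inner shape from
    its number of boxes. *)
Lemma down_closed_card (P : pred 'I_b) :
  (forall c c' : 'I_b, (c < c')%N -> P c' -> P c) ->
  forall c, P c = (c < #|P|)%N.
Proof.
move=> hP c; pose bnd := card_lt_ord.
case Pc: (P c); apply/esym.
  rewrite -[X in (X < _)%N]/(nat_of_ord c) -(bnd c.+1 (ltn_ord c)) //.
  apply: subset_leq_card; apply/subsetP => x; rewrite !inE ltnS leq_eqVlt.
  by case/orP=> [/eqP/val_inj ->//|lt_x]; apply: hP lt_x Pc.
apply/negbTE; rewrite -leqNgt -(bnd c (ltnW (ltn_ord c))).
apply: subset_leq_card; apply/subsetP => x; rewrite !inE => Px; rewrite unfold_in in Px.
rewrite ltnNge leq_eqVlt; apply/negP => /orP[/eqP/val_inj e|lt_x].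
  by rewrite e Px in Pc.
by rewrite (hP _ _ lt_x Px) in Pc.
Qed.

Definition ext (mu : {ffun 'I_a -> 'I_b.+1}) (r : nat) : nat :=
  if insub r is Some i then nat_of_ord (mu i) else 0%N.

Lemma extE mu (r : 'I_a) : ext mu r = mu r.
Proof. by rewrite /ext valK. Qed.

Lemma ext_oob mu r : (a <= r)%N -> ext mu r = 0%N.
Proof. by move=> h; rewrite /ext insubF // ltnNge h. Qed.

(** Erases the boxes holding the largest value n; [grow] puts n back into every box of lam left
    empty. *)
Definition shrink n (t : {ffun 'I_a * 'I_b -> option 'I_n.+1}) :
    {ffun 'I_a * 'I_b -> option 'I_n} :=
  [ffun x => obind (fun v : 'I_n.+1 => insub (nat_of_ord v)) (t x)].

Definition grow n lam (t : {ffun 'I_a * 'I_b -> option 'I_n}) :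
    {ffun 'I_a * 'I_b -> option 'I_n.+1} :=
  [ffun x : 'I_a * 'I_b => if (x.2 < lam x.1)%N
             then if t x is Some v then Some (widen_ord (leqnSn n) v) else Some ord_max
             else None].

Definition inner n (t : {ffun 'I_a * 'I_b -> option 'I_n.+1}) : {ffun 'I_a -> 'I_b.+1} :=
  [ffun r => inord #|[pred c | shrink t (r, c) != None]|].

Definition interlace lam (mu : {ffun 'I_a -> 'I_b.+1}) : bool :=
  [forall r : 'I_a, (lam r.+1 <= mu r)%N && (mu r <= lam r)%N].

Definition good_shape lam :=
  [/\ forall r, (lam r.+1 <= lam r)%N, forall r, (lam r <= b)%N
    & forall r, (a <= r)%N -> lam r = 0%N].

Lemma good_shape_le lam r r' : good_shape lam -> (r <= r')%N -> (lam r' <= lam r)%N.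
Proof.
case=> h _ _; elim: r' => [|r' IH]; first by rewrite leqn0 => /eqP ->.
rewrite leq_eqVlt => /orP[/eqP->//|]; rewrite ltnS => /IH; exact: leq_trans.
Qed.

Lemma good_ext lam mu : good_shape lam -> interlace lam mu -> good_shape (ext mu).
Proof.
move=> [h1 h2 h3] /forallP hmu; split.
- move=> r; case: (ltnP r.+1 a) => hr; last by rewrite ext_oob.
  have hr' : (r < a)%N by apply: ltn_trans hr.
  rewrite (extE mu (Ordinal hr)) (extE mu (Ordinal hr')).
  have /andP[_ u] := hmu (Ordinal hr); have /andP[v _] := hmu (Ordinal hr').
  exact: leq_trans u v.
- move=> r; case: (ltnP r a) => hr; last by rewrite ext_oob.
  by rewrite (extE mu (Ordinal hr)) -ltnS.
- exact: ext_oob.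
Qed.

Lemma shrink_neq_None n (t : {ffun 'I_a * 'I_b -> option 'I_n.+1}) x :
  (shrink t x != None) = (t x != None) && (oval (t x) < n)%N.
Proof. by rewrite ffunE; case: (t x) => //= v; case: insubP => [u -> _|/negbTE ->]. Qed.

Lemma oval_shrink n (t : {ffun 'I_a * 'I_b -> option 'I_n.+1}) x :
  shrink t x != None -> oval (shrink t x) = oval (t x).
Proof. by rewrite ffunE; case: (t x) => //= v; case: insubP. Qed.

Lemma shrink_inner n lam (t : {ffun 'I_a * 'I_b -> option 'I_n.+1}) :
  good_shape lam -> box_tableau lam t ->
  forall (r : 'I_a) (c : 'I_b), (shrink t (r, c) != None) = (c < inner t r)%N.
Proof.
move=> hlam /box_tableauP[h1 h2 h3] r c.
rewrite [inner t r]ffunE inordK; last first.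
  by rewrite ltnS -[X in (_ <= X)%N]card_ord max_card.
rewrite -(@down_closed_card [pred c | shrink t (r, c) != None]) // => c1 c2 lt_c.
rewrite !inE !shrink_neq_None !h1 => /andP[l2 o2].
have l1 : (c1 < lam r)%N by apply: ltn_trans l2.
by rewrite l1 /=; apply: leq_ltn_trans o2; apply: h2.
Qed.

(** Column strictness: if the next row of lam were longer than the inner row, a box holding the
    largest value would have a box under it, with no value left for that box. *)
Lemma inner_interlace n lam (t : {ffun 'I_a * 'I_b -> option 'I_n.+1}) :
  good_shape lam -> box_tableau lam t -> interlace lam (inner t).
Proof.
move=> hlam ht; have [h1 h2 h3] := box_tableauP _ _ ht.
have hin := shrink_inner hlam ht; have [g1 g2 g3] := hlam.
apply/forallP => r; apply/andP; split.
  rewrite leqNgt; apply/negP => lt.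
  have hb : (inner t r < b)%N by apply: leq_trans lt _.
  have ha : (r.+1 < a)%N.
    by rewrite ltnNge; apply/negP => /g3 e; rewrite e in lt.
  have := hin r (Ordinal hb); rewrite /= ltnn => /negbT.
  have l1 : (inner t r < lam r)%N by apply: leq_trans lt (g1 r).
  rewrite shrink_neq_None h1 l1 /= -leqNgt => le_n.
  have := h3 r (Ordinal ha) (Ordinal hb) (ltnSn r) l1 lt.
  move/(leq_ltn_trans le_n); case: (t _) => //= v; rewrite ltnNge -ltnS ltn_ord //.
rewrite leqNgt; apply/negP => lt.
have hb : (lam r < b)%N.
  by apply: leq_trans lt _; rewrite -ltnS.
have := hin r (Ordinal hb); rewrite lt shrink_neq_None h1 /= ltnn //.
Qed.

Lemma shrink_tableau n lam (t : {ffun 'I_a * 'I_b -> option 'I_n.+1}) :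
  good_shape lam -> box_tableau lam t -> box_tableau (ext (inner t)) (shrink t).
Proof.
move=> hlam ht; have [h1 h2 h3] := box_tableauP _ _ ht.
have hin := shrink_inner hlam ht.
have sub (r : 'I_a) (c : 'I_b) : (c < inner t r)%N -> (c < lam r)%N.
  by rewrite -hin shrink_neq_None h1 => /andP[].
apply/box_tableauP; split.
- by move=> r c; rewrite extE hin.
- move=> r c c' lt_c; rewrite !extE => u u'.
  by rewrite !oval_shrink ?hin //; apply: h2 => //; apply: sub.
- move=> r r' c lt_r; rewrite !extE => u u'.
  by rewrite !oval_shrink ?hin //; apply: h3 => //; apply: sub.
Qed.

Lemma grow_tableau n lam mu (t : {ffun 'I_a * 'I_b -> option 'I_n}) :
  good_shape lam -> interlace lam mu -> box_tableau (ext mu) t ->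
  [/\ box_tableau lam (grow lam t), inner (grow lam t) = mu & shrink (grow lam t) = t].
Proof.
move=> hlam hmu ht; have [h1 h2 h3] := box_tableauP _ _ ht.
have [g1 g2 g3] := hlam; move/forallP: (hmu) => hmu'.
have sub (r : 'I_a) (c : 'I_b) : t (r, c) != None -> (c < lam r)%N.
  by rewrite h1 extE => /leq_trans; apply; case/andP: (hmu' r).
have ov (r : 'I_a) (c : 'I_b) : (c < lam r)%N ->
    oval (grow lam t (r, c)) = if t (r, c) is Some v then nat_of_ord v else n.
  by move=> l; rewrite ffunE l; case: (t (r, c)).
have hsh : shrink (grow lam t) = t.
  apply/ffunP => -[r c]; rewrite !ffunE /=; case: ifP => l /=.
    case: (t (r, c)) => /= [v|]; first by rewrite valK.
    by rewrite insubF // ltnn.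
  by case e: (t (r, c)) => [v|] //; rewrite sub ?e in l.
have htab : box_tableau lam (grow lam t).
  apply/box_tableauP; split.
  - by move=> r c; rewrite ffunE /=; case: ifP => //= l; case: (t _).
  - move=> r c c' lt_c l l'; rewrite !ov //.
    case e': (t (r, c')) => [v'|]; last by case: (t (r, c)) => // v; apply: ltnW.
    have m' : (c' < ext mu r)%N by rewrite -h1 e'.
    have m : (c < ext mu r)%N by apply: ltn_trans m'.
    have := h2 r c c' lt_c m m'; rewrite e'.
    by have := h1 r c; rewrite m; case: (t (r, c)).
  - move=> r r' c lt_r l l'; rewrite !ov //.
    have m : (c < ext mu r)%N.
      rewrite extE; have /andP[le _] := hmu' r.
      exact: leq_trans l' (leq_trans (good_shape_le hlam lt_r) le).
    have := h1 r c; rewrite m; case e: (t (r, c)) => [v|] // _.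
    case e': (t (r', c)) => [v'|]; last exact: ltn_ord.
    have m' : (c < ext mu r')%N by rewrite -h1 e'.
    by have := h3 r r' c lt_r m m'; rewrite e e'.
split=> //; apply/ffunP => r; apply: val_inj => /=.
have hin := shrink_inner hlam htab.
have heq (c : 'I_b) : (c < inner (grow lam t) r)%N = (c < mu r)%N.
  by rewrite -hin hsh h1 extE.
apply/eqP; rewrite eqn_leq; apply/andP; split; rewrite leqNgt; apply/negP => lt.
  have hb : (mu r < b)%N by apply: leq_trans lt _; rewrite -ltnS.
  by have := heq (Ordinal hb); rewrite lt /= ltnn.
have hb : (inner (grow lam t) r < b)%N by apply: leq_trans lt _; rewrite -ltnS.
by have := heq (Ordinal hb); rewrite lt /= ltnn.
Qed.

Lemma shrinkK n lam (t : {ffun 'I_a * 'I_b -> option 'I_n.+1}) :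
  box_tableau lam t -> grow lam (shrink t) = t.
Proof.
move=> /box_tableauP[h1 _ _]; apply/ffunP => -[r c]; rewrite !ffunE /= -h1.
case: (t (r, c)) => //= v; case: insubP => [u lt e|] /=.
  by congr Some; apply: val_inj.
by rewrite -leqNgt => le; congr Some; apply: val_inj; apply/eqP; rewrite eqn_leq le -ltnS ltn_ord.
Qed.

Lemma card_strip_row (i j : nat) : (i <= b)%N -> (j <= i)%N ->
  #|[pred c : 'I_b | (c < i)%N && ~~ (c < j)%N]| = (i - j)%N.
Proof.
move=> le_i le_j.
have := cardID [pred c : 'I_b | (c < j)%N] [pred c : 'I_b | (c < i)%N].
rewrite card_lt_ord //.
rewrite (@eq_card _ [predI _ & _] [pred c : 'I_b | (c < j)%N]) => [|c]; last first.
  rewrite !inE andbC; case lt: (c < j)%N => //=; exact: leq_trans lt le_j.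
rewrite card_lt_ord ?(leq_trans le_j) // => /(canRL (addKn _)) <-.
by apply: eq_card => c; rewrite !inE andbC.
Qed.

Lemma tab_weight_shrink n lam (t : {ffun 'I_a * 'I_b -> option 'I_n.+1}) :
  good_shape lam -> box_tableau lam t ->
  tab_weight t = y n ^+ (\sum_(r < a) (lam r - inner t r)) * tab_weight (shrink t).
Proof.
move=> hlam ht; have [h1 _ _] := box_tableauP _ _ ht; have [_ g2 _] := hlam.
have /forallP hint := inner_interlace hlam ht.
rewrite -prodrXr.
under [X in X * _]eq_bigr => r _.
  have /andP[_ le] := hint r; rewrite -(card_strip_row (g2 r) le) -prodr_const big_mkcond /=.
  over.
rewrite pair_big /= /tab_weight -big_split /=; apply: eq_bigr => -[r c] _ /=.
rewrite inE /= -(shrink_inner hlam ht) shrink_neq_None -h1 ffunE.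
case: (t (r, c)) => [v|] /=; last by rewrite mul1r.
case: insubP => [u -> /= ->|/negbTE nlt]; first by rewrite mul1r.
rewrite nlt mulr1 /=; congr y; apply/eqP; rewrite eqn_leq -ltnS ltn_ord leqNgt.
by rewrite nlt.
Qed.

(** The branching rule: a tableau amounts to the shape of its entries below n, which interlaces with
    lam, and a tableau of that shape; each erased box contributes a factor [y n]. *)
Lemma tab_sum_branch n lam : good_shape lam ->
  tab_sum n.+1 lam = \sum_(mu | interlace lam mu)
    y n ^+ (\sum_(r < a) (lam r - mu r)) * tab_sum n (ext mu).
Proof.
move=> hlam; rewrite {1}/tab_sum.
rewrite (partition_big (@inner n) (interlace lam)) /=; last first.
  by move=> t; apply: inner_interlace.
apply: eq_bigr => mu hmu; rewrite /tab_sum mulr_sumr.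
rewrite (reindex_onto (grow lam) (@shrink n)) /=; last first.
  by move=> t /andP[ht _]; apply: shrinkK ht.
apply: eq_big => [t|t /andP[/andP[ht /eqP e] /eqP e']].
  apply/idP/idP => [/andP[/andP[ht /eqP <-] /eqP e]|ht].
    by rewrite -{2}e; apply: shrink_tableau ht.
  by have [-> -> ->] := grow_tableau hlam hmu ht; rewrite !eqxx.
by rewrite (tab_weight_shrink hlam ht) e e'.
Qed.

Lemma tab_sum0 lam : tab_sum 0 lam = [forall r : 'I_a, [forall c : 'I_b, ~~ (c < lam r)%N]]%:R.
Proof.
rewrite /tab_sum; pose t0 : {ffun 'I_a * 'I_b -> option 'I_0} := [ffun=> None].
have all0 t : t = t0.
  by apply/ffunP => x; rewrite ffunE; case: (t x) => // -[].
have -> : [forall r : 'I_a, [forall c : 'I_b, ~~ (c < lam r)%N]] = box_tableau lam t0.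
  apply/forallP/box_tableauP => [h|[h _ _] r].
    have h' (r : 'I_a) (c : 'I_b) : (c < lam r)%N = false by apply/negbTE; exact: (forallP (h r)).
    by split=> [r c|r c c' _|r r' c _]; rewrite ?ffunE h'.
  by apply/forallP => c; rewrite -h ffunE.
case ht: (box_tableau lam t0); last first.
  by rewrite big1 // => t; rewrite (all0 t) ht.
rewrite (big_pred1 t0) => [|t]; last by rewrite /= (all0 t) ht eqxx.
by rewrite /tab_weight big1 // => x _; rewrite ffunE.
Qed.

(** A strictly increasing column of more than n boxes cannot be filled. In the recursion,
    interlacing passes [lam n.+1 != 0] on to [mu n != 0]. *)
Lemma tab_sum_too_long n lam : good_shape lam -> lam n != 0%N -> tab_sum n lam = 0.
Proof.
elim: n lam => [|n IH] lam hlam nz.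
  rewrite tab_sum0; case: forallP => // h; have [g1 g2 g3] := hlam.
  have a0 : (0 < a)%N by rewrite lt0n; apply: contra nz => /eqP a0; rewrite g3 // a0.
  have b0 : (0 < b)%N by apply: leq_trans (g2 0%N); rewrite lt0n.
  by have /forallP/(_ (Ordinal b0)) := h (Ordinal a0); rewrite /= lt0n nz.
rewrite tab_sum_branch // big1 // => mu hmu; rewrite IH ?mulr0 //.
  exact: good_ext hmu.
have [g1 g2 g3] := hlam.
have ha : (n < a)%N.
  rewrite ltnNge; apply: contra nz => le; rewrite g3 //; exact: leqW.
have /forallP/(_ (Ordinal ha))/andP[/= le _] := hmu.
by rewrite (extE mu (Ordinal ha)) -lt0n (leq_trans _ le) // lt0n.
Qed.

End Tableaux.

(** * Alternants and their recursion in the number of variables *)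

Section Alternants.
Variables (S : comPzRingType) (y : nat -> S).
Implicit Types (lam : nat -> nat) (n : nat).

Definition alternant n lam : S :=
  \det (\matrix_(i < n, j < n) y i ^+ (lam j + (n.-1 - j))).

Lemma det_sum_col n (I : finType) (P : 'I_n -> pred I) (F : 'I_n -> 'I_n -> I -> S) :
  \det (\matrix_(i < n, j < n) \sum_(u | P j u) F i j u) =
  \sum_(f : {ffun 'I_n -> I} | [forall j, P j (f j)])
    \det (\matrix_(i < n, j < n) F i j (f j)).
Proof.
rewrite -det_tr /determinant.
transitivity (\sum_(f : {ffun 'I_n -> I} | [forall j, P j (f j)])
    \det (\matrix_(i < n, j < n) F i j (f j))^T); last first.
  by apply: eq_bigr => f _; rewrite det_tr.
rewrite /determinant exchange_big /=; apply: eq_bigr => s _; rewrite -mulr_sumr; congr (_ * _).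
under eq_bigr => i _ do rewrite !mxE.
rewrite bigA_distr_big_dep /=.
by apply: eq_big => [f|f _]; [|by apply: eq_bigr => i _; rewrite !mxE].
Qed.

Lemma geom_diff (u v : S) d :
  u ^+ d.+1 - v ^+ d.+1 = (u - v) * \sum_(m < d.+1) u ^+ m * v ^+ (d - m).
Proof.
rewrite subrXX; congr (_ * _); rewrite (reindex_inj rev_ord_inj) /=.
apply: eq_bigr => m _; rewrite subSS; congr (_ ^+ _ * _ ^+ _).
by rewrite subKn // -ltnS.
Qed.

(** What remains of the alternant in n+1 variables after elimination of the last one; the bound [bd]
    only makes the range of u finite. *)
Definition strip_mx n lam (bd : nat) :=
  \matrix_(i < n, j < n) \sum_(u < bd.+1 | (lam j.+1 <= u)%N && (u <= lam j)%N)
     (y n ^+ (lam j - u) * y i ^+ (u + (n.-1 - j))).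

(** Subtracting from column j the multiple of column j+1 that clears the last row leaves a single
    entry there. In the other rows each entry becomes a multiple of a difference of powers,
    divisible by [y i - y n], and the quotient is a geometric sum over the interlacing values. *)
Lemma alternant_col n lam bd : (forall r, (lam r.+1 <= lam r)%N) ->
  (forall r, (lam r <= bd)%N) ->
  alternant n.+1 lam =
  y n ^+ lam n * (\prod_(i < n) (y i - y n)) * \det (strip_mx n lam bd).
Proof.
move=> dec bnd; pose l j := (lam j + (n - j))%N.
have ldec (j : nat) : (j < n)%N -> (l j.+1 < l j)%N.
  by move=> lt; rewrite /l; have := dec j; lia.
pose U : 'M[S]_n.+1 := \matrix_(i, j)
  ((i == j)%:R - ((i == j.+1 :> nat)%:R * y n ^+ (l j - l j.+1))).
have detU : \det U = 1.
  rewrite det_trig; last first.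
    apply/is_trig_mxP => i j lt; rewrite mxE.
    have -> : (i == j) = false by apply/eqP => e; rewrite e ltnn in lt.
    have -> : (i == j.+1 :> nat) = false by apply/eqP; lia.
    by rewrite mul0r subrr.
  rewrite big1 // => i _; rewrite mxE eqxx.
  have -> : (nat_of_ord i == i.+1) = false by apply/eqP; lia.
  by rewrite mul0r subr0.
rewrite /alternant; set Y := \matrix_(i, j) _; set Z := Y *m U.
have -> : \det Y = \det Z by rewrite det_mulmx detU mulr1.
have ZE i j : Z i j = y i ^+ l j -
    (if (j < n)%N then y i ^+ l j.+1 * y n ^+ (l j - l j.+1) else 0).
  rewrite mxE; under eq_bigr => k _ do rewrite !mxE mulrBr.
  rewrite big_split /= sumrN; congr (_ - _).
    rewrite (bigD1 j) //= eqxx mulr1 big1 ?addr0 // => k /negbTE ->.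
    by rewrite mulr0.
  case: ifP => lt; last first.
    rewrite big1 // => k _; have -> : (nat_of_ord k == j.+1) = false.
      by apply/eqP; have := ltn_ord k; lia.
    by rewrite mul0r mulr0.
  rewrite (bigD1 (Ordinal (lt : (j.+1 < n.+1)%N))) //= eqxx mul1r big1 ?addr0 // => k.
  by rewrite -val_eqE /= => /negbTE ->; rewrite mul0r mulr0.
rewrite (expand_det_row _ ord_max) big_ord_recr /= big1 ?add0r; last first.
  move=> j _; rewrite ZE /= ltn_ord -exprD subnKC ?subrr ?mul0r //.
  exact/ltnW/ldec.
rewrite ZE ltnn subr0 /= /l subnn addn0 -mulrA; congr (_ * _).
rewrite /cofactor addnn -signr_odd odd_double expr0 mul1r.
have E : row' ord_max (col' ord_max Z) =
    diag_mx (\row_(i < n) (y i - y n)) *m strip_mx n lam bd :> 'M_n.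
  apply/matrixP => i j; rewrite mul_diag_mx [LHS]mxE [LHS]mxE ZE !mxE.
  have e (k : 'I_n) : lift ord_max k = k :> nat by rewrite /= /bump leqNgt ltn_ord.
  rewrite !e ltn_ord.
  have [d dE] : exists d, lam j = (d + lam j.+1)%N.
    by exists (lam j - lam j.+1)%N; rewrite subnK.
  have lE : (l j - l j.+1 = d.+1)%N by rewrite /l dE; have := ltn_ord j; lia.
  have lE' : l j = (d.+1 + l j.+1)%N by rewrite -lE subnK // ltnW // ldec.
  rewrite lE lE' addnC exprD -mulrBr geom_diff mulrCA; congr (_ * _).
  rewrite mulr_sumr.
  transitivity (\sum_(lam j.+1 <= u < (lam j).+1)
     (y n ^+ (lam j - u) * y i ^+ (u + (n.-1 - j)))).
    rewrite -{1}[lam j.+1]add0n big_addn big_mkord.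
    have -> : ((lam j).+1 - lam j.+1 = d.+1)%N by rewrite dE; lia.
    apply: eq_bigr => m _; rewrite mulrA [RHS]mulrC -exprD; congr (_ ^+ _ * _ ^+ _).
      by rewrite /l; have := ltn_ord j; lia.
    by rewrite dE; lia.
  rewrite big_geq_mkord (big_ord_widen_cond bd.+1 (fun u => lam j.+1 <= u)%N
    (fun u => y n ^+ (lam j - u) * y i ^+ (u + (n.-1 - j)))) //.
  by rewrite ltnS bnd.
  rewrite [LHS](congr1 (@determinant S n) E) det_mulmx det_diag; congr (_ * _).
by apply: eq_bigr => i _; rewrite mxE.
Qed.

Lemma det_strip n lam bd :
  \det (strip_mx n lam bd) =
  \sum_(f : {ffun 'I_n -> 'I_bd.+1} | [forall j : 'I_n, (lam j.+1 <= f j)%N && (f j <= lam j)%N])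
    y n ^+ (\sum_(j < n) (lam j - f j)) *
    \det (\matrix_(i < n, j < n) y i ^+ (f j + (n.-1 - j))).
Proof.
rewrite det_sum_col; apply: eq_bigr => f _.
rewrite -prodrXr.
have -> : \matrix_(i, j) (y n ^+ (lam j - f j) * y i ^+ (f j + (n.-1 - j))) =
    (\matrix_(i < n, j < n) y i ^+ (f j + (n.-1 - j))) *m
    diag_mx (\row_(j < n) y n ^+ (lam j - f j)).
  by apply/matrixP => i j; rewrite mul_mx_diag !mxE mulrC.
rewrite det_mulmx det_diag mulrC; congr (_ * _).
by apply: eq_bigr => j _; rewrite mxE.
Qed.

Lemma sum_vanish (D : nat -> nat) p q :
  (forall r, (p <= r)%N -> D r = 0%N) -> (forall r, (q <= r)%N -> D r = 0%N) ->
  (\sum_(r < p) D r = \sum_(r < q) D r)%N.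
Proof.
move=> hp hq; wlog le : p q hp hq / (p <= q)%N.
  by move=> W; case: (leqP p q) => [|/ltnW] le; [apply: W|apply/esym/W].
rewrite (big_ord_widen q D le) [in RHS](bigID (fun r : 'I_q => (r < p)%N)) /=.
by rewrite [X in (_ + X)%N]big1 ?addn0 // => r; rewrite -leqNgt => /hp.
Qed.

(** The bialternant formula. Both sides obey the same recursion in n: branching for tableaux, column
    elimination for alternants. Shapes with [mu n != 0] occur only on the tableau side, where they
    contribute 0. *)
Lemma alternant_tab_sum a b n lam : good_shape a b lam -> lam n = 0%N ->
  alternant n (fun=> 0%N) * tab_sum y a b n lam = alternant n lam.
Proof.
elim: n lam => [|n IH] lam hlam lam0.
  have lz r : lam r = 0%N.
    by apply/eqP; rewrite -leqn0 -lam0; apply: good_shape_le hlam _.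
  rewrite tab_sum0 /alternant !det_mx00 mul1r.
  by case: forallP => // -[] r; apply/forallP => c; rewrite lz.
have [g1 g2 g3] := hlam.
rewrite tab_sum_branch // !(alternant_col _ (bd := b)) // !det_strip expr0 mul1r.
rewrite [X in _ * X * _](big_pred1 [ffun=> ord0]); last first.
  move=> f /=; apply/forallP/eqP => [h|-> j]; last by rewrite ffunE.
  by apply/ffunP => j; apply: val_inj; rewrite ffunE /=; apply/eqP; rewrite -leqn0; have := h j.
rewrite (_ : (\sum_(j < n) (0 - [ffun=> @ord0 b] j))%N = 0%N); last by rewrite big1.
rewrite expr0 mul1r.
have -> : \det (\matrix_(i < n, j < n) y i ^+ ([ffun=> @ord0 b] j + (n.-1 - j))) =
    alternant n (fun=> 0%N).
  by congr (\det _); apply/matrixP => i j; rewrite !mxE ffunE.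
move: (alternant n (fun=> 0%N)) IH => A0 IH.
rewrite [y n ^+ _ * _]mulrC -!mulrA; congr (_ * _).
rewrite [LHS]mulr_sumr [RHS]mulr_sumr.
rewrite (bigID (fun mu => ext mu n == 0%N)) /= [X in _ + X]big1 ?addr0; last first.
  move=> mu /andP[hmu nz].
  by rewrite (tab_sum_too_long _ (good_ext hlam hmu) nz) !mulr0.
(* [F] and [G] translate between shapes indexed by the a rows of the box and by the n columns of the
   determinant, padding with 0. They are inverse on the shapes that are left, whose rows from n on
   vanish. *)
pose F (mu : {ffun 'I_a -> 'I_b.+1}) : {ffun 'I_n -> 'I_b.+1} := [ffun j => inord (ext mu (nat_of_ord j))].
pose G (f : {ffun 'I_n -> 'I_b.+1}) : {ffun 'I_a -> 'I_b.+1} :=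
  [ffun r => if insub (nat_of_ord r) is Some j then f j else ord0].
have FE mu (j : 'I_n) : F mu j = ext mu j :> nat.
  rewrite ffunE inordK // ltnS /ext; case: insub => // i; exact: leq_ord.
have GE f r : ext (G f) r = if (r < a)%N then (if insub r is Some j then nat_of_ord (f j) else 0%N) else 0%N.
  case: ifP => hr; last by rewrite ext_oob // leqNgt hr.
  by rewrite (extE _ (Ordinal hr)) ffunE /=; case: insubP.
rewrite (reindex_onto G F) /=; last first.
  move=> mu /andP[hmu /eqP e]; apply/ffunP => r; apply: val_inj.
  rewrite ffunE /=; case: insubP => [j lt ej|] /=; first by rewrite FE ej extE.
  rewrite -leqNgt => le; rewrite -extE; apply/esym/eqP; rewrite -leqn0 -e.
  exact: good_shape_le (good_ext hlam hmu) le.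
apply: eq_big => [f|f /andP[/andP[hmu /eqP e] /eqP FG]].
  apply/idP/idP => [/andP[/andP[hmu /eqP e] /eqP <-]|/forallP hf].
    apply/forallP => j; rewrite FE; case: (ltnP j a) => hj.
      by rewrite (extE _ (Ordinal hj)); apply: (forallP hmu).
    by rewrite ext_oob // !g3 // leqW.
  have GE' (j : 'I_n) : ext (G f) j = f j.
    rewrite GE; case: ifP => hj; first by rewrite valK.
    have haj : (a <= j)%N by rewrite leqNgt hj.
    by have /andP[_] := hf j; rewrite (g3 j) // leqn0 => /eqP.
  apply/andP; split; [apply/andP; split|].
  - apply/forallP => r; rewrite -extE GE ltn_ord; case: insubP => [j lt ej|].
      by rewrite -ej; apply: hf.
    rewrite -leqNgt => le; have := good_shape_le hlam (le : (n.+1 <= r.+1)%N).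
    by rewrite lam0 leqn0 => /eqP ->.
  - by rewrite GE insubF ?ltnn // if_same.
  - by apply/eqP/ffunP => j; apply: val_inj; rewrite /= FE GE'.
rewrite mulrCA (IH _ (good_ext hlam hmu) e).
rewrite mulrA -exprD; congr (_ ^+ _ * _); last first.
  congr (\det _); apply/matrixP => i j; rewrite !mxE; congr (_ ^+ (_ + _)).
  by rewrite -FE FG.
rewrite addnC; transitivity (\sum_(r < a) (lam r - ext (G f) r))%N.
  by apply: eq_bigr => r _; rewrite extE.
rewrite (@sum_vanish (fun r => lam r - ext (G f) r)%N a n.+1); last 2 first.
- by move=> r le; rewrite g3.
- move=> r le; have : (lam r <= 0)%N by rewrite -lam0; apply: good_shape_le hlam le.
  by rewrite leqn0 => /eqP ->.
rewrite big_ord_recr /= e subn0; congr (_ + _)%N.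
by apply: eq_bigr => j _; rewrite -FE FG.
Qed.

End Alternants.

(** * Antisymmetric polynomials and expansion in Schur polynomials *)

Section SchurAlternant.
Variable n : nat.

(** The bialternant recursion lowers the number of variables inside a fixed ring, hence variables
    indexed by all of nat. *)
Definition Xnat (i : nat) : {mpoly int[n]} := if insub i is Some v then 'X_v else 0.

Lemma XnatE (v : 'I_n) : Xnat v = 'X_v.
Proof. by rewrite /Xnat valK. Qed.

Lemma part_sorted la i j : is_part la -> (i <= j)%N -> (nth 0 la j <= nth 0 la i)%N.
Proof.
case/andP => srt _ le; case: (ltnP j (size la)) => hj; last by rewrite nth_default.
have tr : transitive geq by move=> u v w h1 h2; apply: leq_trans h2 h1.
by apply: (sorted_leq_nth tr leqnn) => //; rewrite inE // (leq_ltn_trans le).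
Qed.

Lemma foldr_maxn_ge (la : seq nat) i : (nth 0 la i <= foldr maxn 0 la)%N.
Proof.
elim: la i => [|x la IH] [|i] //=; first by rewrite leq_maxl.
by rewrite leq_max IH orbT.
Qed.

Lemma good_part la : is_part la -> good_shape (size la) (foldr maxn 0 la) (nth 0%N la).
Proof.
move=> h; split=> [r|r|r hr]; [exact: part_sorted|exact: foldr_maxn_ge|exact: nth_default].
Qed.

Lemma schur_tab_sum la :
  schur n la = tab_sum Xnat (size la) (foldr maxn 0 la) n (nth 0%N la).
Proof.
apply: eq_big => // t _; apply: eq_bigr => x _.
by case: (t x) => // v; rewrite XnatE.
Qed.

Lemma alternant_schur la : is_part la -> (size la <= n)%N ->
  alternant Xnat n (fun=> 0%N) * schur n la = alternant Xnat n (nth 0%N la).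
Proof.
move=> hla hs; rewrite schur_tab_sum alternant_tab_sum //; first exact: good_part.
exact: nth_default.
Qed.

Lemma schur_too_long la : is_part la -> (n < size la)%N -> schur n la = 0.
Proof.
move=> hla hs; rewrite schur_tab_sum tab_sum_too_long //; first exact: good_part.
by have /andP[_] := hla; apply: contra => /eqP <-; apply: mem_nth.
Qed.

Definition alt_mon (lam : nat -> nat) (s : 'S_n) : 'X_{1..n} :=
  [multinom (lam (s i) + (n.-1 - s i))%N | i < n].

Lemma alternantE (lam : nat -> nat) :
  alternant Xnat n lam = \sum_(s : 'S_n) (-1) ^+ s *: 'X_[alt_mon lam s].
Proof.
apply: eq_bigr => s _; rewrite scaler_sign; rewrite mulr_sign; congr (if _ then - _ else _);
  rewrite mpolyXE_id; apply: eq_bigr => i _; rewrite !mxE XnatE mnmE //.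
Qed.

Definition mantisym (p : {mpoly int[n]}) := forall s : 'S_n, msym s p = (-1) ^+ s *: p.

Lemma alternant_antisym lam : mantisym (alternant Xnat n lam).
Proof.
move=> s; apply/mpolyP => m; rewrite mcoeff_sym mcoeffZ !alternantE.
rewrite !(raddf_sum (mcoeff _)) /= mulr_sumr (reindex_inj (mulgI s)) /=.
apply: eq_bigr => t _; rewrite !mcoeffZ !mcoeffX odd_permM signr_addb -mulrA.
congr (_ * (_ * (nat_of_bool _)%:R)).
apply/idP/idP => /eqP/mnmP h; apply/eqP/mnmP => i.
  have := h ((s^-1)%g i); rewrite !mnmE permM permKV => ->.
  by [].
by have := h (s i); rewrite !mnmE permM.
Qed.

Lemma perm_sort_desc (m : 'I_n -> nat) :
  exists s : 'S_n, forall i j : 'I_n, (i <= j)%N -> (m (s j) <= m (s i))%N.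
Proof.
pose t := [tuple m i | i < n].
have hs : size (sort geq t) == n by rewrite size_sort size_tuple.
have /tuple_permP[s hp] : perm_eq (Tuple hs) t by rewrite /= perm_sort.
exists s => i j le.
have E k : m (s k) = nth 0%N (sort geq t) k.
  have -> : sort geq t = Tuple hs by [].
  by rewrite hp -tnth_nth !tnth_mktuple.
rewrite !E.
have tr : transitive geq by move=> u v w h1 h2; apply: leq_trans h2 h1.
apply: (sorted_leq_nth tr leqnn) => //; rewrite ?inE ?(eqP hs) //.
by apply: sort_sorted => u v; apply: leq_total.
Qed.

Lemma perm_increasing (s : 'S_n) :
  (forall i j : 'I_n, (i < j)%N -> (s i < s j)%N) -> s = 1%g.
Proof.
have key (u : 'S_n) : (forall i j : 'I_n, (i < j)%N -> (u i < u j)%N) ->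
    forall i : 'I_n, (i <= u i)%N.
  move=> h [k hk]; elim: k hk => [|k IH] hk //.
  have hk' : (k < n)%N by apply: ltn_trans hk.
  by apply: leq_ltn_trans (IH hk') (h (Ordinal hk') (Ordinal hk) (ltnSn k)).
move=> h; have h' (i j : 'I_n) : (i < j)%N -> (s^-1%g i < s^-1%g j)%N.
  move=> lt; rewrite ltnNge leq_eqVlt; apply/negP => /orP[/eqP/val_inj/perm_inj e|/h].
    by rewrite e ltnn in lt.
  by rewrite !permKV => lt'; have := ltn_trans lt lt'; rewrite ltnn.
apply/permP => i; rewrite perm1; apply: val_inj; apply/eqP; rewrite eqn_leq key //.
have := key _ h' i; rewrite leq_eqVlt => /orP[/eqP/val_inj e|/h]; last by rewrite permKV => /ltnW ->.
by rewrite {1}e permKV leqnn.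
Qed.

Definition mdecr (m : 'X_{1..n}) := forall i j : 'I_n, (i < j)%N -> (m j < m i)%N.

(** A permutation sorts the exponents at the cost of a sign, and a repeated exponent makes the
    coefficient equal to its own opposite; only strictly decreasing exponents are left. *)
Lemma mantisym_eq0 p : mantisym p -> (forall m, mdecr m -> p@_m = 0) -> p = 0.
Proof.
move=> anti h; apply/mpolyP => m; rewrite mcoeff0.
have [s hs] := perm_sort_desc m.
suff : p@_[multinom m (s i) | i < n] = 0.
  rewrite -mcoeff_sym anti mcoeffZ => /eqP; rewrite mulf_eq0 signr_eq0 /= => /eqP //.
set m' := [multinom m (s i) | i < n].
have hm' (i j : 'I_n) : (i <= j)%N -> (m' j <= m' i)%N by rewrite !mnmE; apply: hs.
have [/forallP dec|] := boolP [forall i : 'I_n, [forall j : 'I_n, (i < j)%N ==> (m' j < m' i)%N]].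
  by apply: h => i j lt; have /forallP/(_ j)/implyP := dec i; apply.
case/forallPn => i /forallPn[j]; rewrite negb_imply -leqNgt => /andP[lt le].
have e : m' i = m' j by apply/eqP; rewrite eqn_leq le hm' // ltnW.
have := anti (tperm i j); move/(congr1 (mcoeff m')); rewrite mcoeff_sym mcoeffZ odd_tperm.
have -> : (i != j) by apply: contraTneq lt => ->; rewrite ltnn.
have -> : [multinom m' (tperm i j k) | k < n] = m'.
  by apply/mnmP => k; rewrite [LHS]mnmE; case: tpermP => [->|->|].
rewrite expr1 mulN1r => /eqP; rewrite -addr_eq0 -mulr2n mulrn_eq0 /= => /eqP //.
Qed.

(** Of all permuted exponent vectors of the alternant only that of the identity is strictly
    decreasing. *)
Lemma mcoeff_alternant (lam : nat -> nat) m :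
  (forall i j, (i <= j)%N -> (lam j <= lam i)%N) -> mdecr m ->
  (alternant Xnat n lam)@_m = (m == alt_mon lam 1)%:R.
Proof.
move=> hlam hm; rewrite alternantE raddf_sum /= (bigD1 1%g) //= big1 ?addr0.
  by rewrite mcoeffZ mcoeffX odd_perm1 expr0 mul1r eq_sym.
move=> s ns; rewrite mcoeffZ mcoeffX; case: eqP => [e|]; last by rewrite mulr0.
case/eqP: ns; apply: perm_increasing => i j lt.
have := hm i j lt; rewrite -e !mnmE.
have := ltn_ord (s i); have := ltn_ord (s j).
case: (ltnP (s i) (s j)) => // le; have := hlam _ _ le; lia.
Qed.

Lemma alt_mon_decr lam : (forall i j, (i <= j)%N -> (lam j <= lam i)%N) -> mdecr (alt_mon lam 1).
Proof.
move=> h i j lt; rewrite !mnmE !perm1; have := h _ _ (ltnW lt).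
have := ltn_ord j; lia.
Qed.

Definition part_of (f : nat -> nat) : seq nat := [seq x <- mkseq f n | x != 0%N].

Lemma nth_filter0 (s : seq nat) i : sorted geq s ->
  nth 0%N [seq x <- s | x != 0%N] i = nth 0%N s i.
Proof.
elim: s i => [|x s IH] i //= hs; have tr : transitive geq.
  by move=> u v w h1 h2; apply: leq_trans h2 h1.
case: eqP => [x0|_] /=; last by case: i => //= i; apply: IH; apply: path_sorted hs.
have all0 : all (pred1 0%N) s.
  move: hs; rewrite path_sortedE // => /andP[/allP h _]; apply/allP => z /h /=.
  by rewrite x0 leqn0.
have -> : [seq x <- s | x != 0%N] = [::].
  by apply/eqP; rewrite -[_ == _]negbK -has_filter -all_predC; apply: sub_all all0 => z /= ->.
rewrite nth_nil x0; case: i => //= i; case: (ltnP i (size s)) => hi; last by rewrite nth_default.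
by have /(_ i hi)/eqP -> := all_nthP 0%N all0.
Qed.

Lemma part_ofP f : (forall i j, (i <= j)%N -> (j < n)%N -> (f j <= f i)%N) ->
  [/\ is_part (part_of f), (size (part_of f) <= n)%N &
      forall i, (i < n)%N -> nth 0%N (part_of f) i = f i].
Proof.
move=> h; have srt : sorted geq (mkseq f n).
  apply/(sortedP 0%N) => i; rewrite size_mkseq => hi.
  by rewrite !nth_mkseq // ?(ltn_trans _ hi) //; apply: h.
have tr : transitive geq by move=> u v w h1 h2; apply: leq_trans h2 h1.
split.
- rewrite /is_part (sorted_filter tr) //=; by rewrite mem_filter.
- by rewrite size_filter -[X in (_ <= X)%N](size_mkseq f) count_size.
- by move=> i hi; rewrite nth_filter0 // nth_mkseq.
Qed.

Lemma part_inj la mu : is_part la -> is_part mu ->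
  (forall i, nth 0%N la i = nth 0%N mu i) -> la = mu.
Proof.
have sz ka : is_part ka -> forall i, (i < size ka)%N = (nth 0%N ka i != 0%N).
  move=> /andP[_ h] i; case: (ltnP i (size ka)) => hi; last by rewrite nth_default.
  by apply/esym; apply: contra h => /eqP <-; apply: mem_nth.
move=> h1 h2 e; apply: (@eq_from_nth _ 0%N) => // ; apply/eqP; rewrite eqn_leq.
have E i : (i < size la)%N = (i < size mu)%N by rewrite !sz // e.
apply/andP; split; rewrite leqNgt; apply/negP => lt.
  by have := E (size mu); rewrite lt ltnn.
by have := E (size la); rewrite lt ltnn.
Qed.

Lemma alternant0_neq0 : alternant Xnat n (fun=> 0%N) != 0.
Proof.
apply/eqP => /(congr1 (mcoeff (alt_mon (fun=> 0%N) 1))).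
by rewrite mcoeff_alternant ?mcoeff0 ?eqxx //; apply: alt_mon_decr.
Qed.

(** A strictly decreasing exponent is delta plus a partition. So finitely many alternants are
    candidates, and the coefficient of each is read off at its leading exponent. *)
Lemma mantisym_expansion p : mantisym p ->
  exists (c : seq nat -> int) (S : seq (seq nat)),
  [/\ uniq S, all (fun la => is_part la && (size la <= n)%N) S,
      (forall la, la \notin S -> c la = 0)
    & p = \sum_(la <- S) c la *: alternant Xnat n (nth 0%N la)].
Proof.
move=> anti; pose d := msize p.
pose ok (la : seq nat) := is_part la && (size la <= n)%N.
pose S := undup [seq la <- [seq part_of (fun i => if insub i is Some v then nat_of_ord (f v) else 0%N) |
    f : {ffun 'I_n -> 'I_d}] | ok la].
pose c la := if la \in S then p@_(alt_mon (nth 0%N la) 1) else 0.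
have okS la : la \in S -> ok la by rewrite mem_undup mem_filter => /andP[].
have decS la : la \in S -> forall i j, (i <= j)%N -> (nth 0%N la j <= nth 0%N la i)%N.
  by move=> /okS /andP[h _] i j; apply: part_sorted.
exists c, S; split.
- exact: undup_uniq.
- by apply/allP => la /okS.
- by move=> la /negbTE h; rewrite /c h.
apply/eqP; rewrite -subr_eq0; apply/eqP; apply: mantisym_eq0.
  move=> s; rewrite msymB anti scalerBr; congr (_ - _).
  rewrite (raddf_sum (msym s)) scaler_sumr; apply: eq_bigr => la _.
  by rewrite /= msymZ alternant_antisym !scalerA mulrC.
move=> m hm; rewrite mcoeffB raddf_sum /=; apply/eqP; rewrite subr_eq0; apply/eqP.
have cE la : la \in S -> c la * (alternant Xnat n (nth 0%N la))@_m =
    p@_m * (m == alt_mon (nth 0%N la) 1)%:R.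
  move=> h; rewrite mcoeff_alternant //; last exact: decS.
  by rewrite /c h; case: eqP => [<-//|]; rewrite !mulr0.
under eq_bigr => la _ do rewrite mcoeffZ.
rewrite big_seq (eq_bigr _ cE) -big_seq.
have [->|nz] := eqVneq (p@_m) 0; first by rewrite big1 // => la _; rewrite mul0r.
have hge (v : 'I_n) : (n.-1 - v <= m v)%N.
  case: v => k hk; have [q e] : exists q, (k + q = n.-1)%N.
    by exists (n.-1 - k)%N; rewrite subnKC //; lia.
  rewrite /= -e addKn; elim: q k hk e => [|q IH] k hk e //.
  have hk1 : (k.+1 < n)%N by lia.
  by apply: leq_ltn_trans (IH _ hk1 _) (hm (Ordinal hk) (Ordinal hk1) (ltnSn k)); lia.
have hlt (v : 'I_n) : (m v - (n.-1 - v) < d)%N.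
  apply: leq_ltn_trans (leq_subr _ _) _; apply: leq_ltn_trans (_ : mdeg m < d)%N.
    by rewrite mdegE (bigD1 v) //= leq_addr.
  by apply: msize_mdeg_lt; rewrite mcoeff_msupp.
pose f : {ffun 'I_n -> 'I_d} := [ffun v => Ordinal (hlt v)].
pose fn i := if insub i is Some v then nat_of_ord (f v) else 0%N.
have fnE (v : 'I_n) : fn v = (m v - (n.-1 - v))%N by rewrite /fn valK ffunE.
have [la1 la2 la3] : [/\ is_part (part_of fn), (size (part_of fn) <= n)%N &
      forall i, (i < n)%N -> nth 0%N (part_of fn) i = fn i].
  apply: part_ofP => i j le hj; have hi : (i < n)%N by apply: leq_ltn_trans hj.
  rewrite (fnE (Ordinal hi)) (fnE (Ordinal hj)) /=.
  have [e|lt] := eqVneq i j; first by subst i; rewrite (bool_irrelevance hi hj).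
  have hd k q (hk : (k < n)%N) (hq : (k + q < n)%N) : (m (Ordinal hq) + q <= m (Ordinal hk))%N.
    elim: q hq => [|q IH] hq.
      by rewrite addn0; have -> : Ordinal hq = Ordinal hk by apply: val_inj; rewrite /= addn0.
    have hq' : (k + q < n)%N by lia.
    have := hm (Ordinal hq') (Ordinal hq); rewrite /= => /(_ ltac:(lia)).
    have := IH hq'; lia.
  have hj' : (i + (j - i) < n)%N by rewrite subnKC.
  have := hd i (j - i)%N hi hj'; have -> : Ordinal hj' = Ordinal hj by apply: val_inj; rewrite /= subnKC.
  by have := hge (Ordinal hj); have := hge (Ordinal hi); rewrite /=; lia.
have mE : m = alt_mon (nth 0%N (part_of fn)) 1.
  by apply/mnmP => v; rewrite mnmE perm1 la3 // fnE subnK // hge.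
have inS : part_of fn \in S.
  rewrite mem_undup mem_filter /ok la1 la2 /=; apply/mapP; exists f => //.
  by rewrite mem_enum.
rewrite (bigD1_seq _ inS) ?undup_uniq //= -mE eqxx mulr1 big1_seq ?addr0 // => la /andP[nla laS].
case: eqP => [e|]; last by rewrite mulr0.
case/eqP: nla; have /andP[ok1 ok2] := okS _ laS; apply: part_inj => // i.
case: (ltnP i n) => hi; last by rewrite !nth_default // (leq_trans _ hi).
have /mnmP/(_ (Ordinal hi)) := e; rewrite {1}mE !mnmE !perm1 /=; lia.
Qed.

(** Numerator and denominator of the bialternant formula are both antisymmetric. *)
Lemma schur_sym la s : is_part la -> msym s (schur n la) = schur n la.
Proof.
move=> hla; case: (ltnP n (size la)) => hs.
  by rewrite schur_too_long // msym0.
have anti := alternant_antisym (nth 0%N la).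
have := anti s; rewrite -alternant_schur // msymM alternant_antisym -scalerAl.
move/(congr1 (fun p => (-1) ^+ s *: p)); rewrite !scalerA -!expr2 sqrr_sign !scale1r.
by move/(mulfI alternant0_neq0).
Qed.

Lemma LR_expansion lams : all is_part lams ->
  exists c, schur_expansion (\prod_(la <- lams) schur n la) c.
Proof.
move=> hl; pose A0 := alternant Xnat n (fun=> 0%N).
have [c [S [h1 h2 h3 h4]]] : exists (c : seq nat -> int) (S : seq (seq nat)),
  [/\ uniq S, all (fun la => is_part la && (size la <= n)%N) S,
      (forall la, la \notin S -> c la = 0)
    & A0 * \prod_(la <- lams) schur n la =
      \sum_(la <- S) c la *: alternant Xnat n (nth 0%N la)].
  apply: mantisym_expansion => s; rewrite msymM alternant_antisym -scalerAl.
  congr (_ *: (_ * _)); rewrite rmorph_prod /= !big_seq; apply: eq_bigr => la hla.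
  by rewrite schur_sym // (allP hl).
exists c; exists S; split=> //; apply: (mulfI alternant0_neq0).
rewrite h4 mulr_sumr !big_seq; apply: eq_bigr => la hla; rewrite -scalerAr.
by have /andP[u v] := allP h2 _ hla; rewrite alternant_schur.
Qed.

(** The coefficient is determined by the expanded polynomial, so it does not matter which expansion
    [epsilon] picks in [LRcoef]. *)
Lemma schur_expansion_coeff p c mu : schur_expansion p c -> is_part mu -> (size mu <= n)%N ->
  c mu = (alternant Xnat n (fun=> 0%N) * p)@_(alt_mon (nth 0%N mu) 1).
Proof.
move=> [S [h1 h2 h3 ->]] hmu smu; rewrite mulr_sumr raddf_sum /= big_seq.
have E la : la \in S ->
   (alternant Xnat n (fun=> 0%N) * (c la *: schur n la))@_(alt_mon (nth 0%N mu) 1) =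
   c la * (la == mu)%:R.
  move=> hla; have /andP[u v] := allP h2 _ hla.
  rewrite -scalerAr mcoeffZ alternant_schur // mcoeff_alternant; last 2 first.
  - by move=> i j; apply: part_sorted.
  - by apply: alt_mon_decr => i j; apply: part_sorted.
  congr (_ * (nat_of_bool _)%:R); apply/eqP/eqP => [/mnmP e|->//].
  apply: part_inj => // i; case: (ltnP i n) => hi; last by rewrite !nth_default // (leq_trans _ hi).
  by have := e (Ordinal hi); rewrite !mnmE !perm1 /=; lia.
rewrite (eq_bigr _ E) -big_seq; case hS: (mu \in S).
  rewrite (bigD1_seq _ hS) //= eqxx mulr1 big1 ?addr0 // => la /negbTE ->.
  by rewrite mulr0.
rewrite h3 ?hS // big1_seq // => la /andP[_ hla]; case: eqP => [e|]; last by rewrite mulr0.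
by rewrite -e hla in hS.
Qed.

End SchurAlternant.

Lemma LRcoefE lams mu n : all is_part lams -> is_part mu -> size mu = n ->
  LRcoef lams mu =
  (alternant (@Xnat n) n (fun=> 0%N) * \prod_(la <- lams) schur n la)@_(alt_mon (nth 0%N mu) 1).
Proof.
move=> hl hmu <-; rewrite /LRcoef; apply: schur_expansion_coeff => //.
exact: (epsilon_spec _ _ (LR_expansion _ hl)).
Qed.

(** * Jacobi-Trudi and the signed count *)

Section JacobiTrudi.
Variables (S : comNzRingType) (y : nat -> S) (B n : nat).

(** The series 1/(1 - y_j X) truncated after degree B; up to that degree the coefficients of the
    product [hser] are the complete homogeneous polynomials. *)
Definition geom (j : nat) : {poly S} := \poly_(p < B.+1) y j ^+ p.

Definition hser : {poly S} := \prod_(j < n) geom j.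

Lemma hserE : hser = \sum_(f : {ffun 'I_n -> 'I_B.+1})
  (\prod_(j < n) y j ^+ f j) *: 'X^(\sum_(j < n) f j).
Proof.
rewrite /hser; under eq_bigr => j _ do rewrite /geom poly_def.
rewrite bigA_distr_bigA /=; apply: eq_bigr => f _.
rewrite scaler_prod; congr (_ *: _).
by elim/big_rec2: _ => [|j u v _ ->]; rewrite ?expr0 // exprD.
Qed.

Lemma geomM j : (1 - y j *: 'X) * geom j = 1 - y j ^+ B.+1 *: 'X^(B.+1).
Proof.
rewrite /geom poly_def mulrBl mul1r mulr_sumr.
rewrite big_ord_recl [in X in _ - X]big_ord_recr /= expr0 scale1r expr0.
rewrite -scalerAl -scalerAr scalerA -!exprS opprD addrA; congr (_ - _).
rewrite -addrA -[RHS]addr0; congr (_ + _); apply/eqP; rewrite subr_eq0; apply/eqP.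
by apply: eq_bigr => i _; rewrite /bump /= add1n -scalerAl -scalerAr scalerA -!exprS.
Qed.

Lemma coef_trunc (p : {poly S}) c m : (m <= B)%N -> (p * (1 - c *: 'X^(B.+1)))`_m = p`_m.
Proof.
move=> le; rewrite mulrBr mulr1 coefB -scalerAr coefZ coefMXn ltnS le mulr0 subr0 //.
Qed.

(** Cancels all factors of [hser] but the i-th modulo X^(B+1), which leaves the powers of [y i] as
    coefficients. *)
Definition hker (i : 'I_n) : {poly S} := \prod_(j < n | j != i) (1 - y j *: 'X).

Lemma hkerM (i : 'I_n) m : (m <= B)%N -> (hker i * hser)`_m = y i ^+ m.
Proof.
move=> le; rewrite /hser (bigD1 i) //= mulrCA -big_split /=.
rewrite (eq_bigr _ (fun (j : 'I_n) _ => geomM j)).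
have -> : (geom i * \prod_(j < n | j != i) (1 - y j ^+ B.+1 *: 'X^(B.+1)))`_m = (geom i)`_m.
  move: (geom i) => p; elim/big_rec: _ => [|j u _ IH]; first by rewrite mulr1.
  by rewrite mulrCA mulrC coef_trunc.
by rewrite /geom coef_poly ltnS le.
Qed.

Lemma size_hker i : (size (hker i) <= n)%N.
Proof.
apply: leq_trans (size_prod_leq _ _) _.
rewrite leq_subLR; have cE : #|[pred j | j != i]| = n.-1.
  have := cardC (pred1 i); rewrite card1 card_ord add1n => /(congr1 predn) /= <-.
  by apply: eq_card => j; rewrite !inE.
rewrite cE.
have n0 : (0 < n)%N by apply: leq_ltn_trans (ltn_ord i).
have bd : (\sum_(j < n | j != i) size (1 - y j *: 'X : {poly S})%R <= \sum_(j < n | j != i) 2)%N.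
  apply: leq_sum => j _; apply: leq_trans (size_polyD _ _) _.
  rewrite geq_max size_poly1 /= size_polyN; apply: leq_trans (size_scale_leq _ _) _.
  by rewrite size_polyX.
have e : (\sum_(j < n | j != i) 2 = n.-1 * 2)%N.
  by rewrite sum_nat_const cE.
rewrite e in bd; apply: leq_ltn_trans bd _; lia.
Qed.

(** The Jacobi-Trudi matrix. The test makes h of negative index 0, where truncated subtraction would
    give h_0 = 1. *)
Definition jt_mx (lam : nat -> nat) : 'M[S]_n :=
  \matrix_(p, j) (if (j <= lam j + p)%N then hser`_(lam j + p - j) else 0).

Lemma alternant_jt (lam : nat -> nat) : (forall j : 'I_n, (lam j + n.-1 <= B)%N) ->
  alternant y n lam = \det (\matrix_(i < n, p < n) (hker i)`_(n.-1 - p)) * \det (jt_mx lam).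
Proof.
move=> hB; rewrite /alternant -det_mulmx; congr (\det _); apply/matrixP => i j.
rewrite !mxE -hkerM; last by have := hB j; lia.
rewrite coefM.
under [RHS]eq_bigr => p _ do rewrite !mxE.
pose F q := (hker i)`_q * (if (q <= lam j + (n.-1 - j))%N then hser`_(lam j + (n.-1 - j) - q) else 0).
transitivity (\sum_(q < n) F q).
  have -> : \sum_(q < n) F q = \sum_(0 <= q < n) F q by rewrite big_mkord.
  set m := (lam j + (n.-1 - j))%N.
  have -> : \sum_(q < m.+1) (hker i)`_q * hser`_(m - q) = \sum_(0 <= q < m.+1) F q.
    rewrite big_mkord; apply: eq_bigr => q _; rewrite /F -/m.
    by have -> : (q <= m)%N by rewrite -ltnS.
  case: (leqP m.+1 n) => le.
    rewrite [RHS](big_cat_nat (n := m.+1)) //= [X in _ = _ + X]big_nat_cond.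
    rewrite [X in _ = _ + X]big1 ?addr0 // => q /andP[/andP[lt _] _].
    by rewrite /F -/m leqNgt lt /= mulr0.
  rewrite (big_cat_nat (n := n)) //=; last exact: ltnW.
  rewrite [X in _ + X]big_nat_cond [X in _ + X]big1 ?addr0 // => q /andP[/andP[lt _] _].
  by rewrite /F nth_default ?mul0r // (leq_trans (size_hker i)).
rewrite [RHS](reindex_inj rev_ord_inj) /=.
apply: eq_bigr => q _; rewrite /F; have lq := ltn_ord q; have lj := ltn_ord j.
congr (_`_ _ * _); first lia.
have -> : (j <= lam j + (n - q.+1))%N = (q <= lam j + (n.-1 - j))%N by lia.
by congr (if _ then _`__ else _); lia.
Qed.

Lemma det_jt0 : \det (jt_mx (fun=> 0%N)) = 1.
Proof.
rewrite det_trig.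
  rewrite big1 // => i _; rewrite mxE add0n leqnn subnn /hser coef0_prod big1 // => j _.
  by rewrite coef_poly /= expr0.
apply/is_trig_mxP => i j lt; rewrite mxE add0n leqNgt lt //.
Qed.

(** The first factor in [alternant_jt] does not depend on lam, and for lam = 0 the second is
    unitriangular; so the first is the Vandermonde determinant. *)
Lemma alternant_det_h (lam : nat -> nat) : (forall j : 'I_n, (lam j + n.-1 <= B)%N) ->
  alternant y n lam = alternant y n (fun=> 0%N) * \det (jt_mx lam).
Proof.
move=> hB; rewrite alternant_jt // [in RHS]alternant_jt; last first.
  by move=> j; have := hB j; lia.
by rewrite det_jt0 mulr1.
Qed.

End JacobiTrudi.

(** The columns from L on belong to empty rows: they are unitriangular with zeros above, so an L x L
    minor remains. *)
Lemma det_jt_rect (S : comNzRingType) (y : nat -> S) B n L N : (L <= n)%N -> (L <= N)%N ->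
  \det (@jt_mx S y B n (fun j => if (j < L)%N then N else 0%N)) =
  \det (\matrix_(p < L, j < L) (hser y B n)`_(N + p - j)).
Proof.
move=> /subnKC; move: (n - L)%N => d <- leL; set J := jt_mx _ _ _ _.
rewrite -[J]submxK; have -> : ursubmx J = 0.
  apply/matrixP => p j; rewrite !mxE /= ltnNge leq_addr /= add0n.
  by rewrite leqNgt (leq_trans (ltn_ord p)) ?leq_addr.
rewrite det_lblock; have -> : \det (drsubmx J) = 1.
  rewrite det_trig.
    rewrite big1 // => i _; rewrite !mxE /= ltnNge leq_addr /= add0n leqnn subnn.
    rewrite /hser coef0_prod big1 // => j _.
    by rewrite coef_poly /= expr0.
  apply/is_trig_mxP => i j lt; rewrite !mxE /= ltnNge leq_addr /= add0n.
  by rewrite leq_add2l leqNgt lt.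
rewrite mulr1; congr (\det _); apply/matrixP => p j; rewrite !mxE /= ltn_ord.
by have -> : (j <= N + p)%N by have := ltn_ord j; lia.
Qed.

(** Distributivity needs one codomain for all k, so a function on the fibre [T k] is encoded as a
    function on the whole sigma type that equals [u0] off the fibre. *)
Lemma prod_sum_tagged (S : comPzSemiRingType) (K : finType) (T : K -> finType) (U : finType) (u0 : U)
    (G : forall k, {ffun T k -> U} -> S) :
  \prod_k \sum_(f : {ffun T k -> U}) G k f =
  \sum_(F : {ffun {k : K & T k} -> U}) \prod_k G k [ffun j => F (Tagged T j)].
Proof.
pose J : finType := {ffun {k : K & T k} -> U}.
pose supp k (F : J) := [forall c, (tag c != k) ==> (F c == u0)].
pose res k (F : J) : {ffun T k -> U} := [ffun j => F (Tagged T j)].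
pose up k (f : {ffun T k -> U}) : J := [ffun c => untag u0 (fun j => f j) c].
have upK k f : res k (up k f) = f.
  by apply/ffunP => j; rewrite !ffunE (untagE _ _ (erefl : tag (Tagged T j) = k)).
have E k : \sum_(f : {ffun T k -> U}) G k f = \sum_(F | supp k F) G k (res k F).
  rewrite (reindex_onto (@up k) (res k)) /=.
    apply: eq_big => [f|f _]; last by rewrite upK.
    rewrite upK eqxx andbT; apply/esym/forallP => c; apply/implyP => nk.
    by rewrite ffunE untag_dflt.
  move=> F /forallP sF; apply/ffunP => c; rewrite ffunE.
  case: (eqVneq (tag c) k) => [e|ne]; last by rewrite untag_dflt //; apply/esym/eqP; apply: (implyP (sF c)).
  by case: c e => k' j /= e; subst k'; rewrite (untagE _ _ (erefl : tag (Tagged T j) = k)) ffunE.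
rewrite (eq_bigr _ (fun k _ => E k)) bigA_distr_big_dep /=.
pose glue (phi : {ffun K -> J}) : J := [ffun c => phi (tag c) c].
pose split (F : J) : {ffun K -> J} := [ffun k => [ffun c => if tag c == k then F c else u0]].
rewrite (reindex_onto split glue) /=.
  apply: eq_big => [F|F _].
    have -> : glue (split F) = F by apply/ffunP => c; rewrite !ffunE eqxx.
    rewrite eqxx andbT; apply/familyP => k; apply/forallP => c; apply/implyP => /negbTE nk.
    by rewrite !ffunE nk.
  apply: eq_bigr => k _; congr (G k _); apply/ffunP => j; by rewrite !ffunE /= eqxx.
move=> phi /familyP hphi; apply/ffunP => k; apply/ffunP => c; rewrite !ffunE.
case: eqP => [->//|/eqP nk]; have /forallP/(_ c)/implyP/(_ nk)/eqP -> // := hphi k.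
Qed.

(** The coefficient of y^(c + delta) in the Vandermonde determinant times y^nu: a sign if the
    numbers nu_j + j permute c, ..., c+n-1, and 0 otherwise. *)
Definition sgcount n (c : nat) (nu : 'I_n -> nat) : int :=
  \sum_(s : 'S_n) (-1) ^+ s * [forall j : 'I_n, nu j + j == c + s j]%N%:R.

Lemma alternant0_coeff n c (m : 'X_{1..n}) :
  (alternant (@Xnat n) n (fun=> 0%N) * 'X_[m])@_(alt_mon (fun=> c) 1) = sgcount c m.
Proof.
rewrite alternantE mulr_suml raddf_sum /=; apply: eq_bigr => s _.
rewrite -scalerAl mcoeffZ -mpolyXD mcoeffX; congr (_ * (nat_of_bool _)%:R).
apply/eqP/forallP => [/mnmP h j|h].
  by have := h j; rewrite mnmDE !mnmE perm1; have := ltn_ord j; have := ltn_ord (s j); lia.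
apply/mnmP => j; rewrite mnmDE !mnmE perm1; have := ltn_ord j; have := ltn_ord (s j).
by have /eqP := h j; lia.
Qed.

Lemma is_part_nseq L N : (0 < N)%N -> is_part (nseq L N).
Proof.
move=> h; rewrite /is_part mem_nseq; apply/andP; split; last first.
  by rewrite negb_and; apply/orP; right; rewrite eq_sym -lt0n.
by case: L => //= L; elim: L => //= L ->; rewrite andbT /=.
Qed.

Lemma schur_nseq n L N B : (0 < N)%N -> (L <= n)%N -> (L <= N)%N -> (N + n <= B)%N ->
  schur n (nseq L N) = \det (\matrix_(p < L, j < L) (hser (@Xnat n) B n)`_(N + p - j)).
Proof.
move=> N0 Ln LN hB; apply: (mulfI (alternant0_neq0 n)).
rewrite alternant_schur ?is_part_nseq ?size_nseq //.
have -> : alternant (@Xnat n) n (nth 0%N (nseq L N)) =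
    alternant (@Xnat n) n (fun j => if (j < L)%N then N else 0%N).
  by congr (\det _); apply/matrixP => i j; rewrite !mxE nth_nseq.
rewrite (@alternant_det_h _ _ B); last by move=> j; case: ifP; lia.
by rewrite det_jt_rect.
Qed.

Lemma coef_hser n B m : (hser (@Xnat n) B n)`_m =
  \sum_(u : {ffun 'I_n -> 'I_B.+1})
     (m == \sum_a u a)%N%:R *: 'X_[ [multinom nat_of_ord (u a) | a < n] ].
Proof.
rewrite hserE coef_sum; apply: eq_bigr => u _; rewrite coefZ coefXn.
have -> : \prod_(j < n) Xnat n j ^+ u j = 'X_[ [multinom nat_of_ord (u a) | a < n] ].
  by rewrite mpolyXE_id; apply: eq_bigr => a _; rewrite XnatE mnmE.
by case: eqP => _; rewrite ?mulr1 ?mulr0 ?scale1r ?scale0r.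
Qed.

(** [f j] is the exponent vector of the monomial chosen from the j-th h. The permutation constrains
    only the degrees of the [f j], so summing it out leaves a [sgcount]. *)
Lemma det_h_expand n L N B : (L <= N)%N ->
  \det (\matrix_(p < L, j < L) (hser (@Xnat n) B n)`_(N + p - j)) =
  \sum_(f : {ffun 'I_L -> {ffun 'I_n -> 'I_B.+1}})
     sgcount N (fun j : 'I_L => \sum_a f j a)%N *:
     'X_[ [multinom (\sum_j f j a)%N | a < n] ].
Proof.
move=> LN; rewrite -det_tr /determinant.
under eq_bigr => s _.
  under eq_bigr => j _ do rewrite !mxE coef_hser.
  rewrite bigA_distr_bigA /= mulr_sumr.
  under eq_bigr => f _.
    rewrite scaler_prod -scalerAr -natr_prod.
    have -> : \prod_(j < L) 'X_[ [multinom nat_of_ord (f j a) | a < n] ] =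
       'X_[ [multinom (\sum_j f j a)%N | a < n] ] :> {mpoly int[n]}.
      rewrite mprodXE; congr 'X_[_]; apply/mnmP => a; rewrite mnm_sumE mnmE.
      by apply: eq_bigr => j _; rewrite mnmE.
    (* Since [L <= N], the truncated difference [N + s j - j] is a true one. *)
    have -> : (\prod_(j < L) (N + s j - j == \sum_a f j a)%N =
        [forall j : 'I_L, \sum_a f j a + j == N + s j]%N)%N.
      case: forallP => [h|/forallP/forallPn[j nj]].
        rewrite big1 // => j _; have /eqP e := h j; rewrite -e addnK eqxx //.
      rewrite (bigD1 j) //=; case: eqP => // e; case/eqP: nj; rewrite -e subnK //.
      by have := ltn_ord j; lia.
    rewrite mulr_sign -scaler_sign.
    over.
  over.
rewrite exchange_big /=; apply: eq_bigr => f _; rewrite /sgcount scaler_suml.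
by apply: eq_bigr => s _; rewrite scalerA mulrC.
Qed.

(** [F c a] is the exponent of the entry (a, c) of the N x M matrix. Jacobi-Trudi gives a sign for
    the column degrees of each block, and extracting a coefficient against the Vandermonde gives the
    sign for the row degrees. *)
Lemma LRcoef_rect K (L : 'I_K -> nat) N M B :
  (0 < N)%N -> (0 < M)%N -> (forall k, (L k <= N)%N) -> (N + N <= B)%N ->
  LRcoef [seq rect N (L i) | i <- enum 'I_K] (rect M N) =
  \sum_(F : {ffun {k : 'I_K & 'I_(L k)} -> {ffun 'I_N -> 'I_B.+1}})
     sgcount M (fun a : 'I_N => \sum_c F c a)%N *
     \prod_k sgcount N (fun j : 'I_(L k) => \sum_a F (Tagged (fun k => 'I_(L k)) j) a)%N.
Proof.
move=> N0 M0 LN hB.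
have rE b q : (0 < b)%N -> rect b q = nseq q b by case: b.
rewrite (@eq_map _ _ _ (fun i => nseq (L i) N)) => [|i]; last exact: rE.
rewrite rE // (@LRcoefE _ _ N) ?size_nseq ?is_part_nseq //; last first.
  by apply/allP => la /mapP[i _ ->]; apply: is_part_nseq.
rewrite big_map big_enum /=.
under eq_bigr => k _ do rewrite (schur_nseq N0 (LN k) (LN k) hB) (det_h_expand _ _ (LN k)).
rewrite (prod_sum_tagged [ffun=> ord0]) mulr_sumr raddf_sum /=; apply: eq_bigr => F _.
rewrite scaler_prod -scalerAr mcoeffZ mulrC; congr (_ * _); last first.
  by apply: eq_bigr => k _; apply: eq_bigr => s _; congr (_ * (nat_of_bool _)%:R);
     apply: eq_forallb => j; congr (_ + _ == _)%N; apply: eq_bigr => a _; rewrite ffunE.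
rewrite mprodXE.
have -> : alt_mon (nth 0%N (nseq N M)) 1 = alt_mon (fun=> M) 1 :> 'X_{1..N}.
  by apply/mnmP => a; rewrite !mnmE nth_nseq perm1 ltn_ord.
rewrite alternant0_coeff; apply: eq_bigr => s _; congr (_ * (nat_of_bool _)%:R).
apply: eq_forallb => a; congr (_ + _ == _)%N; rewrite mnm_sumE.
transitivity (\sum_k \sum_(j : 'I_(L k)) F (Tagged (fun k => 'I_(L k)) j) a)%N.
  by apply: eq_bigr => k _; rewrite mnmE; apply: eq_bigr => j _; rewrite ffunE.
rewrite sig_big_dep /=; apply: eq_bigr => -[k j] _ //.
Qed.

(** * The Casimir operator *)

Section VandermondeCalculus.
Variables (R : realFieldType) (n : nat).
Local Notation P := {mpoly R[n]}.

Definition theta (a : 'I_n) (p : P) : P := 'X_a * p^`M(a).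

Lemma thetaX a m : theta a 'X_[m] = (m a)%:R *: 'X_[m].
Proof.
rewrite /theta mderivX -scalerAr -mpolyXD.
case: (posnP (m a)) => [->|h]; first by rewrite !scale0r.
congr (_ *: 'X_[_]); apply/mnmP => b; rewrite mnmDE mnmBE mnm1E.
by case: eqP => [<-|_]; [rewrite add1n subn1 prednK|rewrite subn0].
Qed.

Lemma theta_is_linear a : linear (theta a).
Proof. by move=> c p q; rewrite /theta mderivD mderivZ mulrDr scalerAr. Qed.
HB.instance Definition _ a := GRing.isLinear.Build R P P *:%R (theta a) (theta_is_linear a).

Lemma thetaM a p q : theta a (p * q) = theta a p * q + p * theta a q.
Proof. by rewrite /theta mderivM; ring. Qed.

Lemma mcoeff_theta a p m : (theta a p)@_m = (m a)%:R * p@_m.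
Proof.
rewrite {1}[p]mpolyE linear_sum raddf_sum /=.
rewrite [in RHS](mpolyE p) raddf_sum mulr_sumr; apply: eq_bigr => m' _.
rewrite linearZ /= thetaX !mcoeffZ !mcoeffX [RHS]mulrCA; congr (_ * _).
by have [->|_] := eqVneq m' m; rewrite ?mulr0.
Qed.

Lemma theta_prod (I : finType) a (f : I -> P) (A : {set I}) :
  theta a (\prod_(i in A) f i) = \sum_(i in A) theta a (f i) * \prod_(j in A :\ i) f j.
Proof.
have [k] := ubnP #|A|; elim: k A => // k IH A hk.
have [->|[x xA]] := set_0Vmem A.
  by rewrite !big_set0 /theta -[1]/(1%:MP_[n] : P) mderivC mulr0.
rewrite (big_setD1 x) //= thetaM IH; last by rewrite (cardsD1 x) xA in hk.
rewrite [RHS](big_setD1 x) //=; congr (_ + _); rewrite mulr_sumr.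
apply: eq_bigr => i; rewrite !inE => /andP[nix iA].
rewrite [in RHS](big_setD1 x) ?inE 1?eq_sym ?nix //= mulrCA; congr (_ * (_ * _)).
by apply: eq_bigl => j; rewrite !inE andbCA.
Qed.

Definition pairs : {set 'I_n * 'I_n} := [set pr : 'I_n * 'I_n | (pr.1 < pr.2)%N].
Definition vdiff (pr : 'I_n * 'I_n) : P := 'X_pr.1 - 'X_pr.2.
Definition vdm : P := \prod_(pr in pairs) vdiff pr.
Definition vquo0 (a b : 'I_n) : P := \prod_(pr in pairs :\ (a, b)) vdiff pr.
(** The Vandermonde product divided by X_a - X_b, for either order of a and b. *)
Definition vquo (a b : 'I_n) : P := if (a < b)%N then vquo0 a b else - vquo0 b a.

Lemma vquoN a b : a != b -> vquo a b = - vquo b a.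
Proof.
rewrite /vquo -val_eqE neq_ltn => /orP[] h; rewrite h ltnNge ltnW //= ?opprK //.
Qed.

Lemma vquoM a b : a != b -> ('X_a - 'X_b) * vquo a b = vdm.
Proof.
wlog lt : a b / (a < b)%N.
  move=> W ne; have := ne; rewrite -val_eqE neq_ltn => /orP[h|h]; first exact: W.
  by rewrite vquoN // mulrN -mulNr opprB; apply: W => //; rewrite eq_sym.
by move=> _; rewrite /vquo lt /vdm (big_setD1 (a, b)) ?inE.
Qed.

Lemma theta_X a b : theta a ('X_b : P) = (b == a)%:R *: 'X_a.
Proof.
by rewrite thetaX mnm1E; case: eqP => [->|_]; rewrite ?scale0r.
Qed.

Lemma theta_vdm a : theta a vdm = \sum_(b | b != a) 'X_a * vquo a b.
Proof.
rewrite theta_prod.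
have E pr : theta a (vdiff pr) = ((pr.1 == a)%:R - (pr.2 == a)%:R) *: 'X_a.
  by rewrite linearB /= !theta_X scalerBl.
under eq_bigr => pr _ do rewrite E scalerBl mulrBl.
rewrite sumrB (bigID (fun b : 'I_n => (a < b)%N)) /=; congr (_ + _).
  rewrite (eq_bigl (fun b : 'I_n => (a < b)%N)); last first.
    by move=> b; rewrite andbC; case: ltnP => //= lt; rewrite -val_eqE gtn_eqF.
  rewrite (bigID (fun pr : 'I_n * 'I_n => pr.1 == a)) /= [X in _ + X]big1 ?addr0; last first.
    by move=> pr /andP[_ /negbTE ->]; rewrite scale0r mul0r.
  rewrite (reindex_onto (fun b => (a, b)) (fun pr => pr.2)) /=.
    apply: eq_big => b; first by rewrite !inE !eqxx !andbT.
    by move=> /andP[/andP[]]; rewrite inE /= /vquo => -> _ _; rewrite eqxx scale1r.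
  by move=> [p r] /andP[_ /eqP /= ->].
rewrite -sumrN (eq_bigl (fun b : 'I_n => (b < a)%N)); last first.
  by move=> b; rewrite -leqNgt -val_eqE ltn_neqAle.
rewrite (bigID (fun pr : 'I_n * 'I_n => pr.2 == a)) /= [X in _ + X]big1 ?addr0; last first.
  by move=> pr /andP[_ /negbTE ->]; rewrite scale0r mul0r oppr0.
rewrite (reindex_onto (fun b => (b, a)) (fun pr => pr.1)) /=.
  apply: eq_big => b; first by rewrite !inE !eqxx !andbT.
  move=> /andP[/andP[]]; rewrite inE /= /vquo => lt _ _.
  by rewrite ltnNge (ltnW lt) /= eqxx scale1r mulrN.
by move=> [p r] /andP[_ /eqP /= ->].
Qed.

Definition rev_perm : 'S_n := perm (@rev_ord_inj n).

Lemma vdmE : vdm = \sum_(s : 'S_n) (-1) ^+ s *: 'X_[ [multinom (n.-1 - s i)%N | i < n] ].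
Proof.
(* Reversing the variables turns the differences of the standard Vandermonde matrix into X_p - X_r
   with p < r; conjugation by the reversal undoes this in the sum over permutations. *)
pose V := Vandermonde n (\row_(i < n) ('X_(rev_ord i) : P)).
have -> : vdm = \det V.
  rewrite det_Vandermonde pair_big_dep /= /vdm.
  rewrite (reindex (fun pr : 'I_n * 'I_n => (rev_ord pr.2, rev_ord pr.1))) /=; last first.
    by exists (fun pr : 'I_n * 'I_n => (rev_ord pr.2, rev_ord pr.1)) => -[p r] _ /=; rewrite !rev_ordK.
  apply: eq_big => [[p r]|[p r] _]; last by rewrite /vdiff !mxE.
  by rewrite inE /=; have := ltn_ord p; have := ltn_ord r; lia.
rewrite -det_tr /determinant (reindex_inj (conjg_inj rev_perm)) /=.
apply: eq_bigr => s _; rewrite odd_permJ mulr_sign -scaler_sign; congr (_ *: _).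
rewrite mpolyXE_id (reindex_inj rev_ord_inj) /=; apply: eq_bigr => i _.
rewrite !mxE rev_ordK mnmE; congr (_ ^+ _).
have rV : (rev_perm^-1 = rev_perm)%g.
  by apply/permP => j; apply: (@perm_inj _ rev_perm); rewrite permKV !permE rev_ordK.
by rewrite conjgE rV !permM !permE rev_ordK /=; have := ltn_ord (s i); lia.
Qed.

Definition Lap (p : P) : P := \sum_a theta a (theta a p).
Definition Eul (p : P) : P := \sum_a theta a p.

Lemma mcoeff_Lap p m : (Lap p)@_m = (\sum_a (m a) ^ 2)%N%:R * p@_m.
Proof.
rewrite raddf_sum natr_sum mulr_suml; apply: eq_bigr => a _.
by rewrite /= !mcoeff_theta mulrA -natrM.
Qed.

Lemma mcoeff_Eul p m : (Eul p)@_m = (\sum_a m a)%N%:R * p@_m.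
Proof.
by rewrite raddf_sum natr_sum mulr_suml; apply: eq_bigr => a _; rewrite /= mcoeff_theta.
Qed.

Lemma mcoeff_vdm m : vdm@_m != 0 -> exists s : 'S_n, forall a, m a = (n.-1 - s a)%N.
Proof.
rewrite vdmE raddf_sum /= => nz.
have [/existsP[s /eqP e]|] := boolP [exists s : 'S_n, [multinom (n.-1 - s i)%N | i < n] == m].
  by exists s => a; rewrite -e mnmE.
rewrite negb_exists => /forallP h; case/eqP: nz; apply: big1 => s _.
by rewrite mcoeffZ mcoeffX (negbTE (h s)) mulr0.
Qed.

Lemma sum_perm_delta (g : nat -> nat) (s : 'S_n) :
  (\sum_(a < n) g (n.-1 - s a) = \sum_(a < n) g (n.-1 - a))%N.
Proof. by rewrite [RHS](reindex_inj (@perm_inj _ s)). Qed.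

Lemma Lap_vdm : Lap vdm = (\sum_(a < n) (n.-1 - a) ^ 2)%N%:R *: vdm.
Proof.
apply/mpolyP => m; rewrite mcoeff_Lap mcoeffZ.
have [->|nz] := eqVneq (vdm@_m) 0; first by rewrite !mulr0.
have [s e] := mcoeff_vdm nz; under eq_bigr => a _ do rewrite e.
by rewrite (sum_perm_delta (fun x => x ^ 2)%N).
Qed.

Lemma Eul_vdm : Eul vdm = (\sum_(a < n) (n.-1 - a))%N%:R *: vdm.
Proof.
apply/mpolyP => m; rewrite mcoeff_Eul mcoeffZ.
have [->|nz] := eqVneq (vdm@_m) 0; first by rewrite !mulr0.
have [s e] := mcoeff_vdm nz; under eq_bigr => a _ do rewrite e.
by rewrite (sum_perm_delta id).
Qed.

(* Radial part of the Casimir operator: multiplication by the Vandermonde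
   product turns it into a shifted Laplacian. *)
Lemma vdm_radial (T : P) (S : 'I_n -> 'I_n -> P) :
  (forall a b, a != b -> ('X_a - 'X_b) * S a b = 'X_a * (theta a T - theta b T)) ->
  vdm * (Lap T + \sum_a \sum_(b | b != a) S a b) =
  Lap (vdm * T) - T * Lap vdm - n.-1%:R *: (Eul (vdm * T) - T * Eul vdm).
Proof.
move=> hS.
have LapM p q : Lap (p * q) = Lap p * q + p * Lap q + (\sum_a theta a p * theta a q) *+ 2.
  rewrite /Lap mulr_suml mulr_sumr mulr2n -!big_split /=; apply: eq_bigr => a _.
  by rewrite thetaM linearD /= !thetaM; ring.
have EulM p q : Eul (p * q) = Eul p * q + p * Eul q.
  by rewrite /Eul mulr_suml mulr_sumr -big_split /=; apply: eq_bigr => a _; rewrite thetaM.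
rewrite LapM EulM; set W := \sum_a theta a vdm * theta a T.
have -> : vdm * (Lap T + \sum_a \sum_(b | b != a) S a b) =
    vdm * Lap T + \sum_a \sum_(b | b != a) vquo a b * 'X_a * (theta a T - theta b T).
  rewrite mulrDr; congr (_ + _); rewrite mulr_sumr; apply: eq_bigr => a _; rewrite mulr_sumr.
  by apply: eq_bigr => b nb; rewrite -(@vquoM a b) 1?eq_sym // mulrAC [_ * S a b]hS 1?eq_sym //; ring.
have -> : \sum_a \sum_(b | b != a) vquo a b * 'X_a * (theta a T - theta b T) =
    W + (W - n.-1%:R *: (vdm * Eul T)).
  under eq_bigr => a _.
    under eq_bigr => b _ do rewrite mulrBr.
    rewrite sumrB. over.
  rewrite sumrB; congr (_ + _).
    rewrite /W; apply: eq_bigr => a _; rewrite theta_vdm mulr_suml.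
    by apply: eq_bigr => b _; rewrite ['X_a * _]mulrC.
  rewrite (exchange_big_dep predT) //= -sumrN /W /Eul mulr_sumr scaler_sumr -sumrB.
  apply: eq_bigr => b _.
  (* By [vquoM], replacing X_b by X_a in each of the n - 1 terms of theta_b(vdm) costs one [vdm];
     this is the source of the Euler term. *)
  have -> : theta b vdm = \sum_(a | a != b) vquo b a * 'X_a + n.-1%:R *: vdm.
    rewrite theta_vdm; apply/eqP; rewrite addrC -subr_eq -sumrB; apply/eqP.
    transitivity (\sum_(a : 'I_n | a != b) vdm).
      by apply: eq_bigr => a na; rewrite -(@vquoM b a) 1?eq_sym //; ring.
    rewrite sumr_const -scaler_nat; congr (_%:R *: _).
    have := cardC (pred1 b); rewrite card1 card_ord add1n => /(congr1 predn) /= <-.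
    by apply: eq_card => j; rewrite !inE.
  rewrite mulrDl -scalerAl addrK mulr_suml -sumrN.
  apply: eq_big => [a|a na]; first by rewrite eq_sym.
  by rewrite (@vquoN a b) 1?eq_sym // !mulNr opprK.
have -> : Eul vdm * T + vdm * Eul T - T * Eul vdm = vdm * Eul T by ring.
move: (n.-1%:R *: _) => Z; ring.
Qed.

Lemma vdm_coeff c (nu : 'I_n -> nat) :
  (vdm * 'X_[ [multinom nu a | a < n] ])@_[multinom (c + (n.-1 - a))%N | a < n] = (sgcount c nu)%:~R.
Proof.
rewrite vdmE mulr_suml raddf_sum /= rmorph_sum; apply: eq_bigr => s _.
rewrite -scalerAl mcoeffZ -mpolyXD mcoeffX rmorphM /= rmorph_sign rmorph_nat.
congr (_ * (nat_of_bool _)%:R).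
apply/eqP/forallP => [/mnmP h j|h].
  by have := h j; rewrite mnmDE !mnmE; have := ltn_ord j; have := ltn_ord (s j); lia.
apply/mnmP => j; rewrite mnmDE !mnmE; have := ltn_ord j; have := ltn_ord (s j).
by have /eqP := h j; lia.
Qed.

End VandermondeCalculus.

(** * Weighted traces and the Casimir operator of one factor *)

Section CasimirTrace.
Variables (R : realFieldType) (n d : nat) (wt : 'I_d -> 'I_n -> nat).
Variable E : 'I_n -> 'I_n -> 'M[R]_d.
Hypothesis Ediag : forall a i j, E a a i j = (i == j)%:R * (wt i a)%:R.
Hypothesis Eshift : forall a b i j, E a b i j != 0 ->
  forall c, (wt i c + (c == b) = wt j c + (c == a))%N.
Hypothesis Ecomm : forall a b, E a b *m E b a - E b a *m E a b = E a a - E b b.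

Definition casimir : 'M[R]_d := \sum_a \sum_b E a b *m E b a.

Let mwt i : 'X_{1..n} := [multinom wt i a | a < n].
Let char (phi : 'M[R]_d) : {mpoly R[n]} := \sum_i phi i i *: 'X_[mwt i].

Let charD phi psi : char (phi + psi) = char phi + char psi.
Proof. by rewrite /char -big_split /=; apply: eq_bigr => i _; rewrite mxE scalerDl. Qed.
Let charN phi : char (- phi) = - char phi.
Proof. by rewrite /char -sumrN /=; apply: eq_bigr => i _; rewrite mxE scaleNr. Qed.
Let char_sum (I : finType) (Q : pred I) (F : I -> 'M[R]_d) :
  char (\sum_(i | Q i) F i) = \sum_(i | Q i) char (F i).
Proof.
apply: (big_morph char) => //; rewrite /char big1 // => i _; by rewrite mxE scale0r.
Qed.

Let charEaa (phi : 'M[R]_d) a : char (phi *m E a a) = theta a (char phi).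
Proof.
rewrite /char linear_sum; apply: eq_bigr => i _; rewrite linearZ /= thetaX mnmE scalerA.
congr (_ *: _); rewrite mxE (bigD1 i) //= Ediag eqxx mul1r big1 ?addr0 // => j ne.
by rewrite Ediag (negbTE ne) mul0r mulr0.
Qed.

(** Cyclicity of the trace and the weight shift give X_b S_ab = X_a S_ba, the bracket gives S_ab -
    S_ba; together they yield the hypothesis of [vdm_radial]. At exponent c + delta the shifted
    Laplacian has eigenvalue |c + delta|^2 - |delta|^2 - (n-1) n c = n c^2. *)
Lemma casimir_trace (phi : 'M[R]_d) c : (forall a b, phi *m E a b = E a b *m phi) ->
  \sum_i (phi *m casimir) i i * (sgcount c (wt i))%:~R =
  (n * c ^ 2)%N%:R * \sum_i phi i i * (sgcount c (wt i))%:~R.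
Proof.
move=> hphi; pose T := char phi; pose S a b := char (phi *m E a b *m E b a).
have SX a b : 'X_b * S a b = 'X_a * S b a.
  rewrite /S /char !mulr_sumr.
  under eq_bigr => i _ do rewrite mxE scaler_suml mulr_sumr.
  under [RHS]eq_bigr => i _ do rewrite hphi -mulmxA mxE scaler_suml mulr_sumr.
  rewrite exchange_big /=; apply: eq_bigr => j _; apply: eq_bigr => i _.
  have [->|nz] := eqVneq (E b a j i) 0; first by rewrite mulr0 mul0r !scale0r !mulr0.
  rewrite [RHS]mulrC -[in RHS]scalerAl [LHS]mulrC -scalerAl [E b a j i * _]mulrC.
  congr (_ *: _); rewrite -!mpolyXD; congr 'X_[_]; apply/mnmP => x.
  rewrite !mnmDE !mnmE; have := Eshift nz x.
  by rewrite [b == x]eq_sym [a == x]eq_sym => ->.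
have SB a b : S a b - S b a = theta a T - theta b T.
  rewrite /S /T -!charEaa -!charN -!charD -!mulmxA -!mulmxBr Ecomm mulmxBr //.
have hS a b : a != b -> ('X_a - 'X_b) * S a b = 'X_a * (theta a T - theta b T).
  by move=> _; rewrite -SB mulrBl mulrBr SX.
have charO : char (phi *m casimir) = Lap T + \sum_a \sum_(b | b != a) S a b.
  rewrite /casimir mulmx_sumr char_sum /Lap -big_split /=; apply: eq_bigr => a _.
  rewrite mulmx_sumr char_sum (bigD1 a) //= mulmxA !charEaa; congr (_ + _).
  by apply: eq_bigr => b _; rewrite mulmxA.
pose gam : 'X_{1..n} := [multinom (c + (n.-1 - a))%N | a < n].
have coefE (psi : 'M[R]_d) : \sum_i psi i i * (sgcount c (wt i))%:~R = (vdm R n * char psi)@_gam.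
  rewrite /char mulr_sumr raddf_sum /=; apply: eq_bigr => i _.
  by rewrite -scalerAr mcoeffZ vdm_coeff.
rewrite !coefE charO vdm_radial // Lap_vdm Eul_vdm.
rewrite -!scalerAr ![_ * vdm _ _]mulrC !(mcoeffB, mcoeffZ, mcoeff_Lap, mcoeff_Eul).
rewrite -!mulrBl mulrA -mulrBl; congr (_ * _).
under eq_bigr => a _ do rewrite mnmE.
under [X in _ * (X%:R - _)]eq_bigr => a _ do rewrite mnmE.
have e1 : (\sum_(a < n) (c + (n.-1 - a)) = n * c + \sum_(a < n) (n.-1 - a))%N.
  by rewrite big_split /= sum_nat_const card_ord.
have e2 : (\sum_(a < n) (c + (n.-1 - a)) ^ 2 =
    n * c ^ 2 + 2 * c * \sum_(a < n) (n.-1 - a) + \sum_(a < n) (n.-1 - a) ^ 2)%N.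
  rewrite big_distrr /= -[X in (X * _)%N](card_ord n) -sum_nat_const -!big_split /=.
  by apply: eq_bigr => a _; rewrite sqrnD; lia.
have e3 : (2 * \sum_(a < n) (n.-1 - a) = n * n.-1)%N.
  rewrite (reindex_inj rev_ord_inj) /=.
  have -> : (\sum_(a < n) (n.-1 - (n - a.+1)) = \sum_(0 <= a < n) a)%N.
    by rewrite big_mkord; apply: eq_bigr => a _; have := ltn_ord a; lia.
  elim: (n) => [|m IH]; first by rewrite big_geq.
  by rewrite big_nat_recr //= mulnDr IH; nia.
rewrite e1 e2 !natrD.
have -> : (2 * c * \sum_(a < n) (n.-1 - a) = c * (n * n.-1))%N by rewrite -e3; lia.
rewrite !natrM; ring.
Qed.

End CasimirTrace.

Lemma idempotent_trace (R : fieldType) d (e : 'M[R]_d) : e *m e = e -> \tr e = (\rank e)%:R.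
Proof.
move=> ee; have cb := mulmx_base e.
have bc : row_base e *m col_base e = 1%:M.
  apply: (row_full_inj (col_base_full e)); apply: (row_free_inj (row_base_free e)).
  transitivity e; last by rewrite /= mulmx1 cb.
  by rewrite /= -mulmxA -[_ *m _ *m row_base e]mulmxA cb mulmxA cb ee.
by rewrite -{1}cb mxtrace_mulC bc mxtrace1.
Qed.

Lemma sgcount_const n c : sgcount c (fun _ : 'I_n => c) = 1.
Proof.
rewrite /sgcount (bigD1 1%g) //= odd_perm1 mul1r big1 ?addr0 => [|s ns].
  by case: forallP => // -[] j; rewrite perm1.
case: forallP => [h|]; last by rewrite mulr0.
case/eqP: ns; apply/permP => j; apply: val_inj; rewrite perm1.
by have /eqP := h j; rewrite /= => /addnI.
Qed.

(** * Invariants counted by a weighted trace *)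

Section InvariantCount.
Variables (R : realFieldType) (Q : finType) (nq : Q -> nat) (cq : Q -> nat) (d : nat).
Variables (wt : forall q, 'I_d.+1 -> 'I_(nq q) -> nat).
Variable E : forall q, 'I_(nq q) -> 'I_(nq q) -> 'M[R]_d.+1.
Hypothesis Ediag : forall q (a : 'I_(nq q)) i j, E a a i j = (i == j)%:R * (wt i a)%:R.
Hypothesis Eshift : forall q (a b : 'I_(nq q)) i j, E a b i j != 0 ->
  forall c, (wt i c + (c == b) = wt j c + (c == a))%N.
Hypothesis Ebracket : forall q (a b c e : 'I_(nq q)),
  E a b *m E c e - E c e *m E a b = (b == c)%:R *: E a e - (e == a)%:R *: E c b.
Hypothesis Ecross : forall q q', q != q' -> forall (a b : 'I_(nq q)) (c e : 'I_(nq q')),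
  E a b *m E c e = E c e *m E a b.
Definition wnorm i : nat := (\sum_q \sum_(a < nq q) wt i a ^ 2)%N.
Definition wmin : nat := (\sum_q nq q * cq q ^ 2)%N.
Hypothesis wnorm_min : forall i, (wmin <= wnorm i)%N.
Hypothesis wnorm_eq : forall i, wnorm i = wmin -> forall q (a : 'I_(nq q)), wt i a = cq q.

Definition Ohat : 'M[R]_d.+1 := \sum_q casimir (@E q).

Definition signed_count : R := \sum_i \prod_q (sgcount (cq q) (@wt q i))%:~R.

Lemma Eother q q' (a b : 'I_(nq q)) i j : q != q' -> E a b i j != 0 ->
  forall c : 'I_(nq q'), wt i c = wt j c.
Proof.
move=> ne nz c; have := Ecross ne a b c c => /matrixP/(_ i j).
rewrite !mxE (bigD1 j) //= big1 ?addr0; last first.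
  by move=> k nk; rewrite Ediag (negbTE nk) mul0r mulr0.
rewrite (bigD1 i) //= big1 ?addr0; last first.
  by move=> k nk; rewrite Ediag eq_sym (negbTE nk) mul0r mul0r.
rewrite !Ediag !eqxx !mul1r mulrC => /(mulIf nz)/eqP.
by rewrite eqr_nat => /eqP ->.
Qed.

(** Centrality of the Casimir element: the bracket acts as a derivation, and the four resulting sums
    cancel in pairs. *)
Lemma EC_casimir q q' (a b : 'I_(nq q)) : E a b *m casimir (@E q') = casimir (@E q') *m E a b.
Proof.
have [e|ne] := eqVneq q q'; last first.
  rewrite /casimir mulmx_sumr mulmx_suml; apply: eq_bigr => c _.
  rewrite mulmx_sumr mulmx_suml; apply: eq_bigr => f _.
  by rewrite mulmxA (Ecross ne) -mulmxA (Ecross ne) mulmxA.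
subst q'; apply/eqP; rewrite -subr_eq0; apply/eqP.
have br c f : E a b *m (E c f *m E f c) - E c f *m E f c *m E a b =
   (b == c)%:R *: (E a f *m E f c) - (f == a)%:R *: (E c b *m E f c)
   + ((b == f)%:R *: (E c f *m E a c) - (c == a)%:R *: (E c f *m E f b)).
  transitivity ((E a b *m E c f - E c f *m E a b) *m E f c +
                E c f *m (E a b *m E f c - E f c *m E a b)).
    by rewrite mulmxBl mulmxBr !mulmxA addrA subrK.
  by rewrite !Ebracket mulmxBl mulmxBr -!scalemxAl -!scalemxAr.
transitivity (\sum_(c < nq q) \sum_(f < nq q) (E a b *m (E c f *m E f c) - E c f *m E f c *m E a b)).
  rewrite /casimir mulmx_sumr mulmx_suml -sumrB; apply: eq_bigr => c _.
  by rewrite mulmx_sumr mulmx_suml -sumrB.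
under eq_bigr => c _.
  under eq_bigr => f _ do rewrite br.
  rewrite big_split /= !sumrB.
  over.
rewrite big_split /= !sumrB.
have s1 (F : 'I_(nq q) -> 'I_(nq q) -> 'M[R]_d.+1) (x : 'I_(nq q)) :
    \sum_c \sum_f (x == c)%:R *: F c f = \sum_f F x f.
  rewrite (bigD1 x) //= [X in _ + X]big1 ?addr0 => [|c nc].
    by apply: eq_bigr => f _; rewrite eqxx scale1r.
  by rewrite big1 // => f _; rewrite eq_sym (negbTE nc) scale0r.
have s2 (F : 'I_(nq q) -> 'I_(nq q) -> 'M[R]_d.+1) (x : 'I_(nq q)) :
    \sum_c \sum_f (x == f)%:R *: F c f = \sum_c F c x.
  by rewrite exchange_big /= s1.
rewrite (s1 (fun c f => E a f *m E f c)) (s2 (fun c f => E c f *m E a c)).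
under [X in _ - X + _]eq_bigr => c _ do under eq_bigr => f _ do rewrite eq_sym.
rewrite (s2 (fun c f => E c b *m E f c)).
under [X in _ + (_ - X)]eq_bigr => c _ do under eq_bigr => f _ do rewrite eq_sym.
rewrite (s1 (fun c f => E c f *m E f b)).
by rewrite addrC addrA subrK subrr.
Qed.

Lemma EC_Ohat q (a b : 'I_(nq q)) : E a b *m Ohat = Ohat *m E a b.
Proof. by rewrite /Ohat mulmx_sumr mulmx_suml; apply: eq_bigr => q' _; apply: EC_casimir. Qed.

Lemma mul_diag_entry (phi : 'M[R]_d.+1) (s : 'rV[R]_d.+1) i j :
  (phi *m diag_mx s) i j = phi i j * s 0 j.
Proof. by rewrite mul_mx_diag mxE. Qed.

Lemma Ohat_trace (phi : 'M[R]_d.+1) :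
  (forall q (a b : 'I_(nq q)), phi *m E a b = E a b *m phi) ->
  \sum_i (phi *m Ohat) i i * \prod_q (sgcount (cq q) (@wt q i))%:~R =
  wmin%:R * \sum_i phi i i * \prod_q (sgcount (cq q) (@wt q i))%:~R.
Proof.
move=> hphi; rewrite /wmin natr_sum mulr_suml.
under eq_bigr => i _ do rewrite /Ohat mulmx_sumr summxE mulr_suml.
rewrite exchange_big /=; apply: eq_bigr => q _.
(* The signs of the other factors go into a diagonal matrix. It commutes with the operators of
   factor q, which do not move the other weights, so [casimir_trace] applies to
   [phi *m diag_mx s]. *)
pose s : 'rV[R]_d.+1 := \row_i \prod_(q' | q' != q) (sgcount (cq q') (@wt q' i))%:~R.
have sC (a b : 'I_(nq q)) : diag_mx s *m E a b = E a b *m diag_mx s.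
  apply/matrixP => i j; rewrite mul_mx_diag mul_diag_mx !mxE mulrC.
  have [->|nz] := eqVneq (E a b i j) 0; first by rewrite !mul0r.
  congr (_ * _); apply: eq_bigr => q' nq'; congr (_%:~R); rewrite /sgcount.
  apply: eq_bigr => t _; congr (_ * (nat_of_bool _)%:R); apply: eq_forallb => c.
  by rewrite (Eother (_ : q != q') nz) // eq_sym.
have sCc : diag_mx s *m casimir (@E q) = casimir (@E q) *m diag_mx s.
  rewrite /casimir mulmx_sumr mulmx_suml; apply: eq_bigr => a _.
  by rewrite mulmx_sumr mulmx_suml; apply: eq_bigr => b _; rewrite mulmxA sC -mulmxA sC mulmxA.
have Ec (a b : 'I_(nq q)) : E a b *m E b a - E b a *m E a b = E a a - E b b.
  by rewrite Ebracket !eqxx !scale1r.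
have := @casimir_trace R (nq q) d.+1 (@wt q) (@E q) (@Ediag q) (@Eshift q) Ec
  (phi *m diag_mx s) (cq q).
have hc (a b : 'I_(nq q)) : phi *m diag_mx s *m E a b = E a b *m (phi *m diag_mx s).
  by rewrite -mulmxA sC mulmxA hphi -mulmxA.
move/(_ hc) => tr.
transitivity (\sum_i (phi *m diag_mx s *m casimir (@E q)) i i * (sgcount (cq q) (@wt q i))%:~R).
  apply: eq_bigr => i _; rewrite -mulmxA sCc mulmxA mul_diag_entry [s 0 i]mxE (bigD1 q) //=.
  by rewrite -mulrA; congr (_ * _); rewrite mulrC.
rewrite tr; congr (_ * _); apply: eq_bigr => i _.
by rewrite mul_diag_entry [s 0 i]mxE [in RHS](bigD1 q) //= -mulrA; congr (_ * _); rewrite mulrC.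
Qed.

(** Induction on p: each factor [Ohat] comes out as [wmin], because polynomials in [Ohat] commute
    with all E_ab. *)
Lemma horner_Ohat_trace (p : {poly R}) :
  \sum_i (horner_mx Ohat p) i i * \prod_q (sgcount (cq q) (@wt q i))%:~R =
  p.[wmin%:R] * signed_count.
Proof.
elim/poly_ind: p => [|p c IH].
  by rewrite rmorph0 horner0 mul0r big1 // => i _; rewrite mxE mul0r.
rewrite rmorphD rmorphM /= horner_mx_X horner_mx_C hornerMXaddC.
under eq_bigr => i _ do rewrite mxE mulrDl.
rewrite big_split /= [X in X + _]Ohat_trace; last first.
  by move=> q a b; apply: comm_horner_mx; rewrite /comm_mx EC_Ohat.
rewrite IH mulrDl mulrA [wmin%:R * _]mulrC; congr (_ + _).
by rewrite /signed_count mulr_sumr; apply: eq_bigr => i _; rewrite mxE eqxx mulr1n.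
Qed.

Lemma Ohat_weight i j : Ohat i j != 0 -> forall q (c : 'I_(nq q)), wt i c = wt j c.
Proof.
move=> nz q c.
have [/existsP[q' /existsP[a /existsP[b /existsP[k /andP[n1 n2]]]]]|] := boolP
  [exists q', [exists a : 'I_(nq q'), [exists b : 'I_(nq q'), [exists k,
     (E a b i k != 0) && (E b a k j != 0)]]]].
  have [e|ne] := eqVneq q' q; last by rewrite (Eother ne n1) (Eother ne n2).
  subst q'; have := Eshift n1 c; have := Eshift n2 c; lia.
rewrite negb_exists => /forallP h; case/eqP: nz; rewrite /Ohat summxE big1 // => q' _.
have := h q'; rewrite negb_exists => /forallP {}h.
rewrite summxE big1 // => a _; have := h a; rewrite negb_exists => /forallP {}h.
rewrite summxE big1 // => b _; have := h b; rewrite negb_exists => /forallP {}h.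
rewrite mxE big1 // => k _; have := h k; rewrite negb_and !negbK => /orP[] /eqP ->;
by rewrite ?mul0r ?mulr0.
Qed.

Definition gen_eig m (v : 'cV[R]_d.+1) := (Ohat - wmin%:R%:M) ^+ m *m v = 0.

Lemma gen_eig_comm m (X : 'M[R]_d.+1) v : X *m Ohat = Ohat *m X -> gen_eig m v -> gen_eig m (X *m v).
Proof.
move=> hX hv; rewrite /gen_eig mulmxA.
have c1 : GRing.comm X (Ohat - wmin%:R%:M).
  by apply: commrB; [exact: hX|apply: scalar_mxC].
by rewrite -[_ *m X]/(_ * X) -(commrX m c1) -[X * _]/(X *m _) -mulmxA hv mulmx0.
Qed.

Lemma Eaa_col q (a : 'I_(nq q)) (v : 'cV[R]_d.+1) i : (E a a *m v) i 0 = (wt i a)%:R * v i 0.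
Proof.
rewrite mxE (bigD1 i) //= big1 ?addr0; first by rewrite Ediag eqxx mul1r.
by move=> k nk; rewrite Ediag eq_sym (negbTE nk) mul0r mul0r.
Qed.

(* A weight of maximal norm in a generalized eigenspace is annihilated by
   E_ab or E_ba for every a and b, so the Casimir eigenvalue is at least its norm. *)
Lemma gen_eig_weight m v : gen_eig m v -> forall i, v i 0 != 0 ->
  forall q (a : 'I_(nq q)), wt i a = cq q.
Proof.
move=> hv i vi.
(* Excluded middle makes it boolean whether an index occurs in some vector of the generalized
   eigenspace, so that one of largest [wnorm] can be chosen. *)
pose P j := if excluded_middle_informative (exists v, gen_eig m v /\ v j 0 != 0) then true else false.
have PP j : reflect (exists v, gen_eig m v /\ v j 0 != 0) (P j).
  by rewrite /P; case: excluded_middle_informative => h; constructor.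
have Pi : P i by apply/PP; exists v.
have [i0 /PP[w [hw wi0]] imax] := @arg_maxnP _ i P wnorm Pi.
suff e0 : (wnorm i0 <= wmin)%N.
  by apply: wnorm_eq; apply/eqP; rewrite eqn_leq wnorm_min (leq_trans (imax _ Pi)).
pose same j := [forall q, [forall c : 'I_(nq q), wt j c == wt i0 c]].
have sameP j : same j -> forall q (c : 'I_(nq q)), wt j c = wt i0 c.
  by move=> /forallP h q c; have /forallP/(_ c)/eqP := h q.
(* Projection to the weight space of [i0]; it commutes with [Ohat], which preserves weights. *)
pose D := diag_mx (\row_j (same j)%:R : 'rV[R]_d.+1).
have DC : D *m Ohat = Ohat *m D.
  apply/matrixP => j k; rewrite mul_mx_diag mul_diag_mx !mxE mulrC.
  have [->|nz] := eqVneq (Ohat j k) 0; first by rewrite !mul0r.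
  congr (_ * (nat_of_bool _)%:R); rewrite /same; apply: eq_forallb => q; apply: eq_forallb => c.
  by rewrite (Ohat_weight nz).
pose f := D *m w; have hf : gen_eig m f by apply: gen_eig_comm.
have fE j : f j 0 = (same j)%:R * w j 0 by rewrite /f /D mul_diag_mx !mxE.
have fs j : f j 0 != 0 -> forall q (c : 'I_(nq q)), wt j c = wt i0 c.
  by rewrite fE; case h: (same j); [move=> _; apply: sameP|rewrite mul0r eqxx].
have f0 : f i0 0 != 0.
  rewrite fE; have -> : same i0 by apply/forallP => q; apply/forallP => c; rewrite eqxx.
  by rewrite mul1r.
(* E_ab moves one unit of weight from b to a; if a is already at least as heavy, the norm would
   exceed the maximum. *)
have kill q (a b : 'I_(nq q)) : a != b -> (wt i0 b <= wt i0 a)%N -> E a b *m f = 0.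
  move=> nab le; apply/matrixP => j z; rewrite ord1 [RHS]mxE.
  apply/eqP; apply: contraT => nz.
  have Pj : P j by apply/PP; exists (E a b *m f); split=> //; apply: gen_eig_comm => //; apply: EC_Ohat.
  have [k [Ejk fk]] : exists k, E a b j k != 0 /\ f k 0 != 0.
    have [/existsP[k /andP[h1 h2]]|] := boolP [exists k, (E a b j k != 0) && (f k 0 != 0)].
      by exists k.
    rewrite negb_exists => /forallP h; case/eqP: nz; rewrite mxE big1 // => k _.
    by have := h k; rewrite negb_and !negbK => /orP[] /eqP ->; rewrite ?mul0r ?mulr0.
  have le_j : (wnorm j <= wnorm i0)%N := imax _ Pj.
  move: le_j; rewrite leqNgt => /negP[].
  rewrite /wnorm (bigD1 q) //= [in X in (_ < X)%N](bigD1 q) //=.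
  have -> : (\sum_(q' | q' != q) \sum_(c < nq q') wt j c ^ 2 =
             \sum_(q' | q' != q) \sum_(c < nq q') wt i0 c ^ 2)%N.
    apply: eq_bigr => q' nq'; apply: eq_bigr => c _.
    by rewrite (Eother (_ : q != q') Ejk) 1?eq_sym // (fs _ fk).
  rewrite ltn_add2r (bigD1 a) //= (bigD1 b) 1?eq_sym //= [in X in (_ < X)%N](bigD1 a) //=.
  rewrite [in X in (_ < X)%N](bigD1 b) 1?eq_sym //=.
  have -> : (\sum_(c < nq q | (c != a) && (c != b)) wt j c ^ 2 =
             \sum_(c < nq q | (c != a) && (c != b)) wt i0 c ^ 2)%N.
    apply: eq_bigr => c /andP[ca cb]; have := Eshift Ejk c.
    by rewrite (negbTE ca) (negbTE cb) !addn0 (fs _ fk) => ->.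
  have ea : wt j a = (wt i0 a).+1.
    by have := Eshift Ejk a; rewrite eqxx (negbTE nab) (fs _ fk); lia.
  have eb : wt i0 b = (wt j b).+1.
    by have := Eshift Ejk b; rewrite eqxx [b == a]eq_sym (negbTE nab) (fs _ fk); lia.
  by move: le; rewrite ea eb -!mulnn; move: (wt i0 a) (wt j b) (\sum_(_ < _ | _) _)%N => x y t; nia.
(* If b is heavier than a, it is E_ba that kills [f], and the truncated difference is 0 as
   needed. *)
have EE q (a b : 'I_(nq q)) : a != b -> E a b *m (E b a *m f) = (wt i0 a - wt i0 b)%N%:R *: f.
  move=> nab; case: (leqP (wt i0 b) (wt i0 a)) => le; last first.
    by rewrite (kill _ b a) ?mulmx0 1?eq_sym ?nab 1?ltnW // (eqP (ltnW le : (_ - _ == 0)%N)) scale0r.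
  have := Ebracket a b b a; rewrite !eqxx !scale1r => /(congr1 (mulmx^~ f)).
  rewrite /= mulmxBl -!mulmxA (kill _ a b) // mulmx0 subr0 => ->.
  apply/matrixP => j z; rewrite ord1 mulmxBl [LHS]mxE [X in _ + X]mxE !Eaa_col [RHS]mxE -mulrBl.
  have [->|nz] := eqVneq (f j 0) 0; first by rewrite !mulr0.
  by rewrite !(fs _ nz) natrB.
(* The Casimir eigenvalue of [f]: the squared norm of its weight plus all positive differences, as
   for a highest weight vector after reordering the coordinates. *)
pose kap := (\sum_q \sum_(a < nq q) (wt i0 a ^ 2 + \sum_(b < nq q | b != a) (wt i0 a - wt i0 b)))%N.
have Of : Ohat *m f = kap%:R *: f.
  rewrite /Ohat mulmx_suml natr_sum scaler_suml; apply: eq_bigr => q _.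
  rewrite /casimir mulmx_suml natr_sum scaler_suml; apply: eq_bigr => a _.
  rewrite mulmx_suml (bigD1 a) //= natrD scalerDl; congr (_ + _).
    rewrite -mulmxA; apply/matrixP => j z; rewrite ord1 !Eaa_col [RHS]mxE.
    have [->|nz] := eqVneq (f j 0) 0; first by rewrite !mulr0.
    by rewrite (fs _ nz) mulrA -natrM.
  by rewrite natr_sum scaler_suml; apply: eq_bigr => b nb; rewrite -mulmxA EE // eq_sym.
have kE : kap = wmin.
  have pw k : (Ohat - wmin%:R%:M) ^+ k *m f = (kap%:R - wmin%:R) ^+ k *: f.
    elim: k => [|k IH]; first by rewrite !expr0 mul1mx scale1r.
    rewrite !exprSr -[_ * _]/(_ *m _) -mulmxA mulmxBl Of mul_scalar_mx -scalerBl.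
    by rewrite -scalemxAr IH scalerA mulrC.
  have := hf; rewrite /gen_eig pw => /matrixP/(_ i0 0); rewrite mxE [in RHS]mxE => /eqP.
  rewrite mulf_eq0 (negbTE f0) orbF expf_eq0 subr_eq0 eqr_nat => /andP[_ /eqP //].
rewrite -kE /wnorm /kap; apply: leq_sum => q _; apply: leq_sum => a _; exact: leq_addr.
Qed.

(** Only the balanced weight occurs, so E_ab with a != b has no weight to move a vector to. *)
Lemma gen_eig_inv m v : gen_eig m v ->
  (forall q (a b : 'I_(nq q)), a != b -> E a b *m v = 0) /\
  (forall q (a : 'I_(nq q)), E a a *m v = (cq q)%:R *: v).
Proof.
move=> hv; split=> q a.
  move=> b nab; apply/matrixP => j z; rewrite ord1 [RHS]mxE; apply/eqP; apply: contraT => nz.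
  have hj := gen_eig_weight (gen_eig_comm (EC_Ohat a b) hv) nz.
  have [k [Ejk fk]] : exists k, E a b j k != 0 /\ v k 0 != 0.
    have [/existsP[k /andP[h1 h2]]|] := boolP [exists k, (E a b j k != 0) && (v k 0 != 0)].
      by exists k.
    rewrite negb_exists => /forallP h; case/eqP: nz; rewrite mxE big1 // => k _.
    by have := h k; rewrite negb_and !negbK => /orP[] /eqP ->; rewrite ?mul0r ?mulr0.
  have := Eshift Ejk a; rewrite hj (gen_eig_weight hv fk) eqxx (negbTE nab); lia.
apply/matrixP => j z; rewrite ord1 Eaa_col [RHS]mxE.
have [->|nz] := eqVneq (v j 0) 0; first by rewrite !mulr0.
by rewrite (gen_eig_weight hv nz).
Qed.

Definition invariant_vec (v : 'cV[R]_d.+1) :=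
  (forall q (a b : 'I_(nq q)), a != b -> E a b *m v = 0) /\
  (forall q (a : 'I_(nq q)), E a a *m v = (cq q)%:R *: v).

Lemma invariant_Ohat v : invariant_vec v -> Ohat *m v = wmin%:R *: v.
Proof.
move=> [h1 h2]; rewrite /Ohat mulmx_suml /wmin natr_sum scaler_suml; apply: eq_bigr => q _.
rewrite /casimir mulmx_suml.
transitivity (\sum_(a < nq q) (cq q ^ 2)%N%:R *: v); last first.
  by rewrite sumr_const card_ord -scaler_nat scalerA -natrM.
apply: eq_bigr => a _; rewrite mulmx_suml (bigD1 a) //= big1 ?addr0.
  by rewrite -mulmxA !h2 -scalemxAr h2 scalerA -natrM.
by move=> b nb; rewrite -mulmxA h1 // mulmx0.
Qed.

(** Write the characteristic polynomial as h (X - wmin)^m with h(wmin) != 0. The columns of e =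
    h(Ohat) lie in the generalized eigenspace, hence are invariant. So e/h(wmin) is an idempotent
    fixing every invariant, and [signed_count] is its trace, that is, its rank. *)
Lemma signed_count_neq0 : signed_count != 0 <-> exists2 v, v != 0 & invariant_vec v.
Proof.
have [m [h hroot hE]] := multiplicity_XsubC (char_poly Ohat) wmin%:R.
have {hroot} hr : h.[wmin%:R] != 0.
  by have := hroot; rewrite monic_neq0 ?char_poly_monic.
pose e := horner_mx Ohat h.
have he j : gen_eig m (col j e).
  rewrite /gen_eig colE mulmxA; have -> : (Ohat - wmin%:R%:M) ^+ m *m e = 0.
    have := Cayley_Hamilton Ohat; rewrite hE rmorphM rmorphXn rmorphB /= horner_mx_X horner_mx_C.
    move=> <-; rewrite -[LHS]/(_ * e) -/e; apply: commr_sym; apply: commrX; apply: commrB.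
      exact: comm_horner_mx.
    by apply: comm_mx_scalar.
  by rewrite mul0mx.
have etr : \sum_i e i i * \prod_q (sgcount (cq q) (@wt q i))%:~R = h.[wmin%:R] * signed_count.
  exact: horner_Ohat_trace.
split=> [nz|[v v0 hv]].
  have [j hj] : exists j, col j e != 0.
    have [/existsP//|] := boolP [exists j, col j e != 0].
    rewrite negb_exists => /forallP z; have e0 : e = 0.
      apply/matrixP => i j; have := z j; rewrite negbK => /eqP/matrixP/(_ i 0).
      by rewrite !mxE.
    move: etr; rewrite big1 => [|i _]; last by rewrite e0 mxE mul0r.
    by move/esym/eqP; rewrite mulf_eq0 (negbTE hr) (negbTE nz).
  by exists (col j e) => //; apply: gen_eig_inv (he j).
have eO : Ohat *m e = wmin%:R *: e.
  apply/matrixP => i j; have := invariant_Ohat (gen_eig_inv (he j)).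
  move/matrixP/(_ i 0); rewrite !mxE => <-; apply: eq_bigr => k _; by rewrite mxE.
have hmul (p : {poly R}) n (X : 'M[R]_(d.+1, n)) : Ohat *m X = wmin%:R *: X ->
    horner_mx Ohat p *m X = p.[wmin%:R] *: X.
  move=> hX; elim/poly_ind: p => [|p c IH].
    by rewrite rmorph0 mul0mx horner0 scale0r.
  rewrite rmorphD rmorphM /= horner_mx_X horner_mx_C hornerMXaddC mulmxDl -[_ * _]/(_ *m _).
  by rewrite -mulmxA hX -scalemxAr IH mul_scalar_mx scalerDl scalerA mulrC.
(* Where the diagonal of e is nonzero the weight is balanced, and there every [sgcount] is 1. *)
have trE : \tr e = h.[wmin%:R] * signed_count.
  rewrite -etr; apply: eq_bigr => i _.
  have [->|nz] := eqVneq (e i i) 0; first by rewrite mul0r.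
  rewrite big1 ?mulr1 // => q _.
  have nz' : col i e i 0 != 0 by rewrite mxE.
  have -> : sgcount (cq q) (@wt q i) = sgcount (cq q) (fun _ : 'I_(nq q) => cq q).
    apply: eq_bigr => t _; congr (_ * (nat_of_bool _)%:R); apply: eq_forallb => c.
    by rewrite (gen_eig_weight (he i) nz').
  by rewrite sgcount_const.
pose e' := h.[wmin%:R]^-1 *: e.
have id : e' *m e' = e'.
  by rewrite /e' -scalemxAl -scalemxAr (hmul h _ _ eO) !scalerA -mulrA mulVf // mulr1.
have e'v : e' *m v = v.
  by rewrite -scalemxAl (hmul h _ _ (invariant_Ohat hv)) scalerA mulVf // scale1r.
have : \tr e' != 0.
  rewrite (idempotent_trace id) pnatr_eq0 mxrank_eq0; apply: contraNneq v0 => e0.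
  by rewrite -e'v e0 mul0mx.
by rewrite mxtraceZ trE mulrA mulVf // mul1r.
Qed.

End InvariantCount.

(** * Invariant polynomials *)

Section GlOperators.
Variables (R : realFieldType) (nv : nat).
Local Notation P := {mpoly R[nv]}.

(* The action of the Lie algebra gl_nv on polynomials by derivations. *)
Definition opG (G : 'M[R]_nv) (p : P) : P := \sum_u \sum_v G u v *: ('X_u * p^`M(v)).

Lemma opG_is_linear G : linear (opG G).
Proof.
move=> c p q; rewrite /opG scaler_sumr -big_split /=; apply: eq_bigr => u _.
rewrite scaler_sumr -big_split /=; apply: eq_bigr => v _.
by rewrite mderivD mderivZ mulrDr scalerDr -scalerAr !scalerA mulrC.
Qed.
HB.instance Definition _ G := GRing.isLinear.Build R P P *:%R (opG G) (opG_is_linear G).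

Lemma opGD G H p : opG (G + H) p = opG G p + opG H p.
Proof.
rewrite /opG -big_split /=; apply: eq_bigr => u _; rewrite -big_split /=.
by apply: eq_bigr => v _; rewrite mxE scalerDl.
Qed.

Lemma opGZ c G p : opG (c *: G) p = c *: opG G p.
Proof.
rewrite /opG scaler_sumr; apply: eq_bigr => u _; rewrite scaler_sumr.
by apply: eq_bigr => v _; rewrite mxE scalerA.
Qed.

Lemma opGB G H p : opG (G - H) p = opG G p - opG H p.
Proof. by rewrite -scaleN1r opGD opGZ scaleN1r. Qed.

Lemma opG0 p : opG 0 p = 0.
Proof. by rewrite -(subrr (0 : 'M[R]_nv)) opGB subrr. Qed.

Lemma opG_sum (I : finType) (F : I -> 'M[R]_nv) p : opG (\sum_i F i) p = \sum_i opG (F i) p.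
Proof. by apply: (big_morph (opG^~ p)) => [x y|]; rewrite ?opGD ?opG0. Qed.

Lemma opG_delta u v p : opG (delta_mx u v) p = 'X_u * p^`M(v).
Proof.
rewrite /opG (bigD1 u) //= (bigD1 v) //= big1 => [|w nw].
  rewrite big1 => [|w nw]; first by rewrite !addr0 mxE !eqxx scale1r.
  by rewrite big1 // => z _; rewrite mxE (negbTE nw) scale0r.
by rewrite mxE eqxx (negbTE nw) scale0r.
Qed.

Lemma mderivXU (v w : 'I_nv) : ('X_w : P)^`M(v) = (v == w)%:R.
Proof.
rewrite mderivX mnm1E eq_sym; case: eqP => [->|_]; last by rewrite scale0r.
by rewrite scale1r (_ : (U_(w) - U_(w))%MM = 0%MM) ?mpolyX0 //; apply/mnmP => x; rewrite mnmBE subnn mnm0E.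
Qed.

(** Isolates the second-order part, which is symmetric in G and H and therefore cancels in the
    bracket. *)
Lemma opGM G H p : opG G (opG H p) = opG (G *m H) p +
  \sum_u \sum_v \sum_w \sum_z (G u v * H w z) *: ('X_u * 'X_w * p^`M(z)^`M(v)).
Proof.
rewrite {1}/opG; under eq_bigr => u _.
  under eq_bigr => v _.
    rewrite /opG (linear_sum (mderiv v)) mulr_sumr scaler_sumr.
    under eq_bigr => w _.
      rewrite (linear_sum (mderiv v)) mulr_sumr scaler_sumr.
      under eq_bigr => z _.
        rewrite /= mderivZ -scalerAr scalerA mderivM mderivXU mulrDr scalerDr.
        over.
      rewrite big_split /=.
      over.
    rewrite big_split /=.
    over.
  rewrite big_split /=.
  over.
rewrite big_split /=; congr (_ + _); last first.
  by apply: eq_bigr => u _; apply: eq_bigr => v _; apply: eq_bigr => w _;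
     apply: eq_bigr => z _; rewrite mulrA.
rewrite /opG; apply: eq_bigr => u _.
transitivity (\sum_v \sum_z (G u v * H v z) *: ('X_u * p^`M(z))).
  apply: eq_bigr => v _; rewrite (bigD1 v) //= [X in _ + X]big1 ?addr0 => [|w nw].
    by apply: eq_bigr => z _; rewrite eqxx mul1r.
  by rewrite big1 // => z _; rewrite eq_sym (negbTE nw) mul0r mulr0 scaler0.
rewrite exchange_big /=; apply: eq_bigr => z _; rewrite mxE scaler_suml.
by [].
Qed.

Lemma opG_bracket G H p : opG G (opG H p) - opG H (opG G p) = opG (G *m H - H *m G) p.
Proof.
rewrite !opGM opGB opprD addrACA -[RHS]addr0; congr (_ + _).
apply/eqP; rewrite subr_eq0; apply/eqP.
rewrite !pair_bigA /= [RHS](reindex (fun p : 'I_nv * 'I_nv * 'I_nv * 'I_nv =>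
  (p.1.2, p.2, p.1.1.1, p.1.1.2))) /=; last first.
  by exists (fun p : 'I_nv * 'I_nv * 'I_nv * 'I_nv => (p.1.2, p.2, p.1.1.1, p.1.1.2)) => -[[[u v] w] z].
by apply: eq_bigr => -[[[u v] w] z] _ /=; rewrite mulrC ['X_u * _]mulrC mderiv_comm.
Qed.

Lemma opG_deg G m m' : (opG G 'X_[m'])@_m != 0 -> mdeg m = mdeg m'.
Proof.
apply: contraNeq => ne; rewrite /opG raddf_sum big1 // => u _; rewrite raddf_sum big1 // => v _.
rewrite /= mcoeffZ mderivX -scalerAr mcoeffZ -mpolyXD mcoeffX.
have [->|pos] := posnP (m' v); first by rewrite mul0r mulr0.
case: eqP => [e|_]; last by rewrite !mulr0.
have le : (U_(v) <= m')%MM by rewrite lep1mP -lt0n.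
by case/eqP: ne; rewrite -e mdegD -{2}(submK le) mdegD !mdeg1 addnC.
Qed.

Variables (D d : nat) (mon : 'I_d.+1 -> 'X_{1..nv}).
Hypothesis mon_inj : injective mon.
Hypothesis mon_deg : forall m, mdeg m = D <-> exists i, mon i = m.

Definition toP (v : 'cV[R]_d.+1) : P := \sum_i v i 0 *: 'X_[mon i].
Definition ofP (p : P) : 'cV[R]_d.+1 := \col_i p@_(mon i).
Definition matG (G : 'M[R]_nv) : 'M[R]_d.+1 := \matrix_(i, j) (opG G 'X_[mon j])@_(mon i).

Lemma mcoeff_toP v i : (toP v)@_(mon i) = v i 0.
Proof.
rewrite /toP raddf_sum (bigD1 i) //= mcoeffZ mcoeffX eqxx mulr1 big1 ?addr0 // => j nj.
by rewrite mcoeffZ mcoeffX (inj_eq mon_inj) (negbTE nj) mulr0.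
Qed.

Lemma mcoeff_toP_deg v m : mdeg m <> D -> (toP v)@_m = 0.
Proof.
move=> h; rewrite /toP raddf_sum big1 //= => j _; rewrite mcoeffZ mcoeffX.
case: eqP => [e|]; last by rewrite mulr0.
by case: h; apply/mon_deg; exists j.
Qed.

Lemma toPK v : ofP (toP v) = v.
Proof. by apply/matrixP => i z; rewrite ord1 mxE mcoeff_toP. Qed.

Lemma toP_inj : injective toP.
Proof. exact: can_inj toPK. Qed.

Lemma toP0 : toP 0 = 0.
Proof. by rewrite /toP big1 // => i _; rewrite mxE scale0r. Qed.

Lemma toPZ c v : toP (c *: v) = c *: toP v.
Proof. by rewrite /toP scaler_sumr; apply: eq_bigr => i _; rewrite mxE scalerA. Qed.

Lemma toPB u v : toP (u - v) = toP u - toP v.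
Proof. by rewrite /toP -sumrB; apply: eq_bigr => i _; rewrite !mxE scalerBl. Qed.

Lemma toP_matG G v : toP (matG G *m v) = opG G (toP v).
Proof.
have oE m : (opG G (toP v))@_m = \sum_j v j 0 * (opG G 'X_[mon j])@_m.
  have -> : opG G (toP v) = \sum_j v j 0 *: opG G 'X_[mon j].
    by rewrite /toP [LHS](linear_sum (opG G)); apply: eq_bigr => j _; rewrite /= linearZ.
  by rewrite [LHS](raddf_sum (mcoeff m)); apply: eq_bigr => j _; rewrite /= mcoeffZ.
apply/mpolyP => m; have [/eqP/mon_deg[i <-]|/eqP ne] := boolP (mdeg m == D).
  by rewrite mcoeff_toP oE mxE; apply: eq_bigr => j _; rewrite mxE mulrC.
rewrite mcoeff_toP_deg // oE big1 // => j _.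
have [->|/opG_deg e] := eqVneq ((opG G 'X_[mon j])@_m) 0; first by rewrite mulr0.
by case: ne; rewrite e; apply/mon_deg; exists j.
Qed.

Lemma matG_eq (A B : 'M[R]_d.+1) : (forall v, toP (A *m v) = toP (B *m v)) -> A = B.
Proof.
move=> h; apply/matrixP => i j; have /toP_inj := h (delta_mx j 0).
by rewrite -!colE => /matrixP/(_ i 0); rewrite !mxE.
Qed.

Lemma matG_bracket G H : matG G *m matG H - matG H *m matG G = matG (G *m H - H *m G).
Proof.
apply: matG_eq => v; rewrite mulmxBl toPB -!mulmxA !toP_matG opG_bracket //.
Qed.

Lemma matGZ c G : matG (c *: G) = c *: matG G.
Proof. by apply/matrixP => i j; rewrite !mxE opGZ mcoeffZ. Qed.

Lemma matGB G H : matG (G - H) = matG G - matG H.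
Proof. by apply/matrixP => i j; rewrite !mxE opGB mcoeffB. Qed.

Lemma toP_ofP p : (forall m, p@_m != 0 -> mdeg m = D) -> toP (ofP p) = p.
Proof.
move=> h; apply/mpolyP => m; have [/eqP/mon_deg[i <-]|/eqP ne] := boolP (mdeg m == D).
  by rewrite mcoeff_toP mxE.
rewrite mcoeff_toP_deg //; apply/esym/eqP; apply: contraT => /h //.
Qed.

End GlOperators.

(** The dimension is given as a successor, the form in which [horner_mx] sees a ring of matrices;
    [0 < nv] ensures that some monomial of degree D exists. *)
Lemma homog_basis nv D : (0 < nv)%N -> exists (d : nat) (mon : 'I_d.+1 -> 'X_{1..nv}),
  injective mon /\ forall m, mdeg m = D <-> exists i, mon i = m.
Proof.
move=> h; pose J : finType := {m : 'X_{1..nv < D.+1} | mdeg m == D}.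
have e0 : mdeg (U_(Ordinal h) *+ D)%MM = D by rewrite mdegMn mdeg1 mul1n.
have lt0 : (mdeg (U_(Ordinal h) *+ D)%MM < D.+1)%N by rewrite e0.
pose j0 : J := exist _ (BMultinom lt0) (introT eqP e0).
have cE : #|J| = #|J|.-1.+1 by rewrite prednK //; apply/card_gt0P; exists j0.
exists #|J|.-1, (fun i => bmnm (val (enum_val (cast_ord (esym cE) i)))); split.
  move=> i j /= e; apply: (@cast_ord_inj _ _ (esym cE)); apply: enum_val_inj.
  by apply: val_inj; apply: val_inj.
move=> m; split=> [dm|[i <-]]; last by apply/eqP; exact: (valP (enum_val (cast_ord (esym cE) i))).
have ltm : (mdeg m < D.+1)%N by rewrite dm.
pose j : J := exist _ (BMultinom ltm) (introT eqP dm).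
exists (cast_ord cE (enum_rank j)).
by rewrite cast_ordK enum_rankK.
Qed.

(** * Row and column operators on a matrix of variables *)

Section MatrixVariables.
Variables (R : realFieldType) (N l : nat).
Local Notation P := {mpoly R[N * l]}.

(* Elementary matrices of the row and column operations on an N x l matrix of
   variables. *)
Definition LL (a b : 'I_N) : 'M[R]_(N * l) :=
  \sum_c delta_mx (mxvec_index a c) (mxvec_index b c).
Definition RR (c e : 'I_l) : 'M[R]_(N * l) :=
  \sum_a delta_mx (mxvec_index a c) (mxvec_index a e).

Lemma mxvec_index_eq (a b : 'I_N) (c e : 'I_l) :
  (mxvec_index a c == mxvec_index b e) = (a == b) && (c == e).
Proof.
apply/eqP/andP => [h|[/eqP-> /eqP->//]].
by have := enum_rank_inj (cast_ord_inj h) => -[-> ->].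
Qed.

Lemma deltaM (a b a' b' : 'I_N) (c e c' e' : 'I_l) :
  delta_mx (mxvec_index a c) (mxvec_index b e) *m
  delta_mx (mxvec_index a' c') (mxvec_index b' e') =
  ((b == a') && (e == c'))%:R *: delta_mx (mxvec_index a c) (mxvec_index b' e') :> 'M[R]_(N * l).
Proof.
by rewrite mul_delta_mx_cond mxvec_index_eq; case: (_ && _); rewrite ?scale1r ?scale0r ?mulr1n.
Qed.

Lemma LLM a b c e : LL a b *m LL c e = (b == c)%:R *: LL a e.
Proof.
rewrite /LL mulmx_suml scaler_sumr; apply: eq_bigr => x _.
rewrite mulmx_sumr (bigD1 x) //= deltaM eqxx andbT big1 ?addr0 // => z nz.
by rewrite deltaM [x == z]eq_sym (negbTE nz) andbF scale0r.
Qed.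

Lemma RRM a b c e : RR a b *m RR c e = (b == c)%:R *: RR a e.
Proof.
rewrite /RR mulmx_suml scaler_sumr; apply: eq_bigr => x _.
rewrite mulmx_sumr (bigD1 x) //= deltaM eqxx big1 ?addr0 // => z nz.
by rewrite deltaM [x == z]eq_sym (negbTE nz) scale0r.
Qed.

Lemma LR_comm a b c e : LL a b *m RR c e = RR c e *m LL a b.
Proof.
transitivity (delta_mx (mxvec_index a c) (mxvec_index b e) : 'M[R]_(N * l)).
  rewrite /LL /RR mulmx_suml (bigD1 c) //= mulmx_sumr (bigD1 b) //= deltaM !eqxx scale1r.
  rewrite big1 => [|x nx]; last by rewrite deltaM [b == x]eq_sym (negbTE nx) scale0r.
  rewrite addr0 big1 ?addr0 // => x nx; rewrite mulmx_sumr big1 // => z _.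
  by rewrite deltaM (negbTE nx) andbF scale0r.
rewrite /LL /RR mulmx_suml (bigD1 a) //= mulmx_sumr (bigD1 e) //= deltaM !eqxx scale1r.
rewrite big1 => [|x nx]; last by rewrite deltaM [e == x]eq_sym (negbTE nx) andbF scale0r.
rewrite addr0 big1 ?addr0 // => x nx; rewrite mulmx_sumr big1 // => z _.
by rewrite deltaM (negbTE nx) scale0r.
Qed.

Definition rowdeg (m : 'X_{1..N * l}) (a : 'I_N) : nat := (\sum_c m (mxvec_index a c))%N.
Definition coldeg (m : 'X_{1..N * l}) (c : 'I_l) : nat := (\sum_a m (mxvec_index a c))%N.

Lemma XderivX (u : 'I_(N * l)) m : 'X_u * ('X_[m] : P)^`M(u) = (m u)%:R *: 'X_[m].
Proof. exact: thetaX. Qed.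

Lemma LL_diag a m : opG (LL a a) ('X_[m] : P) = (rowdeg m a)%:R *: 'X_[m].
Proof.
rewrite /LL opG_sum /rowdeg natr_sum scaler_suml; apply: eq_bigr => c _.
by rewrite opG_delta XderivX.
Qed.

Lemma RR_diag c m : opG (RR c c) ('X_[m] : P) = (coldeg m c)%:R *: 'X_[m].
Proof.
rewrite /RR opG_sum /coldeg natr_sum scaler_suml; apply: eq_bigr => a _.
by rewrite opG_delta XderivX.
Qed.

Lemma mdeg_row m : mdeg m = (\sum_a rowdeg m a)%N.
Proof.
rewrite mdegE /rowdeg pair_bigA /=.
rewrite (reindex (fun p : 'I_N * 'I_l => mxvec_index p.1 p.2)) //.
exists (fun x => enum_val (cast_ord (esym (mxvec_cast N l)) x)) => [[a c] _|x _].
  by rewrite /mxvec_index cast_ordK enum_rankK.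
by rewrite /mxvec_index -surjective_pairing enum_valK cast_ordKV.
Qed.

Lemma mdeg_col m : mdeg m = (\sum_c coldeg m c)%N.
Proof. by rewrite mdeg_row /rowdeg exchange_big. Qed.

End MatrixVariables.

(** Sum 2 f(x) c <= f(x)^2 + c^2 over x, with equality only at f(x) = c. For row and column degrees
    this makes the invariant weight the unique one of least norm. *)
Lemma sum_sq_min (X : finType) (f : X -> nat) c : (\sum_x f x = #|X| * c)%N ->
  (#|X| * c ^ 2 <= \sum_x f x ^ 2)%N /\
  ((\sum_x f x ^ 2 = #|X| * c ^ 2)%N -> forall x, f x = c).
Proof.
move=> h.
have key : (\sum_x 2 * (f x * c) <= \sum_x (f x ^ 2 + c ^ 2) ?= iff [forall x, f x == c])%N.
  by apply: leqif_sum => x _; apply: nat_Cauchy.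
have e1 : (\sum_x 2 * (f x * c) = 2 * (#|X| * c ^ 2))%N.
  by rewrite -big_distrr -big_distrl /= h -mulnA mulnn.
have e2 : (\sum_x (f x ^ 2 + c ^ 2) = \sum_x f x ^ 2 + #|X| * c ^ 2)%N.
  by rewrite big_split /= sum_nat_const.
rewrite e1 e2 in key; split.
  by have := leqif_refl true; case: key => le _; lia.
move=> e x; case: key => _; rewrite e addnn mul2n eqxx => /esym/forallP/(_ x)/eqP //.
Qed.

Lemma sgcount_sum n c (nu : 'I_n -> nat) : sgcount c nu != 0 -> (\sum_j nu j = n * c)%N.
Proof.
move=> nz; have [/existsP[s /forallP h]|] :=
  boolP [exists s : 'S_n, [forall j : 'I_n, nu j + j == c + s j]%N].
  have : (\sum_(j < n) (nu j + j) = \sum_(j < n) (c + s j))%N.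
    by apply: eq_bigr => j _; apply/eqP.
  rewrite !big_split /= sum_nat_const card_ord.
  have -> : (\sum_(j < n) s j = \sum_(j < n) j)%N by rewrite [RHS](reindex_inj (@perm_inj _ s)).
  by move/eqP; rewrite eqn_add2r => /eqP.
rewrite negb_exists => /forallP h; case/eqP: nz; rewrite /sgcount big1 // => s _.
by rewrite (negbTE (h s)) mulr0.
Qed.

(** * Invariant polynomials and the Littlewood-Richardson coefficient *)

Section LRInvariant.
Variables (R : realFieldType) (K N : nat) (L : 'I_K -> nat).
Local Notation Cs := {k : 'I_K & 'I_(L k)}.
Local Notation l := #|{: Cs}|.
Definition block (c : 'I_l) : 'I_K := tag (enum_val c).
Definition slot (k : 'I_K) (j : 'I_(L k)) : 'I_l :=
  enum_rank (Tagged (fun k => 'I_(L k)) j : Cs).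
Definition invariant_poly (M : nat) (f : {mpoly R[N * l]}) : Prop :=
  [/\ forall a b : 'I_N, a != b -> opG (LL R l a b) f = 0,
      forall a : 'I_N, opG (LL R l a a) f = M%:R *: f,
      forall c e, c != e -> block c = block e -> opG (RR R N c e) f = 0
    & forall c, opG (RR R N c c) f = N%:R *: f].

Lemma card_Cs : l = (\sum_k L k)%N.
Proof. by rewrite card_tagged sumnE big_map big_enum; apply: eq_bigr => k _; rewrite card_ord. Qed.

Lemma slot_inj k : injective (@slot k).
Proof.
move=> i j /enum_rank_inj /eqP; rewrite eq_Tagged => /eqP //.
Qed.

Lemma block_slot k (j : 'I_(L k)) : block (slot j) = k.
Proof. by rewrite /block /slot enum_rankK. Qed.

Lemma slotP c : exists j : 'I_(L (block c)), slot j = c.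
Proof.
exists (tagged (enum_val c)); rewrite /slot /block.
have h (x : Cs) : Tagged (fun k => 'I_(L k)) (tagged x) = x by case: x.
by rewrite h enum_valK.
Qed.

Let M := (\sum_k L k)%N.
(** The factors of the group: [None] is GL_N acting on rows, with target weight M; [Some k] is
    GL_(L_k) acting on the columns of block k, with target weight N. *)
Let nq (q : option 'I_K) : nat := if q is Some k then L k else N.
Let cq (q : option 'I_K) : nat := if q is Some k then N else M.
Variables (d : nat) (mon : 'I_d.+1 -> 'X_{1..N * l}).
Hypothesis mon_inj : injective mon.
Hypothesis mon_deg : forall m, mdeg m = (N * M)%N <-> exists i, mon i = m.

Let wt q (i : 'I_d.+1) : 'I_(nq q) -> nat :=
  match q return 'I_(nq q) -> nat with
  | Some k => fun j : 'I_(L k) => coldeg (mon i) (slot j)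
  | None => fun a => rowdeg (mon i) a
  end.

Let G q : 'I_(nq q) -> 'I_(nq q) -> 'M[R]_(N * l) :=
  match q return 'I_(nq q) -> 'I_(nq q) -> 'M[R]_(N * l) with
  | Some k => fun c e : 'I_(L k) => RR R N (slot c) (slot e)
  | None => fun a b => LL R l a b
  end.

Let E q (a b : 'I_(nq q)) : 'M[R]_d.+1 := matG mon (G a b).

Lemma lr_GM q (a b c e : 'I_(nq q)) : G a b *m G c e = (b == c)%:R *: G a e.
Proof.
case: q a b c e => [k|] a b c e /=; last exact: LLM.
by rewrite RRM (inj_eq (@slot_inj k)).
Qed.

Lemma lr_Ebracket q (a b c e : 'I_(nq q)) :
  E a b *m E c e - E c e *m E a b = (b == c)%:R *: E a e - (e == a)%:R *: E c b.
Proof. by rewrite /E (matG_bracket mon_inj mon_deg) !lr_GM matGB !matGZ. Qed.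

Lemma lr_Ecross q q' : q != q' -> forall (a b : 'I_(nq q)) (c e : 'I_(nq q')),
  E a b *m E c e = E c e *m E a b.
Proof.
move=> ne a b c e; apply/eqP; rewrite -subr_eq0 (matG_bracket mon_inj mon_deg).
suff -> : G a b *m G c e = G c e *m G a b.
  by rewrite subrr; apply/eqP/matrixP => i j; rewrite mxE opG0 mcoeff0 mxE.
case: q q' ne a b c e => [k|] [k'|] //= ne a b c e; last 2 first.
- by rewrite LR_comm.
- by rewrite LR_comm.
rewrite !RRM; have h (x : 'I_(L k)) (z : 'I_(L k')) : (slot x == slot z) = false.
  apply/eqP => /(congr1 block); rewrite !block_slot => e0.
  by rewrite e0 eqxx in ne.
by rewrite h eq_sym h !scale0r.
Qed.

Lemma lr_Ediag q (a : 'I_(nq q)) i j : E a a i j = (i == j)%:R * (wt i a)%:R.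
Proof.
have eq_i : (mon j == mon i) = (i == j) by rewrite (inj_eq mon_inj) eq_sym.
rewrite mxE; case: q a => [k|] a /=; rewrite ?RR_diag ?LL_diag mcoeffZ mcoeffX eq_i mulrC;
by case: eqP => [->|]; rewrite ?mul0r.
Qed.

(** Follows from the bracket with the diagonal operator [E c c], so rows and columns need no
    separate inspection of monomials. *)
Lemma lr_Eshift q (a b : 'I_(nq q)) i j : E a b i j != 0 ->
  forall c, (wt i c + (c == b) = wt j c + (c == a))%N.
Proof.
move=> nz c; have := lr_Ebracket c c a b => /matrixP/(_ i j).
rewrite [LHS]mxE [X in _ + X]mxE.
have -> : (E c c *m E a b) i j = (wt i c)%:R * E a b i j.
  rewrite mxE (bigD1 i) //= big1 ?addr0 => [|k nk]; first by rewrite lr_Ediag eqxx mul1r.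
  by rewrite lr_Ediag eq_sym (negbTE nk) mul0r mul0r.
have -> : (E a b *m E c c) i j = (wt j c)%:R * E a b i j.
  rewrite mxE (bigD1 j) //= big1 ?addr0 => [|k nk]; first by rewrite lr_Ediag eqxx mul1r mulrC.
  by rewrite lr_Ediag (negbTE nk) mul0r mulr0.
rewrite -mulrBl.
have -> : ((c == a)%:R *: E c b - (b == c)%:R *: E a c) i j =
   ((c == a)%:R - (c == b)%:R) * E a b i j.
  rewrite !mxE -/(E c b i j) [b == c]eq_sym mulrBl.
  by case: eqP => [->|_]; case: eqP => [->|_]; rewrite ?mul0r ?mul1r.
move/(mulIf nz)/eqP; rewrite subr_eq addrAC eq_sym subr_eq -!natrD eqr_nat => /eqP; lia.
Qed.

Hypothesis N0 : (0 < N)%N.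
Hypothesis M0 : (0 < M)%N.
Hypothesis LN : forall k, (L k <= N)%N.

Lemma lr_rowsum i : (\sum_a rowdeg (mon i) a = #|'I_N| * M)%N.
Proof. by rewrite card_ord -mdeg_row; apply/mon_deg; exists i. Qed.

Lemma lr_colsum i : (\sum_(c : Cs) coldeg (mon i) (enum_rank c) = l * N)%N.
Proof.
have -> : (l * N = N * M)%N by rewrite card_Cs mulnC.
have <- : mdeg (mon i) = (N * M)%N by apply/mon_deg; exists i.
rewrite mdeg_col [RHS](reindex (fun c : Cs => enum_rank c)) //.
by exists enum_val => x _; rewrite ?enum_rankK ?enum_valK.
Qed.

Lemma sum_option (F : option 'I_K -> nat) : (\sum_q F q = F None + \sum_k F (Some k))%N.
Proof.
rewrite (bigD1 None) //=; congr (_ + _)%N.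
rewrite (reindex_omap Some id) //=; last by case.
by apply: eq_bigl => k; rewrite eqxx.
Qed.

Lemma prod_option (F : option 'I_K -> R) : \prod_q F q = F None * \prod_k F (Some k).
Proof.
rewrite (bigD1 None) //=; congr (_ * _).
rewrite (reindex_omap Some id) //=; last by case.
by apply: eq_bigl => k; rewrite eqxx.
Qed.

Lemma lr_wnormE i : wnorm wt i =
  (\sum_a rowdeg (mon i) a ^ 2 + \sum_(c : Cs) coldeg (mon i) (enum_rank c) ^ 2)%N.
Proof.
rewrite /wnorm sum_option /=; congr (_ + _)%N.
by rewrite sig_big_dep /=; apply: eq_bigr => -[k j] _.
Qed.

Lemma lr_wminE : wmin nq cq = (#|'I_N| * M ^ 2 + l * N ^ 2)%N.
Proof. by rewrite /wmin sum_option /= card_ord -big_distrl /= card_Cs. Qed.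

Lemma lr_wnorm_min i : (wmin nq cq <= wnorm wt i)%N.
Proof.
rewrite lr_wnormE lr_wminE; have [h1 _] := sum_sq_min (lr_rowsum i).
have [h2 _] := sum_sq_min (lr_colsum i); exact: leq_add.
Qed.

Lemma lr_wnorm_eq i : wnorm wt i = wmin nq cq -> forall q (a : 'I_(nq q)), wt i a = cq q.
Proof.
rewrite lr_wnormE lr_wminE => e; have [h1 h1'] := sum_sq_min (lr_rowsum i).
have [h2 h2'] := sum_sq_min (lr_colsum i).
have e1 : (\sum_a rowdeg (mon i) a ^ 2 = #|'I_N| * M ^ 2)%N.
  by apply/eqP; rewrite eqn_leq h1 andbT -(leq_add2r (l * N ^ 2)) -e leq_add2l.
have e2 : (\sum_(c : Cs) coldeg (mon i) (enum_rank c) ^ 2 = l * N ^ 2)%N.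
  by apply/eqP; rewrite -(eqn_add2l (#|'I_N| * M ^ 2)) -{1}e1 e.
by case=> [k|] a /=; [exact: h2'|exact: h1'].
Qed.

Lemma signed_count_LR : signed_count R cq wt =
  (LRcoef [seq rect N (L i) | i <- enum 'I_K] (rect M N))%:~R.
Proof.
(* Exponents in degree NM are at most NM; the extra N + N is what the Jacobi-Trudi truncation asks
   for. *)
pose B := (N * M + (N + N))%N.
rewrite (@LRcoef_rect K L N M B) // ?leq_addl // rmorph_sum /=.
pose U : finType := {ffun Cs -> {ffun 'I_N -> 'I_B.+1}}.
pose Fm (i : 'I_d.+1) : U := [ffun c => [ffun a => inord (mon i (mxvec_index a (enum_rank c)))]].
have FmE i c a : Fm i c a = mon i (mxvec_index a (enum_rank c)) :> nat.
  rewrite !ffunE inordK // ltnS; apply: leq_trans (_ : mdeg (mon i) <= _)%N.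
    by rewrite mdegE (bigD1 (mxvec_index a (enum_rank c))) //= leq_addr.
  by rewrite (_ : mdeg (mon i) = (N * M)%N) ?leq_addr //; apply/mon_deg; exists i.
have Fm_inj : injective Fm.
  move=> i j e; apply: mon_inj; apply/mnmP => x; case/mxvec_indexP: x => a c.
  by rewrite -[c]enum_valK -!FmE e.
(* An exponent array outside the image of [Fm] has total degree other than NM, so its row sign
   vanishes by [sgcount_sum]. *)
rewrite [RHS](bigID (fun F => F \in Fm @: setT)) /= [X in _ = _ + X]big1 ?addr0; last first.
  move=> F nF; apply/eqP; rewrite intr_eq0 mulf_eq0.
  apply: contraT; rewrite negb_or => /andP[/sgcount_sum tot _].
  case/negP: nF; pose m : 'X_{1..N * l} := [multinom nat_of_ord
     (let p := enum_val (cast_ord (esym (mxvec_cast N l)) x) in F (enum_val p.2) p.1) | x < N * l].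
  have mE a c : m (mxvec_index a c) = F (enum_val c) a.
    by rewrite mnmE /mxvec_index cast_ordK enum_rankK.
  have : mdeg m = (N * M)%N.
    rewrite -tot mdeg_row; apply: eq_bigr => a _; rewrite /rowdeg.
    rewrite (reindex (fun c : Cs => enum_rank c)) /=; last first.
      by exists enum_val => x _; rewrite ?enum_rankK ?enum_valK.
    by apply: eq_bigr => c _; rewrite mE enum_rankK.
  case/mon_deg => i mi; apply/imsetP; exists i => //.
  apply/ffunP => c; apply/ffunP => a; apply: val_inj; rewrite /= FmE mi mE enum_rankK //.
rewrite big_imset /=; last by move=> i j _ _; apply: Fm_inj.
rewrite /signed_count; apply: eq_big => [i|i _]; first by rewrite inE.
rewrite prod_option rmorphM rmorph_prod /=; congr (_ * _).
  congr (_%:~R); apply: eq_bigr => s _; congr (_ * (nat_of_bool _)%:R).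
  apply: eq_forallb => a; congr (_ + _ == _)%N; rewrite /rowdeg.
  rewrite (reindex (fun c : Cs => enum_rank c)) /=; last first.
    by exists enum_val => x _; rewrite ?enum_rankK ?enum_valK.
  by apply: eq_bigr => c _; rewrite FmE.
apply: eq_bigr => k _; congr (_%:~R); apply: eq_bigr => s _; congr (_ * (nat_of_bool _)%:R).
apply: eq_forallb => j; congr (_ + _ == _)%N; rewrite /coldeg.
by apply: eq_bigr => a _; rewrite FmE.
Qed.

Lemma LR_invariant_aux : LRcoef [seq rect N (L i) | i <- enum 'I_K] (rect M N) != 0 <->
  exists2 f : {mpoly R[N * l]}, f != 0 & invariant_poly M f.
Proof.
have key := signed_count_neq0 lr_Ediag lr_Eshift lr_Ebracket lr_Ecross lr_wnorm_min lr_wnorm_eq.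
rewrite signed_count_LR intr_eq0 in key; apply: iff_trans key _; split.
  move=> [v v0 [h1 h2]]; exists (toP mon v).
    by apply: contraNneq v0 => e; rewrite -[v](toPK mon_inj) e; apply/eqP/matrixP => i j; rewrite !mxE mcoeff0.
  split.
  - move=> a b ne; have := h1 None a b ne; rewrite /E /= => /(congr1 (toP mon)).
    by rewrite (toP_matG mon_inj mon_deg) toP0.
  - move=> a; have := h2 None a; rewrite /E /= => /(congr1 (toP mon)).
    by rewrite (toP_matG mon_inj mon_deg) toPZ.
  - move=> c e ne be; have [j jc] := slotP c; have := slotP e; rewrite -be => -[i ie].
    have nji : j != i by apply: contraNneq ne => ji; rewrite -jc -ie ji.
    have := h1 (Some (block c)) j i nji; rewrite /E /= jc ie => /(congr1 (toP mon)).
    by rewrite (toP_matG mon_inj mon_deg) toP0.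
  - move=> c; have [j jc] := slotP c.
    have := h2 (Some (block c)) j; rewrite /E /= jc => /(congr1 (toP mon)).
    by rewrite (toP_matG mon_inj mon_deg) toPZ.
move=> [f f0 [h1 h2 h3 h4]].
(* The diagonal row operators force every row degree to be M, hence f is homogeneous of degree
   NM. *)
have fdeg m : f@_m != 0 -> mdeg m = (N * M)%N.
  move=> nz; rewrite mdeg_row.
  transitivity (\sum_(a < N) M)%N; last by rewrite sum_nat_const card_ord.
  apply: eq_bigr => a _; have /(congr1 (mcoeff m)) := h2 a.
  have -> : (opG (LL R l a a) f)@_m = (rowdeg m a)%:R * f@_m.
    rewrite {1}[f]mpolyE [X in X@__](linear_sum (opG _)) [LHS](raddf_sum (mcoeff m)).
    rewrite [in RHS](mpolyE f) [X in _ * X](raddf_sum (mcoeff m)) mulr_sumr; apply: eq_bigr => m' _.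
    rewrite /= linearZ /= LL_diag !mcoeffZ !mcoeffX [RHS]mulrCA; congr (_ * _).
    by have [->|_] := eqVneq m' m; rewrite ?mulr0.
  by rewrite mcoeffZ => /(mulIf nz)/eqP; rewrite eqr_nat => /eqP.
have fK := toP_ofP mon_inj mon_deg fdeg.
exists (ofP mon f); first by apply: contraNneq f0 => e; rewrite -fK e toP0.
split=> [[k|] a|[k|] a] => [b|b||].
- move=> ne; apply: (toP_inj mon_inj); rewrite /E /= (toP_matG mon_inj mon_deg) fK toP0 h3 ?block_slot //.
  by rewrite (inj_eq (@slot_inj k)).
- by move=> ne; apply: (toP_inj mon_inj); rewrite /E /= (toP_matG mon_inj mon_deg) fK toP0 h1.
- by apply: (toP_inj mon_inj); rewrite /E /= (toP_matG mon_inj mon_deg) toPZ fK h4.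
- by apply: (toP_inj mon_inj); rewrite /E /= (toP_matG mon_inj mon_deg) toPZ fK h2.
Qed.

End LRInvariant.

Lemma LR_invariant (R : realFieldType) K N (L : 'I_K -> nat) :
  (0 < N)%N -> (0 < \sum_k L k)%N -> (forall k, (L k <= N)%N) ->
  LRcoef [seq rect N (L i) | i <- enum 'I_K] (rect (\sum_k L k) N) != 0 <->
  exists2 f : {mpoly R[N * #|{: {k : 'I_K & 'I_(L k)}}|]}, f != 0 & invariant_poly (\sum_k L k) f.
Proof.
move=> N0 M0 LN; have nv0 : (0 < N * #|{: {k : 'I_K & 'I_(L k)}}|)%N.
  by rewrite card_Cs muln_gt0 N0.
have [d [mon [mi md]]] := homog_basis (N * \sum_k L k) nv0.
exact: (LR_invariant_aux R mi md).
Qed.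

(** * Minimal vectors *)

Section Sequences.
Variable R : realType.

Definition cvgs (u : nat -> R) (x : R) :=
  forall e, 0 < e -> exists j0, forall j, (j0 <= j)%N -> `|u j - x| < e.

Lemma cvgs_const x : cvgs (fun=> x) x.
Proof. by move=> e e0; exists 0%N => j _; rewrite subrr normr0. Qed.

Lemma cvgsD u v x y : cvgs u x -> cvgs v y -> cvgs (fun j => u j + v j) (x + y).
Proof.
move=> hu hv e e0; have e2 : 0 < e / 2 by rewrite divr_gt0.
have [j1 h1] := hu _ e2; have [j2 h2] := hv _ e2; exists (maxn j1 j2) => j.
rewrite geq_max => /andP[/h1 l1 /h2 l2].
by rewrite opprD addrACA [e]splitr (le_lt_trans (ler_normD _ _)) // ltrD.
Qed.

Lemma cvgsM u v x y : cvgs u x -> cvgs v y -> cvgs (fun j => u j * v j) (x * y).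
Proof.
move=> hu hv e e0; pose C := `|x| + `|y| + 1.
have C0 : 0 < C by rewrite /C; have := normr_ge0 x; have := normr_ge0 y; lra.
pose d := Num.min 1 (e / (2 * C)).
have d0 : 0 < d by rewrite lt_min ltr01 divr_gt0 // mulr_gt0.
have [j1 h1] := hu _ d0; have [j2 h2] := hv _ d0; exists (maxn j1 j2) => j.
rewrite geq_max => /andP[/h1 l1 /h2 l2].
have -> : u j * v j - x * y = (u j - x) * (v j - y) + (u j - x) * y + x * (v j - y) by ring.
have d1 : d <= 1 by rewrite ge_min lexx.
have dC : d * (2 * C) <= e by rewrite -ler_pdivlMr ?mulr_gt0 // ge_min lexx orbT.
have n1 := normr_ge0 (u j - x); have n2 := normr_ge0 (v j - y).
have nx := normr_ge0 x; have ny := normr_ge0 y.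
apply: le_lt_trans (ler_normD _ _) _.
apply: le_lt_trans (lerD (ler_normD _ _) (lexx _)) _.
rewrite !normrM; move: l1 l2 n1 n2; move: `|u j - x| `|v j - y| => a b *.
have : a * b <= d * 1 by apply: ler_pM => //; lra.
have : a * `|y| <= d * `|y| by apply: ler_wpM2r => //; lra.
have : `|x| * b <= `|x| * d by apply: ler_wpM2l => //; lra.
rewrite /C in dC; nra.
Qed.

Lemma cvgs_uniq u x y : cvgs u x -> cvgs u y -> x = y.
Proof.
move=> hx hy; apply/eqP; rewrite -subr_eq0 -normr_eq0; apply: contraT => nz.
have e0 : 0 < `|x - y| / 2 by rewrite divr_gt0 // lt_def nz normr_ge0.
have [j1 h1] := hx _ e0; have [j2 h2] := hy _ e0.
have := h1 _ (leq_maxl j1 j2); have := h2 _ (leq_maxr j1 j2).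
set z := u _ => l2 l1; have : `|x - y| <= `|z - y| + `|z - x|.
  have -> : x - y = (z - y) - (z - x) by ring.
  exact: ler_normB.
lra.
Qed.

Lemma cvgs_ext u v x : (forall j, u j = v j) -> cvgs u x -> cvgs v x.
Proof. by move=> e h d /h[j0 hj]; exists j0 => j /hj; rewrite e. Qed.

(** [phi] need not be increasing: [j <= phi j] is enough to keep limits, and such maps compose. *)
Lemma cvgs_sub u x (phi : nat -> nat) : (forall j, (j <= phi j)%N) -> cvgs u x -> cvgs (u \o phi) x.
Proof.
by move=> hphi h e /h[j0 hj]; exists j0 => j le; apply: hj; apply: leq_trans (hphi j).
Qed.

Lemma cvgs_sum (I : Type) (r : seq I) (P : pred I) (u : I -> nat -> R) x :
  (forall i, cvgs (u i) (x i)) ->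
  cvgs (fun j => \sum_(i <- r | P i) u i j) (\sum_(i <- r | P i) x i).
Proof.
move=> h; elim: r => [|i r IH].
  by rewrite big_nil; apply: cvgs_ext (cvgs_const _) => j; rewrite big_nil.
rewrite big_cons; case Pi: (P i); last by apply: cvgs_ext IH => j; rewrite big_cons Pi.
by apply: cvgs_ext (cvgsD (h i) IH) => j; rewrite big_cons Pi.
Qed.

Lemma cvgs_prod (I : Type) (r : seq I) (P : pred I) (u : I -> nat -> R) x :
  (forall i, cvgs (u i) (x i)) ->
  cvgs (fun j => \prod_(i <- r | P i) u i j) (\prod_(i <- r | P i) x i).
Proof.
move=> h; elim: r => [|i r IH].
  by rewrite big_nil; apply: cvgs_ext (cvgs_const _) => j; rewrite big_nil.
rewrite big_cons; case Pi: (P i); last by apply: cvgs_ext IH => j; rewrite big_cons Pi.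
by apply: cvgs_ext (cvgsM (h i) IH) => j; rewrite big_cons Pi.
Qed.

Lemma cvgsX u x n : cvgs u x -> cvgs (fun j => u j ^+ n) (x ^+ n).
Proof.
move=> h; elim: n => [|n IH]; first by rewrite expr0; apply: cvgs_ext (cvgs_const _) => j.
by rewrite exprS; apply: cvgs_ext (cvgsM h IH) => j; rewrite exprS.
Qed.

Lemma cvgs_ge u x c : (forall j, c <= u j) -> cvgs u x -> c <= x.
Proof.
move=> h hu; rewrite leNgt; apply/negP => lt.
have cx : 0 < c - x by rewrite subr_gt0.
have [j0 /(_ _ (leqnn _))] := hu _ cx.
by have := h j0; rewrite ltr_norml => l1 /andP[_]; lra.
Qed.

(** The limit is the limit superior: the supremum of the values that u reaches or exceeds infinitely
    often. *)
Lemma bolzano1 (u : nat -> R) C : (forall j, `|u j| <= C) ->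
  exists phi x, (forall j, (j <= phi j)%N) /\ cvgs (u \o phi) x.
Proof.
move=> hC; pose E : R -> Prop := fun y => forall j0, exists2 j, (j0 <= j)%N & y <= u j.
have hsup : classical_sets.has_sup E.
  split; first by exists (- C) => j0; exists j0 => //; have := hC j0; rewrite ler_norml => /andP[].
  exists C => y /(_ 0%N)[j _ le]; apply: le_trans le _.
  by have := hC j; rewrite ler_norml => /andP[].
pose x := sup E.
have cl e j0 : 0 < e -> exists j, (j0 <= j)%N /\ `|u j - x| < e.
  move=> e0; have [y Ey ly] := sup_adherent e0 hsup.
  have nE : ~ E (x + e).
    move=> /(sup_upper_bound hsup); rewrite -/x => h; have : x + e <= x := h; lra.
  have [j1 hj1] : exists j1, forall j, (j1 <= j)%N -> u j < x + e.
    apply: NNPP => h; apply: nE => k; apply: NNPP => h'.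
    apply: h; exists k => j le; rewrite ltNge; apply/negP => le'; apply: h'.
    by exists j.
  have [j le1 le2] := Ey (maxn j0 j1); exists j; move: le1; rewrite geq_max => /andP[l1 l2].
  split=> //; rewrite ltr_norml; have := hj1 _ l2; move: ly; rewrite -/x; lra.
have cl' j : exists k, (j <= k)%N /\ `|u k - x| < j.+1%:R^-1.
  by apply: cl; rewrite invr_gt0 ltr0n.
pose phi j := proj1_sig (constructive_indefinite_description _ (cl' j)).
have hphi j : (j <= phi j)%N /\ `|u (phi j) - x| < j.+1%:R^-1.
  exact: (proj2_sig (constructive_indefinite_description _ (cl' j))).
exists phi, x; split=> [j|e e0]; first by case: (hphi j).
exists (Num.truncn e^-1) => j le; have [_ lt] := hphi j; apply: lt_le_trans lt _.
rewrite -[e]invrK lef_pV2 ?posrE ?invr_gt0 ?ltr0n //.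
apply: le_trans (ltW (truncnS_gt _)) _; rewrite ler_nat; exact: le.
Qed.

Lemma bolzano n (u : nat -> 'I_n -> R) C : (forall j i, `|u j i| <= C) ->
  exists phi x, (forall j, (j <= phi j)%N) /\ forall i, cvgs (fun j => u (phi j) i) (x i).
Proof.
elim: n u => [|n IH] u hC; first by exists id, (fun=> 0); split=> // -[].
have [phi [x [h1 h2]]] := IH (fun j i => u j (lift ord_max i)) (fun j i => hC j _).
have [psi [z [h3 h4]]] := bolzano1 (fun j => hC (phi j) ord_max).
exists (phi \o psi), (fun i => if unlift ord_max i is Some k then x k else z); split.
  by move=> j; apply: leq_trans (h3 j) (h1 _).
move=> i; case: unliftP => [k ->|->]; last exact: h4.
exact: (cvgs_sub h3 (h2 k)).
Qed.

Lemma cvgs_invS : cvgs (fun j => j.+1%:R^-1) 0.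
Proof.
move=> e e0; exists (Num.truncn e^-1) => j le.
rewrite subr0 ger0_norm ?invr_ge0 ?ler0n // -[e]invrK ltf_pV2 ?posrE ?invr_gt0 ?ltr0n //.
by apply: lt_le_trans (truncnS_gt _) _; rewrite ler_nat.
Qed.

Lemma cvgs_meval n (f : {mpoly R[n]}) (u : nat -> 'I_n -> R) x :
  (forall i, cvgs (fun j => u j i) (x i)) -> cvgs (fun j => f.@[u j]) f.@[x].
Proof.
move=> h; rewrite mevalE.
apply: (@cvgs_ext (fun j => \sum_(m <- msupp f) f@_m * \prod_i u j i ^+ m i)).
  by move=> j; rewrite mevalE.
apply: cvgs_sum => m; apply: cvgsM; first exact: cvgs_const.
by apply: cvgs_prod => i; apply: cvgsX.
Qed.

End Sequences.

(** * Polynomials along lines and flows of nilpotent operators *)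

Section LineRestriction.
Variables (R : realFieldType) (n : nat).
Implicit Types (f : {mpoly R[n]}) (v w : 'I_n -> R).

Definition line f v w : {poly R} := mmap (@polyC R) (fun i => (v i)%:P + w i *: 'X) f.

Lemma lineE f v w t : (line f v w).[t] = f.@[fun i => v i + t * w i].
Proof.
rewrite /line mevalE /mmap horner_sum; apply: eq_bigr => m _.
rewrite hornerM hornerC; congr (_ * _); rewrite /mmap1 horner_prod; apply: eq_bigr => i _.
by rewrite horner_exp !hornerE mulrC.
Qed.

Lemma deriv_line f v w : (line f v w)^`() = \sum_i w i *: line f^`M(i) v w.
Proof.
pose ok f := (line f v w)^`() = \sum_i w i *: line f^`M(i) v w.
have lineD p q : line (p + q) v w = line p v w + line q v w by rewrite /line mmapD.
have lineM p q : line (p * q) v w = line p v w * line q v w.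
  by rewrite /line rmorphM.
have okM p q : ok p -> ok q -> ok (p * q).
  move=> hp hq; rewrite /ok lineM derivM hp hq mulr_suml mulr_sumr -big_split /=.
  by apply: eq_bigr => i _; rewrite mderivM lineD !lineM scalerDr -scalerAl -scalerAr.
have lineC c : line c%:MP v w = c%:P by rewrite /line mmapC.
have okC c : ok c%:MP.
  rewrite /ok lineC derivC big1 // => i _; rewrite mderivC -mpolyC0 lineC.
  by rewrite polyC0 scaler0.
have okX i : ok 'X_i.
  rewrite /ok; have -> : line 'X_i v w = (v i)%:P + w i *: 'X by rewrite /line mmapX mmap1U.
  rewrite derivD derivC add0r derivZ derivX (bigD1 i) //= big1 ?addr0.
    by rewrite mderivXU eqxx mulr1n -mpolyC1 lineC.
  move=> j nj; rewrite mderivXU (negbTE nj) mulr0n -mpolyC0 lineC.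
  by rewrite polyC0 scaler0.
rewrite -/(ok f); elim/mpolyind: f => [|c m p _ _ IH]; first exact: (okC 0).
rewrite /ok lineD derivD IH.
have okm : ok 'X_[m].
  rewrite mpolyXE_id; elim/big_ind: _ => [|p1 q1|i _]; [exact: (okC 1)|exact: okM|].
  by elim: (m i) => [|k IHk]; rewrite ?expr0 ?exprS; [exact: (okC 1)|apply: okM].
have := okM _ _ (okC c) okm; rewrite mul_mpolyC /ok => ->.
by rewrite -big_split; apply: eq_bigr => i _; rewrite mderivD lineD scalerDr.
Qed.

(** The partial derivatives vanish everywhere too, which reduces the coefficient at m to one of
    lower degree, up to a nonzero integer factor. *)
Lemma meval_eq0 f : (forall v, f.@[v] = 0) -> f = 0.
Proof.
have step (p : {mpoly R[n]}) i : (forall v, p.@[v] = 0) -> forall v, p^`M(i).@[v] = 0.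
  move=> h v; pose w k : R := (k == i)%:R.
  have q0 : line p v w = 0.
    apply: (@roots_geq_poly_eq0 R _ (mkseq (fun k => k%:R) (size (line p v w)))).
    - by apply/allP => x _; rewrite rootE lineE h.
    - by rewrite map_inj_uniq ?iota_uniq // => a b /eqP; rewrite eqr_nat => /eqP.
    - by rewrite size_mkseq.
  have := congr1 (fun q => q^`().[0]) q0; rewrite /= deriv_line deriv0 horner0 horner_sum.
  rewrite (bigD1 i) //= big1 ?addr0 => [|k nk]; last by rewrite hornerZ /w (negbTE nk) mul0r.
  by rewrite hornerZ lineE /w eqxx mul1r => <-; apply: meval_eq => k; rewrite mul0r addr0.
move=> h; apply/mpolyP => m; rewrite mcoeff0.
have [k] := ubnP (mdeg m); elim: k m f h => // k IH m f h hk.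
have [/eqP|] := eqVneq (mdeg m) 0%N.
  rewrite mdeg_eq0 => /eqP ->.
  rewrite -(h (fun=> 0)) mevalE {1}[f]mpolyE (raddf_sum (mcoeff 0%MM)); apply: eq_bigr => m' _.
  rewrite /= mcoeffZ mcoeffX; congr (_ * _); have [->|nm] := eqVneq m' 0%MM.
    by rewrite big1 // => i _; rewrite mnm0E expr0.
  have [i mi] : exists i, m' i != 0%N.
    have [/existsP//|] := boolP [exists i, m' i != 0%N].
    rewrite negb_exists => /forallP z; case/eqP: nm; apply/mnmP => i.
    by have := z i; rewrite negbK mnm0E => /eqP.
  by rewrite (bigD1 i) //= expr0n (negbTE mi) mul0r.
move=> nz; have [i mi] : exists i, m i != 0%N.
  have [/existsP//|] := boolP [exists i, m i != 0%N].
  rewrite negb_exists => /forallP z; case/eqP: nz; rewrite mdegE big1 // => i _.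
  by have := z i; rewrite negbK => /eqP.
have le : (U_(i) <= m)%MM by rewrite lep1mP.
have dm : mdeg m = (mdeg (m - U_(i))%MM).+1 by rewrite -{1}(submK le) mdegD mdeg1 addn1.
have := IH (m - U_(i))%MM f^`M(i) (step _ i h).
rewrite mcoeff_deriv submK // => /(_ _)/eqP; rewrite mulrn_eq0 /= => e.
by apply/eqP; apply: e; rewrite -ltnS -dm.
Qed.

Definition vmul (v : 'I_n -> R) (G : 'M[R]_n) : 'I_n -> R := fun z => \sum_u v u * G u z.

Lemma meval_opG G f v : (opG G f).@[v] = \sum_z vmul v G z * f^`M(z).@[v].
Proof.
rewrite /opG (raddf_sum (meval v)); under eq_bigr => u _.
  rewrite (raddf_sum (meval v)); under eq_bigr => z _ do rewrite /= mevalZ mevalM mevalXU.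
  over.
rewrite exchange_big /=; apply: eq_bigr => z _; rewrite /vmul mulr_suml.
by apply: eq_bigr => u _; ring.
Qed.

(** As G^2 = 0, the line v + t vG is a flow line of G: the field [vmul _ G] is constant along it.
    The derivative of f there is a value of [opG G f], which is 0. *)
Lemma opG_nilpotent G f v t : G *m G = 0 -> opG G f = 0 ->
  f.@[fun z => v z + t * vmul v G z] = f.@[v].
Proof.
move=> GG fG; have dz : (line f v (vmul v G))^`() = 0.
  apply: (@roots_geq_poly_eq0 R _ (mkseq (fun k => k%:R) (size (line f v (vmul v G))^`()))).
  - apply/allP => x _; rewrite rootE deriv_line horner_sum; apply/eqP.
    pose v' z := v z + x * vmul v G z.
    have e z : vmul v G z = vmul v' G z.
      rewrite /vmul /v'; under [RHS]eq_bigr => u _ do rewrite mulrDl.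
      rewrite big_split /= -[LHS]addr0; congr (_ + _).
      under eq_bigr => u _ do rewrite -mulrA.
      rewrite -mulr_sumr; apply/esym/eqP; rewrite mulf_eq0; apply/orP; right.
      rewrite /vmul; under eq_bigr => u _ do rewrite mulr_suml.
      rewrite exchange_big /= big1 // => y _.
      have /matrixP/(_ y z) := GG; rewrite !mxE => h.
      by under eq_bigr => u _ do rewrite -mulrA; rewrite -mulr_sumr h mulr0.
    transitivity ((opG G f).@[v']); last by rewrite fG meval0.
    by rewrite meval_opG; apply: eq_bigr => z _; rewrite hornerZ lineE e.
  - by rewrite map_inj_uniq ?iota_uniq // => a b /eqP; rewrite eqr_nat => /eqP.
  - by rewrite size_mkseq.
have c0 : (size (line f v (vmul v G)) <= 1)%N.
  move: dz; move: (line _ _ _) => q dz; case e: (size q) => [|[|k]] //.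
  have /polyP/(_ k) := dz; rewrite coef_deriv coef0 => /eqP; rewrite mulrn_eq0 /= => z.
  by have := lead_coef_eq0 q; rewrite lead_coefE e /= z -size_poly_eq0 e.
have e (x : R) : (line f v (vmul v G)).[x] = (line f v (vmul v G))`_0.
  by rewrite {1}(size1_polyC c0) hornerC.
rewrite -lineE e -(e 0) lineE.
by apply: meval_eq => z; rewrite mul0r addr0.
Qed.

Lemma meval_scale f (h v : 'I_n -> R) :
  (forall m, f@_m != 0 -> \prod_i h i ^+ m i = 1) ->
  f.@[fun i => h i * v i] = f.@[v].
Proof.
move=> hm; rewrite !mevalE; apply: eq_big_seq => m; rewrite mcoeff_msupp => /hm e.
by congr (_ * _); under eq_bigr => i _ do rewrite exprMn; rewrite big_split /= e mul1r.
Qed.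

End LineRestriction.

(** * Vectors of minimal norm on a level set of an invariant *)

Section KempfNess.
Variables (R : realType) (N l : nat) (T : eqType) (g : 'I_l -> T) (M : nat).
Variable f : {mpoly R[N * l]}.
Hypothesis f0 : f != 0.
Hypothesis fLL : forall a b : 'I_N, a != b -> opG (LL R l a b) f = 0.
Hypothesis fL : forall a : 'I_N, opG (LL R l a a) f = M%:R *: f.
Hypothesis fRR : forall c e : 'I_l, c != e -> g c = g e -> opG (RR R N c e) f = 0.
Hypothesis fR : forall c : 'I_l, opG (RR R N c c) f = N%:R *: f.

Implicit Types A : 'M[R]_(N, l).

Definition evm (A : 'M[R]_(N, l)) : R := f.@[fun x => mxvec A 0 x].
Definition nrm2 (A : 'M[R]_(N, l)) : R := \sum_a \sum_c A a c ^+ 2.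

Lemma diag_weight (G : 'M[R]_(N * l)) (w : 'X_{1..N * l} -> nat) k :
  (forall m, opG G 'X_[m] = (w m)%:R *: 'X_[m]) -> opG G f = k%:R *: f ->
  forall m, f@_m != 0 -> w m = k.
Proof.
move=> hG hf m nz; have /(congr1 (mcoeff m)) := hf.
have -> : (opG G f)@_m = (w m)%:R * f@_m.
  rewrite {1}[f]mpolyE [X in X@__](linear_sum (opG _)) [LHS](raddf_sum (mcoeff m)).
  rewrite [in RHS](mpolyE f) [X in _ * X](raddf_sum (mcoeff m)) mulr_sumr; apply: eq_bigr => m' _.
  rewrite /= linearZ /= hG !mcoeffZ !mcoeffX [RHS]mulrCA; congr (_ * _).
  by have [->|_] := eqVneq m' m; rewrite ?mulr0.
by rewrite mcoeffZ => /(mulIf nz)/eqP; rewrite eqr_nat => /eqP.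
Qed.

Lemma evm_ext A (v : 'I_(N * l) -> R) : (forall a c, v (mxvec_index a c) = A a c) -> f.@[v] = evm A.
Proof.
by move=> h; apply: meval_eq => x; case/mxvec_indexP: x => a c; rewrite mxvecE h.
Qed.

Lemma vmul_LL (A : 'M[R]_(N, l)) a b x c :
  vmul (fun x => mxvec A 0 x) (LL R l a b) (mxvec_index x c) = (x == b)%:R * A a c.
Proof.
rewrite /vmul (bigD1 (mxvec_index a c)) //= mxvecE.
have LLE u : LL R l a b u (mxvec_index x c) = ((u == mxvec_index a c) && (x == b))%:R.
  rewrite /LL summxE (bigD1 c) //= big1 ?addr0 => [|e ne].
    by rewrite mxE mxvec_index_eq eqxx andbT.
  by rewrite mxE [mxvec_index x c == _]mxvec_index_eq [c == e]eq_sym (negbTE ne) !andbF.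
rewrite LLE eqxx /= mulrC big1 ?addr0 // => u nu.
by rewrite LLE (negbTE nu) mulr0.
Qed.

Lemma vmul_RR (A : 'M[R]_(N, l)) c e a z :
  vmul (fun x => mxvec A 0 x) (RR R N c e) (mxvec_index a z) = (z == e)%:R * A a c.
Proof.
rewrite /vmul (bigD1 (mxvec_index a c)) //= mxvecE.
have RRE u : RR R N c e u (mxvec_index a z) = ((u == mxvec_index a c) && (z == e))%:R.
  rewrite /RR summxE (bigD1 a) //= big1 ?addr0 => [|b nb].
    by rewrite mxE mxvec_index_eq eqxx.
  by rewrite mxE [mxvec_index a z == _]mxvec_index_eq [a == b]eq_sym (negbTE nb) !andbF.
rewrite RRE eqxx /= mulrC big1 ?addr0 // => u nu.
by rewrite RRE (negbTE nu) mulr0.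
Qed.

Lemma evm_row A a b t : a != b -> evm (\matrix_(x, c) (A x c + (x == b)%:R * (t * A a c))) = evm A.
Proof.
move=> ne; have nil : LL R l a b *m LL R l a b = 0.
  by rewrite LLM eq_sym (negbTE ne) scale0r.
rewrite [RHS]/evm -(opG_nilpotent _ t nil (fLL ne)); apply/esym/evm_ext => x c.
by rewrite !mxE mxvecE vmul_LL; ring.
Qed.

Lemma evm_col A c e t : c != e -> g c = g e ->
  evm (\matrix_(a, z) (A a z + (z == e)%:R * (t * A a c))) = evm A.
Proof.
move=> ne ge; have nil : RR R N c e *m RR R N c e = 0.
  by rewrite RRM eq_sym (negbTE ne) scale0r.
rewrite [RHS]/evm -(opG_nilpotent _ t nil (fRR ne ge)); apply/esym/evm_ext => x z.
by rewrite !mxE mxvecE vmul_RR; ring.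
Qed.

(** A one-parameter torus of determinant 1. The monomials of f have all row degrees M and all column
    degrees N, so scaling two rows or two columns in this way does not change f. *)
Definition hscale (I : eqType) (i j : I) (s : R) (x : I) : R :=
  if x == i then s else if x == j then s^-1 else 1.

Lemma evm_rowscale A a b s : a != b -> s != 0 ->
  evm (\matrix_(x, c) (hscale a b s x * A x c)) = evm A.
Proof.
move=> ne s0; pose h (u : 'I_(N * l)) := hscale a b s (enum_val (cast_ord (esym (mxvec_cast N l)) u)).1.
have hE x c : h (mxvec_index x c) = hscale a b s x by rewrite /h /mxvec_index cast_ordK enum_rankK.
rewrite [RHS]/evm -(@meval_scale _ _ f h); first last.
  move=> m /[dup] /(diag_weight (LL_diag R a) (fL a)) ra /(diag_weight (LL_diag R b) (fL b)) rb.
  transitivity (\prod_x \prod_c h (mxvec_index x c) ^+ m (mxvec_index x c)).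
    rewrite pair_bigA /= (reindex (fun p : 'I_N * 'I_l => mxvec_index p.1 p.2)) //.
    exists (fun x => enum_val (cast_ord (esym (mxvec_cast N l)) x)) => [[x c] _|x _].
      by rewrite /mxvec_index cast_ordK enum_rankK.
    by rewrite /mxvec_index -surjective_pairing enum_valK cast_ordKV.
  have E x : \prod_c h (mxvec_index x c) ^+ m (mxvec_index x c) = hscale a b s x ^+ rowdeg m x.
    by rewrite /rowdeg -prodrXr; apply: eq_bigr => c _; rewrite hE.
  rewrite (eq_bigr _ (fun x _ => E x)) (bigD1 a) //= (bigD1 b) 1?eq_sym //= big1.
    rewrite mulr1 ra rb /hscale eqxx [b == a]eq_sym (negbTE ne) eqxx -exprMn mulfV //.
    by rewrite expr1n.
  by move=> x /andP[xa xb]; rewrite /hscale (negbTE xa) (negbTE xb) expr1n.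
by apply/esym/evm_ext => x c; rewrite !mxE mxvecE hE.
Qed.

(** c and e may lie in different blocks; this is why the column norms come out equal across all
    blocks. *)
Lemma evm_colscale A c e s : c != e -> s != 0 ->
  evm (\matrix_(a, z) (hscale c e s z * A a z)) = evm A.
Proof.
move=> ne s0; pose h (u : 'I_(N * l)) := hscale c e s (enum_val (cast_ord (esym (mxvec_cast N l)) u)).2.
have hE x z : h (mxvec_index x z) = hscale c e s z by rewrite /h /mxvec_index cast_ordK enum_rankK.
rewrite [RHS]/evm -(@meval_scale _ _ f h); first last.
  move=> m /[dup] /(diag_weight (@RR_diag R N l c) (fR c)) ra /(diag_weight (@RR_diag R N l e) (fR e)) rb.
  transitivity (\prod_z \prod_x h (mxvec_index x z) ^+ m (mxvec_index x z)).
    rewrite exchange_big pair_bigA /= (reindex (fun p : 'I_N * 'I_l => mxvec_index p.1 p.2)) //.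
    exists (fun x => enum_val (cast_ord (esym (mxvec_cast N l)) x)) => [[x z] _|x _].
      by rewrite /mxvec_index cast_ordK enum_rankK.
    by rewrite /mxvec_index -surjective_pairing enum_valK cast_ordKV.
  have E z : \prod_x h (mxvec_index x z) ^+ m (mxvec_index x z) = hscale c e s z ^+ coldeg m z.
    by rewrite /coldeg -prodrXr; apply: eq_bigr => x _; rewrite hE.
  rewrite (eq_bigr _ (fun z _ => E z)) (bigD1 c) //= (bigD1 e) 1?eq_sym //= big1.
    rewrite mulr1 ra rb /hscale eqxx [e == c]eq_sym (negbTE ne) eqxx -exprMn mulfV //.
    by rewrite expr1n.
  by move=> x /andP[xa xb]; rewrite /hscale (negbTE xa) (negbTE xb) expr1n.
by apply/esym/evm_ext => x z; rewrite !mxE mxvecE hE.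
Qed.

Lemma min_exists : exists A, evm A != 0 /\ forall A', evm A' = evm A -> nrm2 A <= nrm2 A'.
Proof.
have [A1 hA1] : exists A, evm A != 0.
  apply: NNPP => h; case/eqP: f0; apply: meval_eq0 => v; apply/eqP; apply: contraT => nz.
  case: h; exists (\matrix_(a, c) v (mxvec_index a c)).
  by rewrite -(@evm_ext _ v) // => a c; rewrite mxE.
(* The supremum of the negated norms stands for the infimum of the norms. *)
pose E : R -> Prop := fun y => exists A, evm A = evm A1 /\ y = - nrm2 A.
have nrm_ge0 A : 0 <= nrm2 A by apply: sumr_ge0 => a _; apply: sumr_ge0 => c _; apply: sqr_ge0.
have hsup : classical_sets.has_sup E.
  split; first by exists (- nrm2 A1); exists A1.
  by exists 0 => y [A [_ ->]]; rewrite oppr_le0.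
have seq (j : nat) : exists A, evm A = evm A1 /\ nrm2 A < - sup E + j.+1%:R^-1.
  have e0 : 0 < (j.+1%:R^-1 : R) by rewrite invr_gt0 ltr0n.
  have [y [A [hA ->]] lt] := sup_adherent e0 hsup; exists A; split=> //.
  by move: (sup E) (j.+1%:R^-1) lt => S z; lra.
pose u j := proj1_sig (constructive_indefinite_description _ (seq j)).
have hu j : evm (u j) = evm A1 /\ nrm2 (u j) < - sup E + j.+1%:R^-1.
  exact: (proj2_sig (constructive_indefinite_description _ (seq j))).
(* Entries of the minimizing sequence have square at most C - 1, and 2|u| <= u^2 + 1 <= C. *)
pose C := - sup E + 2.
have bnd j x : `|mxvec (u j) 0 x| <= C.
  case/mxvec_indexP: x => a c; rewrite mxvecE.
  have h1 : (u j) a c ^+ 2 <= nrm2 (u j).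
    rewrite /nrm2 (bigD1 a) //= (bigD1 c) //= -addrA lerDl addr_ge0 //.
      by apply: sumr_ge0 => z _; apply: sqr_ge0.
    by apply: sumr_ge0 => z _; apply: sumr_ge0 => y _; apply: sqr_ge0.
  have [_ h2] := hu j; have h3 : (j.+1%:R^-1 : R) <= 1 by rewrite invf_le1 ?ltr0n // ler1n.
  have h4 : `|u j a c| ^+ 2 <= C - 1.
    rewrite real_normK ?num_real // /C.
    by move: (sup E) (j.+1%:R^-1) h1 h2 h3 => S z; lra.
  by have := normr_ge0 (u j a c); have := sqr_ge0 (`|u j a c| - 1); nra.
have [phi [x [h1 h2]]] := bolzano bnd.
pose A : 'M[R]_(N, l) := \matrix_(a, c) x (mxvec_index a c).
have cA a c : cvgs (fun j => u (phi j) a c) (A a c).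
  by rewrite mxE; apply: cvgs_ext (h2 (mxvec_index a c)) => j; rewrite mxvecE.
have evA : evm A = evm A1.
  apply: (@cvgs_uniq _ (fun j => evm (u (phi j)))); last first.
    by apply: cvgs_ext (@cvgs_const _ _) => j; rewrite (hu (phi j)).1.
  rewrite -(@evm_ext A x) => [|a c]; last by rewrite mxE.
  exact: cvgs_meval.
exists A; rewrite evA; split=> // A' hA'.
have le1 : - sup E <= nrm2 A'.
  by rewrite lerNl; apply: (sup_upper_bound hsup); exists A'.
apply: le_trans le1; rewrite -subr_ge0.
apply: (@cvgs_ge _ (fun j => (- sup E + j.+1%:R^-1) + (-1) * nrm2 (u (phi j)))).
  move=> j; have [_ lt] := hu (phi j).
  have : ((phi j).+1%:R^-1 : R) <= j.+1%:R^-1.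
    by rewrite lef_pV2 ?posrE ?ltr0n // ler_nat ltnS.
  by move: (sup E) (j.+1%:R^-1) ((phi j).+1%:R^-1) lt => S z1 z2; lra.
have -> : - sup E - nrm2 A = (- sup E + 0) + (-1) * nrm2 A by ring.
apply: cvgsD; first by apply: cvgsD; [exact: cvgs_const|exact: cvgs_invS].
apply: cvgsM; first exact: cvgs_const.
by apply: cvgs_sum => a; apply: cvgs_sum => c; apply: cvgsX.
Qed.

Lemma quad_nonneg (p q : R) : 0 <= q -> (forall t, 0 <= 2 * t * p + t ^+ 2 * q) -> p = 0.
Proof.
move=> q0 h; have q1 : 0 < q + 1 by lra.
(* The minimizer would be t = -p/q; the denominator q + 1 avoids the case q = 0 and still gives a
   negative value unless p = 0. *)
have := h (- p / (q + 1)).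
have -> : 2 * (- p / (q + 1)) * p + (- p / (q + 1)) ^+ 2 * q =
  - (p ^+ 2 * (q + 2)) / (q + 1) ^+ 2.
  by field; rewrite gt_eqF.
rewrite pmulr_lge0 ?invr_gt0 ?exprn_gt0 // oppr_ge0 pmulr_lle0; last by lra.
by move=> le; apply/eqP; rewrite -sqrf_eq0 eq_le le sqr_ge0.
Qed.

Lemma scale_balance (p q : R) : 0 <= p -> 0 <= q ->
  (forall s, s != 0 -> 0 <= (s ^+ 2 - 1) * p + (s^-1 ^+ 2 - 1) * q) -> p <= q.
Proof.
move=> p0 q0 h; rewrite leNgt; apply/negP => lt.
have pp : 0 < p by lra.
(* Shrinking the heavier side slightly, s = 1 - eta, gives s^2 - 1 < 0 while s^2 p >= p - (p - q)/2
   > q. *)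
pose eta := (p - q) / (4 * p); have e0 : 0 < eta by rewrite divr_gt0 ?mulr_gt0 //; lra.
have e1 : eta * (4 * p) = p - q by rewrite mulfVK // mulf_neq0 ?pnatr_eq0 // gt_eqF.
have e2 : eta <= 1 / 4 by rewrite ler_pdivrMr ?mulr_gt0 //; lra.
pose s := 1 - eta; have s0 : 0 < s by rewrite /s; lra.
have := h s; rewrite gt_eqF // => /(_ isT).
have -> : (s ^+ 2 - 1) * p + (s^-1 ^+ 2 - 1) * q = ((s ^+ 2 - 1) * (s ^+ 2 * p - q)) / s ^+ 2.
  by field; rewrite gt_eqF.
rewrite pmulr_lge0 ?invr_gt0 ?exprn_gt0 // leNgt => /negP; apply.
rewrite nmulr_rlt0; rewrite /s; nra.
Qed.

Hypothesis N0 : (0 < N)%N.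
Hypothesis l0 : (0 < l)%N.

(** At a minimum, the unipotent moves give the orthogonality relations ([quad_nonneg]) and the torus
    moves the equality of norms ([scale_balance]). After division by the square root of the common
    column norm, the row norm follows by counting the total norm in two ways. *)
Lemma kempf_ness : exists A : 'M[R]_(N, l),
  A *m A^T = (l%:R / N%:R)%:M /\
  forall c e, g c = g e -> (A^T *m A) c e = (c == e)%:R.
Proof.
have [A [nz hmin]] := min_exists.
have sqs (I : finType) (F : I -> R) : 0 <= \sum_i F i ^+ 2.
  by apply: sumr_ge0 => i _; apply: sqr_ge0.
pose rho a := \sum_c A a c ^+ 2; pose kap c := \sum_a A a c ^+ 2.
have nrmR : nrm2 A = \sum_a rho a by [].
have nrmC : nrm2 A = \sum_c kap c by rewrite /nrm2 exchange_big.
have r1 a b : a != b -> \sum_c A a c * A b c = 0.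
  move=> ne; apply: (@quad_nonneg _ (rho a)) => [|t]; first exact: sqs.
  have := hmin _ (evm_row A t ne); rewrite -subr_ge0.
  have -> : nrm2 (\matrix_(x, c) (A x c + (x == b)%:R * (t * A a c))) - nrm2 A =
     2 * t * (\sum_c A a c * A b c) + t ^+ 2 * rho a; last by [].
  rewrite /nrm2 -sumrB (bigD1 b) //= [X in _ + X = _]big1 ?addr0 => [|x nx].
    rewrite -sumrB !mulr_sumr -big_split /=; apply: eq_bigr => c _.
    by rewrite mxE eqxx mul1r; ring.
  by rewrite -sumrB big1 // => c _; rewrite mxE (negbTE nx) mul0r addr0 subrr.
have r2 a b : rho a <= rho b.
  have [->//|ne] := eqVneq a b; apply: scale_balance; [exact: sqs|exact: sqs|] => s s0.
  have := hmin _ (evm_rowscale A ne s0); rewrite -subr_ge0.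
  have -> : nrm2 (\matrix_(x, c) (hscale a b s x * A x c)) - nrm2 A =
    (s ^+ 2 - 1) * rho a + (s^-1 ^+ 2 - 1) * rho b; last by [].
  rewrite /nrm2 -sumrB (bigD1 a) //= (bigD1 b) 1?eq_sym //= [X in _ + (_ + X) = _]big1 ?addr0 => [|x /andP[xa xb]].
    rewrite -!sumrB !mulr_sumr; congr (_ + _); apply: eq_bigr => c _; rewrite mxE /hscale eqxx.
      by ring.
    by rewrite [b == a]eq_sym (negbTE ne); ring.
  rewrite -sumrB big1 // => c _; rewrite mxE /hscale (negbTE xa) (negbTE xb) mul1r subrr //.
have c1 c e : c != e -> g c = g e -> \sum_a A a c * A a e = 0.
  move=> ne ge; apply: (@quad_nonneg _ (kap c)) => [|t]; first exact: sqs.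
  have := hmin _ (evm_col A t ne ge); rewrite -subr_ge0.
  have -> : nrm2 (\matrix_(a, z) (A a z + (z == e)%:R * (t * A a c))) - nrm2 A =
     2 * t * (\sum_a A a c * A a e) + t ^+ 2 * kap c; last by [].
  rewrite /nrm2 -sumrB !mulr_sumr -big_split /=; apply: eq_bigr => a _.
  rewrite -sumrB (bigD1 e) //= big1 ?addr0 => [|z nz']; first by rewrite mxE eqxx mul1r; ring.
  by rewrite mxE (negbTE nz') mul0r addr0 subrr.
have c2 c e : kap c <= kap e.
  have [->//|ne] := eqVneq c e; apply: scale_balance; [exact: sqs|exact: sqs|] => s s0.
  have := hmin _ (evm_colscale A ne s0); rewrite -subr_ge0.
  have -> : nrm2 (\matrix_(a, z) (hscale c e s z * A a z)) - nrm2 A =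
    (s ^+ 2 - 1) * kap c + (s^-1 ^+ 2 - 1) * kap e; last by [].
  rewrite /nrm2 -sumrB !mulr_sumr -big_split /=; apply: eq_bigr => a _.
  rewrite -sumrB (bigD1 c) //= (bigD1 e) 1?eq_sym //= big1 ?addr0 => [|z /andP[xa xb]].
    by rewrite !mxE /hscale !eqxx [e == c]eq_sym (negbTE ne); ring.
  by rewrite mxE /hscale (negbTE xa) (negbTE xb) mul1r subrr.
pose a0 := Ordinal N0; pose c0 := Ordinal l0; pose k := kap c0.
have kE c : kap c = k by apply/eqP; rewrite eq_le !c2.
have rE a : rho a = rho a0 by apply/eqP; rewrite eq_le !r2.
have tot : N%:R * rho a0 = l%:R * k.
  have := nrmC; rewrite nrmR (eq_bigr _ (fun a _ => rE a)) (eq_bigr _ (fun c _ => kE c)).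
  by rewrite !sumr_const !card_ord -[LHS]mulr_natl -[RHS]mulr_natl.
(* Every monomial of f has degree N > 0 in the first column, so a zero column would give f(A) =
   0. *)
have k0 : 0 < k.
  rewrite lt_def sqs andbT; apply: contra nz => /eqP kz; rewrite /evm mevalE big1_seq //.
  move=> m /andP[_]; rewrite mcoeff_msupp => /(diag_weight (@RR_diag R N l c0) (fR c0)) dm.
  have [a ma] : exists a, m (mxvec_index a c0) != 0%N.
    have [/existsP//|] := boolP [exists a, m (mxvec_index a c0) != 0%N].
    rewrite negb_exists => /forallP z; have : coldeg m c0 = 0%N.
      by rewrite /coldeg big1 // => a _; have := z a; rewrite negbK => /eqP.
    by rewrite dm => e0; have : (0 < 0)%N by rewrite -{2}e0.
  rewrite (bigD1 (mxvec_index a c0)) //= mxvecE.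
  have -> : A a c0 = 0.
    apply/eqP; rewrite -sqrf_eq0; apply/eqP.
    have /(_ _ a isT) := psumr_eq0P _ kz; apply=> // i _; exact: sqr_ge0.
  by rewrite expr0n (negbTE ma) mul0r mulr0.
have sk : Num.sqrt k ^+ 2 = k by rewrite sqr_sqrtr ?ltW.
have skn : Num.sqrt k != 0 by rewrite sqrtr_eq0 -ltNge.
exists ((Num.sqrt k)^-1 *: A); split.
  apply/matrixP => a b; rewrite linearZ /= -scalemxAl -scalemxAr scalerA -expr2 exprVn sk.
  rewrite !mxE; under eq_bigr => c _ do rewrite mxE.
  have [<-|ne] := eqVneq a b; last by rewrite r1 // mulr0.
  have -> : \sum_c A a c * A a c = rho a0 by rewrite -(rE a); apply: eq_bigr => c _; rewrite expr2.
  rewrite mulr1n; apply: (@mulfI _ N%:R); first by rewrite pnatr_eq0 -lt0n.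
  transitivity (l%:R : R); first by rewrite mulrCA tot mulrC mulfK // gt_eqF.
  by rewrite mulrCA mulfV ?mulr1 // pnatr_eq0 -lt0n.
move=> c e ge; rewrite [(_ *: A)^T]linearZ /= -scalemxAl -scalemxAr scalerA -expr2 exprVn sk.
rewrite !mxE; under eq_bigr => a _ do rewrite mxE.
have [<-|ne] := eqVneq c e; last by rewrite c1 // mulr0.
have -> : \sum_a A a c * A a c = k by rewrite -(kE c); apply: eq_bigr => a _; rewrite expr2.
by rewrite mulVf // gt_eqF.
Qed.

End KempfNess.

(** * Generic rank of tau and quotients *)

Section PolyMatrices.
Variable R : realFieldType.

Definition evx (t : R) m n (L : 'M[{poly R}]_(m, n)) : 'M[R]_(m, n) := map_mx (horner_eval t) L.
Definition cf1 m n (L : 'M[{poly R}]_(m, n)) : 'M[R]_(m, n) := map_mx (fun p : {poly R} => p`_1) L.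
Definition cst m n (L : 'M[R]_(m, n)) : 'M[{poly R}]_(m, n) := map_mx (@polyC R) L.

Lemma evxM t m n p (A : 'M_(m, n)) (B : 'M_(n, p)) : evx t (A *m B) = evx t A *m evx t B.
Proof. exact: map_mxM. Qed.

Lemma evxD t m n (A B : 'M_(m, n)) : evx t (A + B) = evx t A + evx t B.
Proof. exact: map_mxD. Qed.

Lemma evx_cst t m n (A : 'M_(m, n)) : evx t (cst A) = A.
Proof. by apply/matrixP => i j; rewrite !mxE /horner_eval hornerC. Qed.

Lemma cf1M m n p (A : 'M_(m, n)) (B : 'M_(n, p)) :
  cf1 (A *m B) = evx 0 A *m cf1 B + cf1 A *m evx 0 B.
Proof.
apply/matrixP => i j; rewrite !mxE coef_sum -big_split /=; apply: eq_bigr => k _.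
by rewrite !mxE /horner_eval !horner_coef0 coefM !big_ord_recl big_ord0 addr0.
Qed.

Lemma poly_all0 (p : {poly R}) : (forall t, p.[t] = 0) -> p = 0.
Proof.
move=> h; apply: (@roots_geq_poly_eq0 R _ (mkseq (fun k => k%:R) (size p))).
- by apply/allP => x _; rewrite rootE h.
- by rewrite map_inj_uniq ?iota_uniq // => a b /eqP; rewrite eqr_nat => /eqP.
- by rewrite size_mkseq.
Qed.

(** P holds for all but finitely many parameters: the exceptions are roots of one nonzero
    polynomial. *)
Definition cof (P : R -> Prop) := exists2 d : {poly R}, d != 0 & forall t, d.[t] != 0 -> P t.

Lemma cof_and P Q : cof P -> cof Q -> cof (fun t => P t /\ Q t).
Proof.
move=> [d d0 hd] [e e0 he]; exists (d * e) => [|t]; first exact: mulf_neq0.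
by rewrite hornerM mulf_eq0 negb_or => /andP[/hd p /he q].
Qed.

Lemma cof_imp (P Q : R -> Prop) : (forall t, P t -> Q t) -> cof P -> cof Q.
Proof. by move=> h [d d0 hd]; exists d => // t /hd /h. Qed.

Lemma cof_true (P : R -> Prop) : (forall t, P t) -> cof P.
Proof. by move=> h; exists 1 => //; apply: oner_neq0. Qed.

Lemma evx_eq0 m n (L : 'M_(m, n)) : cof (fun t => evx t L = 0) -> L = 0.
Proof.
move=> [d d0 h]; apply/matrixP => i j; rewrite mxE; apply: (mulfI d0); rewrite mulr0.
apply: poly_all0 => t; rewrite hornerM; have [->|nz] := eqVneq d.[t] 0; first by rewrite mul0r.
by have /matrixP/(_ i j) := h t nz; rewrite !mxE /horner_eval => ->; rewrite mulr0.
Qed.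

Lemma rank_bases m n (A : 'M[R]_(m, n)) :
  exists (P : 'M_(\rank A, m)) (Q : 'M_(n, \rank A)), P *m A *m Q = 1%:M.
Proof.
have /row_fullP[P hP] := col_base_full A; have /row_freeP[Q hQ] := row_base_free A.
exists P, Q; have e : P *m (col_base A *m row_base A) = row_base A by rewrite mulmxA hP mul1mx.
by rewrite mulmx_base in e; rewrite e hQ.
Qed.

(** Semicontinuity of rank: a generalized minor that is nonzero at t0 is a nonzero polynomial in
    t. *)
Lemma cof_rank m n (L : 'M_(m, n)) t0 : cof (fun t => (\rank (evx t0 L) <= \rank (evx t L))%N).
Proof.
have [P [Q hPQ]] := rank_bases (evx t0 L).
have detE t : (\det (cst P *m L *m cst Q)).[t] = \det (P *m evx t L *m Q).
  by rewrite -[LHS]/(horner_eval t _) -det_map_mx -/(evx t _) !evxM !evx_cst.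
exists (\det (cst P *m L *m cst Q)).
  by apply: contra_neq (oner_neq0 R) => e; rewrite -[RHS](horner0 t0) -e detE hPQ det1.
move=> t; rewrite detE => nz; have : (P *m evx t L *m Q) \in unitmx by rewrite unitmxE unitfE.
rewrite -row_free_unit /row_free => /eqP e; rewrite -{1}e.
by apply: leq_trans (mxrankM_maxl _ _) (mxrankM_maxr _ _).
Qed.

(** With G a generalized inverse of L(0), W = 1 + (L - L(0)) G satisfies L G L(0) = W L(0). As the
    rank does not rise, W^-1 L has the form L(0) D, so u0 W^-1 annihilates L. The adjugate clears
    the denominator and equals 1 at 0. *)
Lemma kernel_curve m n (L : 'M_(m, n)) (u0 : 'rV[R]_m) :
  cof (fun t => (\rank (evx t L) <= \rank (evx 0 L))%N) -> u0 *m evx 0 L = 0 ->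
  exists2 u : 'rV[{poly R}]_m, u *m L = 0 & evx 0 u = u0.
Proof.
move=> hr hu; pose L0 := evx 0 L; pose G := pinvmx L0.
have LGL : L0 *m G *m L0 = L0 by apply: mulmxKpV.
pose W := 1%:M + (L - cst L0) *m cst G.
have WE t : evx t W = 1%:M + (evx t L - L0) *m G.
  rewrite evxD evxM evx_cst; congr (_ + _); last congr (_ *m _).
    by apply/matrixP => i j; rewrite !mxE /horner_eval; case: eqP => _; rewrite ?hornerC // horner0.
  by apply/matrixP => i j; rewrite !mxE /horner_eval hornerD hornerN hornerC.
have W0 : evx 0 W = 1%:M by rewrite WE subrr mul0mx addr0.
have detE t : (\det W).[t] = \det (evx t W) by rewrite -[LHS]/(horner_eval t _) -det_map_mx.
have adjE t : evx t (\adj W) = \adj (evx t W) by exact: map_mx_adj.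
have dW : cof (fun t => \det (evx t W) != 0).
  exists (\det W) => [|t]; last by rewrite detE.
  by apply: contra_neq (oner_neq0 R) => e; rewrite -[RHS](horner0 0) -e detE W0 det1.
exists (cst u0 *m \adj W); last by rewrite evxM adjE W0 evx_cst adj1 mulmx1.
apply: evx_eq0; apply: cof_imp (cof_and hr dW) => t [le nz].
rewrite !evxM adjE evx_cst; set Wt := evx t W; set Lt := evx t L.
have Wu : Wt \in unitmx by rewrite unitmxE unitfE.
have key : Lt *m (G *m L0) = Wt *m L0.
  by rewrite /Wt WE mulmxDl mul1mx !mulmxBl LGL -/Lt addrC subrK mulmxA.
pose Y := invmx Wt *m Lt; have YE : Y *m (G *m L0) = L0 by rewrite -mulmxA key mulKmx.
have sub : (Y^T <= L0^T)%MS.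
  have s1 : (L0^T <= Y^T)%MS by rewrite -YE trmx_mul submxMl.
  have := mxrank_leqif_sup s1; rewrite !mxrank_tr => -[le2 e]; rewrite -e eqn_leq le2 /=.
  exact: leq_trans (mxrankM_maxr _ _) le.
have [D hD] := submxP sub.
have YD : Y = L0 *m D^T by rewrite -[Y]trmxK hD trmx_mul trmxK.
have -> : \adj Wt = \det Wt *: invmx Wt.
  by rewrite /invmx Wu scalerA mulfV // scale1r.
by rewrite -scalemxAr -scalemxAl -mulmxA -/Y YD mulmxA hu mul0mx scaler0.
Qed.

(** Differentiate u L = 0 at 0 along a kernel curve through u0. *)
Lemma tangent_rowspace m n (L : 'M_(m, n)) (u0 : 'rV[R]_m) :
  cof (fun t => (\rank (evx t L) <= \rank (evx 0 L))%N) -> u0 *m evx 0 L = 0 ->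
  (u0 *m cf1 L <= evx 0 L)%MS.
Proof.
move=> hr hu; have [u uL u0E] := kernel_curve hr hu.
have /eqP := cf1M u L; rewrite uL u0E eq_sym.
have -> : cf1 (0 : 'M[{poly R}]_(1, n)) = 0 by apply/matrixP => i j; rewrite !mxE coef0.
by rewrite addr_eq0 => /eqP ->; rewrite -mulNmx submxMl.
Qed.

Lemma cof_ex (P : R -> Prop) : cof P -> exists t, P t.
Proof.
move=> [d d0 h]; apply: NNPP => hn; case/eqP: d0; apply: poly_all0 => t.
by apply/eqP; apply: contraT => /h Pt; case: hn; exists t.
Qed.

End PolyMatrices.

Lemma ex_max (T : Type) (P : T -> Prop) (f : T -> nat) b : (exists x, P x) ->
  (forall x, P x -> (f x <= b)%N) -> exists x, P x /\ forall y, P y -> (f y <= f x)%N.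
Proof.
move=> [x Px] hb; have [k] := ubnP (b - f x)%N; elim: k x Px => // k IH x Px hk.
have [[y [Py lt]]|h] := classic (exists y, P y /\ (f x < f y)%N).
  by apply: (IH y Py); have := hb y Py; lia.
exists x; split=> // y Py; rewrite leqNgt; apply/negP => lt; apply: h; exists y; by split.
Qed.

Definition dec m n (p : 'I_(m * n)) : 'I_m * 'I_n :=
  enum_val (cast_ord (esym (mxvec_cast m n)) p).

Lemma decK m n (i : 'I_m) (j : 'I_n) : dec (mxvec_index i j) = (i, j).
Proof. by rewrite /dec /mxvec_index cast_ordK enum_rankK. Qed.

Lemma sum_mxvec (V : nmodType) m n (F : 'I_(m * n) -> V) :
  \sum_p F p = \sum_i \sum_j F (mxvec_index i j).
Proof.
rewrite pair_bigA /= (reindex (fun p : 'I_m * 'I_n => mxvec_index p.1 p.2)) //.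
exists (@dec m n) => [[i j] _|p _]; first exact: decK.
by rewrite /mxvec_index -surjective_pairing /dec enum_valK cast_ordKV.
Qed.

(** * The linear map tau and its generic kernel *)

Section Tau.
Variables (K N M : nat).

Section OverRing.
Variable S : comNzRingType.

Definition bigX l (g : 'I_l -> 'I_K) (z : 'M[S]_(l, N)) : 'M[S]_(l, K * N) :=
  \matrix_(c, u) (((dec u).1 == g c)%:R * z c (dec u).2).

(* The matrix of z |-> A X(z) B on row-major vectorizations; B stacks K blocks of
   size N x M, and row c of z meets the block number g c. *)
Definition tau l (g : 'I_l -> 'I_K) n (A : 'M[S]_(n, l)) (B : 'M[S]_(K * N, M)) :
    'M[S]_(l * N, n * M) :=
  \matrix_(p, q) (A (dec q).1 (dec p).1 * B (mxvec_index (g (dec p).1) (dec p).2) (dec q).2).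

Lemma bigXE l (g : 'I_l -> 'I_K) z c k j : bigX g z c (mxvec_index k j) = (k == g c)%:R * z c j.
Proof. by rewrite mxE decK. Qed.

Lemma bigXD l (g : 'I_l -> 'I_K) y z : bigX g (y + z) = bigX g y + bigX g z.
Proof. by apply/matrixP => c u; rewrite !mxE mulrDr. Qed.

Lemma bigXZ l (g : 'I_l -> 'I_K) a z : bigX g (a *: z) = a *: bigX g z.
Proof. by apply/matrixP => c u; rewrite !mxE mulrCA. Qed.

Lemma bigXN l (g : 'I_l -> 'I_K) z : bigX g (- z) = - bigX g z.
Proof. by rewrite -scaleN1r bigXZ scaleN1r. Qed.

Lemma tauE l (g : 'I_l -> 'I_K) n (A : 'M[S]_(n, l)) B z :
  mxvec z *m tau g A B = mxvec (A *m bigX g z *m B).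
Proof.
apply/rowP => q; case/mxvec_indexP: q => i m; rewrite mxvecE !mxE !sum_mxvec.
transitivity (\sum_c \sum_j A i c * z c j * B (mxvec_index (g c) j) m).
  by apply: eq_bigr => c _; apply: eq_bigr => j _; rewrite mxvecE mxE !decK /=; ring.
rewrite exchange_big [RHS]exchange_big /=; apply: eq_bigr => j _.
under [RHS]eq_bigr => k _ do rewrite mxE mulr_suml.
rewrite exchange_big /=; apply: eq_bigr => c _; rewrite (bigD1 (g c)) //= bigXE eqxx mul1r.
by rewrite big1 ?addr0 // => k nk; rewrite bigXE (negbTE nk) mul0r mulr0 mul0r.
Qed.

(** Block diagonal with respect to the two colourings; such matrices pass through X(z) by
    [bigX_graded]. *)
Definition graded l' l (g' : 'I_l' -> 'I_K) (g : 'I_l -> 'I_K) (h : 'M[S]_(l', l)) :=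
  forall c' c, g' c' != g c -> h c' c = 0.

Lemma bigX_graded l' l (g' : 'I_l' -> 'I_K) (g : 'I_l -> 'I_K) h z :
  graded g' g h -> bigX g' (h *m z) = h *m bigX g z.
Proof.
move=> gh; apply/matrixP => c' u; case/mxvec_indexP: u => k j; rewrite bigXE !mxE mulr_sumr.
apply: eq_bigr => c _; rewrite bigXE; have [e|ne] := eqVneq (g' c') (g c).
  by rewrite e; ring.
by rewrite (gh _ _ ne) !mul0r mulr0.
Qed.

Lemma bigX_inj l (g : 'I_l -> 'I_K) y z : bigX g y = bigX g z -> y = z.
Proof.
move=> /matrixP h; apply/matrixP => c j; have := h c (mxvec_index (g c) j).
by rewrite !bigXE eqxx !mul1r.
Qed.

End OverRing.

Variable R : realFieldType.

Lemma evx_bigX t l (g : 'I_l -> 'I_K) (z : 'M[{poly R}]_(l, N)) : evx t (bigX g z) = bigX g (evx t z).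
Proof.
apply/matrixP => c u; rewrite !mxE /horner_eval hornerM.
by case: (_ == _); rewrite ?hornerC ?horner0 // -[1%:R]/(1 : {poly R}) hornerC.
Qed.

Lemma cf1_bigX l (g : 'I_l -> 'I_K) (z : 'M[{poly R}]_(l, N)) : cf1 (bigX g z) = bigX g (cf1 z).
Proof.
apply/matrixP => c u; rewrite !mxE.
by case: (_ == _); rewrite ?mul1r // !mul0r coef0.
Qed.

Lemma evx_tau t l (g : 'I_l -> 'I_K) n (A : 'M[{poly R}]_(n, l)) B :
  evx t (tau g A B) = tau g (evx t A) (evx t B).
Proof. by apply/matrixP => p q; rewrite !mxE /horner_eval hornerM. Qed.

Lemma rank_sum_le (I : finType) m n (F : I -> 'M[R]_(m, n)) :
  (\rank (\sum_i F i)%R <= \sum_i \rank (F i))%N.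
Proof.
elim/big_ind2: _ => [|x a y b hx hy|i _ //]; first by rewrite mxrank0.
by apply: leq_trans (mxrank_add _ _) (leq_add hx hy).
Qed.

Lemma rank_lin_mulmxr m p q (H : 'M[R]_(p, q)) : \rank (lin_mulmxr H : 'M_(m * p, m * q)) = (m * \rank H)%N.
Proof.
have comp p1 p2 p3 (C : 'M[R]_(p1, p2)) (D : 'M[R]_(p2, p3)) :
    lin_mulmxr (C *m D) = lin_mulmxr C *m lin_mulmxr D :> 'M[R]_(m * p1, m * p3).
  apply/row_matrixP => i; rewrite !rowE -[delta_mx 0 i]vec_mxK mulmxA !mul_vec_lin /= mulmxA //.
apply/eqP; rewrite eqn_leq; apply/andP; split.
  by rewrite -{1}(mulmx_base H) comp; apply: mulmx_max_rank.
have [P [Q hPQ]] := rank_bases H.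
have e : lin_mulmxr P *m lin_mulmxr H *m lin_mulmxr Q = 1%:M :> 'M[R]_(m * \rank H, _).
  rewrite -!comp hPQ; apply/row_matrixP => i; rewrite !rowE -[delta_mx 0 i]vec_mxK mul_vec_lin /=.
  by rewrite !mulmx1.
rewrite -{1}(mxrank1 R (m * \rank H)) -e.
by apply: leq_trans (mxrankM_maxl _ _) (mxrankM_maxr _ _).
Qed.

Lemma rank_lin_mulmx m p q (H : 'M[R]_(p, q)) : (\rank H * m <= \rank (lin_mulmx H : 'M_(q * m, p * m)))%N.
Proof.
have comp p1 p2 p3 (C : 'M[R]_(p1, p2)) (D : 'M[R]_(p2, p3)) :
    lin_mulmx (C *m D) = lin_mulmx D *m lin_mulmx C :> 'M[R]_(p3 * m, p1 * m).
  apply/row_matrixP => i; rewrite !rowE -[delta_mx 0 i]vec_mxK mulmxA !mul_vec_lin /= mulmxA //.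
have [P [Q hPQ]] := rank_bases H.
have e : lin_mulmx Q *m lin_mulmx H *m lin_mulmx P = 1%:M :> 'M[R]_(\rank H * m, _).
  rewrite -!comp mulmxA hPQ; apply/row_matrixP => i; rewrite !rowE -[delta_mx 0 i]vec_mxK mul_vec_lin /=.
  by rewrite mul1mx mulmx1.
rewrite -{1}(mxrank1 R (\rank H * m)) -e.
by apply: leq_trans (mxrankM_maxl _ _) (mxrankM_maxr _ _).
Qed.

Definition rowmap l N' (H : 'I_l -> 'M[R]_(N, N')) : 'M[R]_(l * N, l * N') :=
  \matrix_(p, q) (((dec p).1 == (dec q).1)%:R * H (dec p).1 (dec p).2 (dec q).2).

Lemma rowmapE l N' (H : 'I_l -> 'M[R]_(N, N')) z :
  mxvec z *m rowmap H = mxvec (\matrix_(c, j) (row c z *m H c) 0 j).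
Proof.
apply/rowP => q; case/mxvec_indexP: q => c j; rewrite mxvecE !mxE sum_mxvec.
rewrite (bigD1 c) //= [X in _ + X]big1 ?addr0 => [|c' nc]; last first.
  by rewrite big1 // => i _; rewrite mxE !decK (negbTE nc) mul0r mulr0.
by apply: eq_bigr => i _; rewrite mxvecE !mxE !decK eqxx mul1r.
Qed.

Lemma rank_rowmap l N' (H : 'I_l -> 'M[R]_(N, N')) : (\rank (rowmap H) <= \sum_c \rank (H c))%N.
Proof.
pose P c : 'M[R]_(l * N, N) := \matrix_(p, j) ((dec p == (c, j))%:R).
pose Q c : 'M[R]_(N', l * N') := \matrix_(j, q) ((dec q == (c, j))%:R).
have -> : rowmap H = \sum_c P c *m H c *m Q c.
  apply/matrixP => p q; rewrite summxE mxE; case ep: (dec p) => [c i].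
  case eqq: (dec q) => [c' j] /=.
  have E c0 : (P c0 *m H c0 *m Q c0) p q = (c == c0)%:R * (c' == c0)%:R * H c0 i j.
    rewrite mxE (bigD1 j) //= [X in _ + X]big1 ?addr0 => [|j' nj]; last first.
      by rewrite [Q _ _ _]mxE eqq xpair_eqE [j == j']eq_sym (negbTE nj) andbF mulr0.
    rewrite mxE (bigD1 i) //= [X in _ + X]big1 ?addr0 => [|i' ni]; last first.
      by rewrite mxE ep xpair_eqE [i == i']eq_sym (negbTE ni) andbF mul0r.
    by rewrite !mxE ep eqq !xpair_eqE !eqxx !andbT; ring.
  rewrite (eq_bigr _ (fun c0 _ => E c0)) (bigD1 c) //= big1 ?addr0 => [|c0 nc].
    by rewrite eqxx mul1r [c' == c]eq_sym.
  by rewrite [c == c0]eq_sym (negbTE nc) !mul0r.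
apply: leq_trans (rank_sum_le _) _; apply: leq_sum => c _.
by apply: leq_trans (mxrankM_maxl _ _) (mxrankM_maxr _ _).
Qed.

Section Good.
Variables (l n : nat) (g : 'I_l -> 'I_K).
Implicit Types (A : 'M[R]_(n, l)) (B : 'M[R]_(K * N, M)) (x : 'M[R]_(l, N)).
Local Notation X := (bigX g).

Definition tau_max A B := forall A' B', (\rank (tau g A' B') <= \rank (tau g A B))%N.

(* The ranks of X(x) and of A X(x) are jointly maximal among kernel elements of
   maximal-rank tau, hence locally constant along curves of such kernel elements. *)
Definition good A B x :=
  [/\ tau_max A B, A *m X x *m B = 0 &
   forall A' B' x', tau_max A' B' -> A' *m X x' *m B' = 0 ->
     (\rank (X x') + \rank (A' *m X x') <= \rank (X x) + \rank (A *m X x))%N].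

Lemma tau_max_exists : exists A B, tau_max A B.
Proof.
have [[A B] [_ h]] := @ex_max ('M[R]_(n, l) * 'M[R]_(K * N, M)) (fun=> True)
  (fun AB => \rank (tau g AB.1 AB.2)) (l * N) (ex_intro _ (0, 0) I) (fun _ _ => rank_leq_row _).
by exists A, B => A' B'; apply: (h (A', B')).
Qed.

Lemma good_exists : exists A B x, good A B x.
Proof.
have [A0 [B0 h0]] := tau_max_exists.
pose P (t : 'M[R]_(n, l) * 'M[R]_(K * N, M) * 'M[R]_(l, N)) :=
  tau_max t.1.1 t.1.2 /\ t.1.1 *m X t.2 *m t.1.2 = 0.
have ex : exists t, P t.
  exists (A0, B0, 0); split=> //=; have -> : X 0 = 0 :> 'M[R]_(l, K * N).
    by apply/matrixP => c u; rewrite !mxE mulr0.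
  by rewrite mulmx0 mul0mx.
have [[[A B] x] [[h1 h2] h3]] := @ex_max _ P
  (fun t => \rank (X t.2) + \rank (t.1.1 *m X t.2))%N (l + n)%N ex
  (fun t _ => leq_add (rank_leq_row _) (rank_leq_row _)).
by exists A, B, x; split=> // A' B' x' t1 t2; apply: (h3 (A', B', x')).
Qed.

(** The kernel element x extends along the curve. Neither rank drops at generic t, and their sum
    cannot rise, so each stays. *)
Lemma good_curve A B x (At : 'M[{poly R}]_(n, l)) Bt : good A B x ->
  evx 0 At = A -> evx 0 Bt = B ->
  exists xt : 'M[{poly R}]_(l, N),
    [/\ At *m X xt *m Bt = 0, evx 0 xt = x &
      cof (fun t => [/\ good (evx t At) (evx t Bt) (evx t xt),
        \rank (X (evx t xt)) = \rank (X x) &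
        \rank (evx t At *m X (evx t xt)) = \rank (A *m X x)])].
Proof.
move=> [h1 h2 h3] eA eB.
have hr : cof (fun t => (\rank (evx t (tau g At Bt)) <= \rank (evx 0 (tau g At Bt)))%N).
  by apply: cof_true => t; rewrite !evx_tau eA eB.
have hk : mxvec x *m evx 0 (tau g At Bt) = 0 by rewrite evx_tau eA eB tauE h2 linear0.
have [u uL u0] := kernel_curve hr hk.
pose xt := vec_mx u.
have xt0 : evx 0 xt = x.
  apply/matrixP => c j; rewrite !mxE; have /rowP/(_ (mxvec_index c j)) := u0.
  by rewrite mxvecE !mxE.
have eq0 : At *m X xt *m Bt = 0.
  by apply: (can_inj mxvecK); rewrite -tauE vec_mxK uL linear0.
exists xt; split=> //.
have tmax t : (\rank (tau g A B) <= \rank (tau g (evx t At) (evx t Bt)))%N ->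
    tau_max (evx t At) (evx t Bt).
  by move=> le A' B'; apply: leq_trans (h1 A' B') le.
have c1 := cof_rank (tau g At Bt) 0; have c2 := cof_rank (X xt) 0.
have c3 := cof_rank (At *m X xt) 0.
apply: cof_imp (cof_and c1 (cof_and c2 c3)) => t [].
rewrite !evx_tau !evxM !evx_bigX eA eB xt0 => r1 [r2 r3].
have ke : evx t At *m X (evx t xt) *m evx t Bt = 0.
  rewrite -evx_bigX -!evxM eq0; apply/matrixP => i j; by rewrite !mxE /horner_eval horner0.
have le := h3 _ _ _ (tmax _ r1) ke.
have e2 : \rank (X (evx t xt)) = \rank (X x) by lia.
have e3 : \rank (evx t At *m X (evx t xt)) = \rank (A *m X x) by lia.
split=> //; split=> [||A' B' x' t1 t2]; [exact: tmax|exact: ke|].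
by rewrite e2 e3; apply: h3.
Qed.

(** First-order conditions for the ranks of X(x) and A X(x) to stay constant when x moves along y
    and A along D. *)
Definition tangent A x (y : 'M[R]_(l, N)) (D : 'M[R]_(n, l)) :=
  (forall v : 'rV[R]_l, v *m X x = 0 -> (v *m X y <= X x)%MS) /\
  (forall w : 'rV[R]_n, w *m (A *m X x) = 0 -> (w *m (D *m X x + A *m X y) <= A *m X x)%MS).

Definition lin_curve m p (A D : 'M[R]_(m, p)) : 'M[{poly R}]_(m, p) := cst A + 'X *: cst D.

Lemma evx_lin t m p (A D : 'M[R]_(m, p)) : evx t (lin_curve A D) = A + t *: D.
Proof. by apply/matrixP => i j; rewrite !mxE /horner_eval !hornerE mulrC. Qed.

Lemma cf1_lin m p (A D : 'M[R]_(m, p)) : cf1 (lin_curve A D) = D.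
Proof. by apply/matrixP => i j; rewrite !mxE coefD coefC coefXM coefC /= add0r. Qed.

(** Every direction (D, C) of the pair (A, B) lifts to a direction y of the kernel element: the
    derivative at 0 of the curve from [good_curve]. *)
Lemma good_tangent A B x D C : good A B x ->
  exists2 y, D *m X x *m B + A *m X x *m C + A *m X y *m B = 0 & tangent A x y D.
Proof.
move=> hg; have e0 m p (E F : 'M[R]_(m, p)) : evx 0 (lin_curve E F) = E.
  by rewrite evx_lin scale0r addr0.
have [xt [k0 x0 hc]] := good_curve hg (e0 _ _ A D) (e0 _ _ B C).
exists (cf1 xt).
  have := congr1 (@cf1 R _ _) k0; rewrite !cf1M evxM !e0 evx_bigX x0 !cf1_lin cf1_bigX.
  have -> : cf1 (0 : 'M[{poly R}]_(n, M)) = 0 by apply/matrixP => i j; rewrite !mxE coef0.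
  by move=> <-; rewrite mulmxDl [RHS]addrA [RHS]addrC addrA.
split=> [v hv|w hw].
  have hr : cof (fun t => (\rank (evx t (X xt)) <= \rank (evx 0 (X xt)))%N).
    by apply: cof_imp hc => t [_ e _]; rewrite !evx_bigX x0 e.
  have := tangent_rowspace hr; rewrite evx_bigX x0 cf1_bigX; exact.
have hr : cof (fun t => (\rank (evx t (lin_curve A D *m X xt)) <= \rank (evx 0 (lin_curve A D *m X xt)))%N).
  by apply: cof_imp hc => t [_ _ e]; rewrite !evxM !evx_bigX x0 e e0.
have := tangent_rowspace hr; rewrite !evxM !evx_bigX x0 e0 cf1M e0 cf1_lin cf1_bigX evx_bigX x0.
by move=> h; have := h w hw; rewrite addrC.
Qed.

(** Here x moves along a line inside the kernel of a fixed tau, where maximality keeps both ranks at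
    generic points. *)
Lemma good_tangent_ker A B x y : good A B x -> A *m X y *m B = 0 -> tangent A x y 0.
Proof.
move=> [h1 h2 h3] hy; have e0 m p (E F : 'M[R]_(m, p)) : evx 0 (lin_curve E F) = E.
  by rewrite evx_lin scale0r addr0.
pose xt := lin_curve x y.
have ker t : A *m X (evx t xt) *m B = 0.
  by rewrite evx_lin bigXD bigXZ mulmxDr -scalemxAr mulmxDl -scalemxAl h2 hy scaler0 addr0.
have c2 := cof_rank (X xt) 0; have c3 := cof_rank (cst A *m X xt) 0.
have hc : cof (fun t => \rank (X (evx t xt)) = \rank (X x) /\ \rank (A *m X (evx t xt)) = \rank (A *m X x)).
  apply: cof_imp (cof_and c2 c3) => t; rewrite !evxM !evx_bigX !evx_cst e0 => -[r2 r3].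
  by have := h3 A B _ h1 (ker t); lia.
split=> [v hv|w hw].
  have hr : cof (fun t => (\rank (evx t (X xt)) <= \rank (evx 0 (X xt)))%N).
    by apply: cof_imp hc => t [e _]; rewrite !evx_bigX e0 e.
  have := tangent_rowspace hr; rewrite evx_bigX e0 cf1_bigX cf1_lin; exact.
have hr : cof (fun t => (\rank (evx t (cst A *m X xt)) <= \rank (evx 0 (cst A *m X xt)))%N).
  by apply: cof_imp hc => t [_ e]; rewrite !evxM !evx_bigX !evx_cst e0 e.
have c0 : cf1 (cst A) = 0 by apply/matrixP => i j; rewrite !mxE coefC.
have := tangent_rowspace hr; rewrite evxM cf1M c0 mul0mx addr0 evx_cst evx_bigX e0 cf1_bigX cf1_lin.
by move=> h; have := h w hw; rewrite mul0mx add0r.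
Qed.

End Good.

End Tau.

(** * The quotient defined by a good kernel element *)

Section Delta.
Variables (K N : nat) (R : realFieldType).

Lemma submx_mxvec m1 m2 p n (F : 'M[R]_(m1 * m2, n)) (G : 'M[R]_(p, n)) :
  (forall Z : 'M_(m1, m2), (mxvec Z *m F <= G)%MS) -> (F <= G)%MS.
Proof. by move=> h; apply/row_subP => i; rewrite rowE -[delta_mx 0 i]vec_mxK; apply: h. Qed.

Lemma colspace_of_kermx m n k q (W : 'M[R]_(m, n)) (P : 'M[R]_(q, m)) (Y : 'M[R]_(m, k)) :
  (kermx W <= P)%MS -> P *m Y = 0 -> exists C, Y = W *m C.
Proof.
move=> hP PY; exists (pinvmx W *m Y).
have h : ((1%:M - W *m pinvmx W) <= P)%MS.
  by apply: submx_trans hP; apply/sub_kermxP; rewrite mulmxBl mul1mx mulmxKpV // subrr.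
have [D hD] := submxP h; have : (1%:M - W *m pinvmx W) *m Y = 0 by rewrite hD -mulmxA PY mulmx0.
by rewrite mulmxBl mul1mx -mulmxA => /eqP; rewrite subr_eq0 => /eqP.
Qed.

Definition xblk l (g : 'I_l -> 'I_K) (x : 'M[R]_(l, N)) k : 'M[R]_(l, N) :=
  \matrix_(c, j) ((g c == k)%:R * x c j).

(** The row space of X(x) is the direct sum of the row spaces of its blocks, as different blocks
    occupy different columns. *)
Lemma bigX_sub l l' (g : 'I_l -> 'I_K) (g' : 'I_l' -> 'I_K) x (z : 'M[R]_(l', N)) :
  (bigX g' z <= bigX g x)%MS <-> forall c, (row c z <= xblk g x (g' c))%MS.
Proof.
split=> [/submxP[y hy] c|h].
  apply/submxP; exists (row c y); apply/rowP => j; have /matrixP/(_ c (mxvec_index (g' c) j)) := hy.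
  rewrite bigXE eqxx mul1r [RHS]mxE => e; rewrite [LHS]mxE e [RHS]mxE; apply: eq_bigr => c' _.
  by rewrite bigXE [row c y _ _]mxE [xblk _ _ _ _ _]mxE [g c' == _]eq_sym.
pose y : 'M[R]_(l', l) := \matrix_(c, c') ((g c' == g' c)%:R * (row c z *m pinvmx (xblk g x (g' c))) 0 c').
apply/submxP; exists y; apply/matrixP => c u; case/mxvec_indexP: u => k j.
rewrite bigXE mxE; have /matrixP/(_ 0 j) := mulmxKpV (h c); rewrite [RHS]mxE => e.
have [->|nk] := eqVneq k (g' c).
  rewrite mul1r -e mxE; apply: eq_bigr => c' _; rewrite bigXE [y _ _]mxE [xblk _ _ _ _ _]mxE [g c' == _]eq_sym.
  by case: eqP => _; rewrite ?mul1r // !mul0r mulr0.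
rewrite mul0r big1 // => c' _; rewrite bigXE [y _ _]mxE.
by have [e1|ne] := eqVneq k (g c'); rewrite ?mul0r ?mulr0 // -e1 (negbTE nk) !mul0r.
Qed.

(** The kernel of X(x) is stable under the projections to the blocks. [Z] collects the projections
    of a spanning set, and a maximal independent set of its rows is a homogeneous basis. *)
Lemma graded_kernel l (g : 'I_l -> 'I_K) (x : 'M[R]_(l, N)) :
  exists (g' : 'I_(l - \rank (bigX g x)) -> 'I_K) (q : 'M[R]_(l - \rank (bigX g x), l)),
    [/\ row_free q, graded g' g q & (q :=: kermx (bigX g x))%MS].
Proof.
pose Ker := kermx (bigX g x).
pose Z : 'M[R]_(K * l, l) := \matrix_(u, c) ((g c == (dec u).1)%:R * Ker (dec u).2 c).
have ZX : Z *m bigX g x = 0.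
  apply/matrixP => u w; case/mxvec_indexP: w => k j; rewrite mxE [RHS]mxE.
  under eq_bigr => c _ do rewrite [Z _ _]mxE bigXE.
  case: (dec u) => k0 i /=.
  have e : \sum_c Ker i c * ((k == g c)%:R * x c j) = 0.
    transitivity ((Ker *m bigX g x) i (mxvec_index k j)); last by rewrite mulmx_ker mxE.
    by rewrite mxE; apply: eq_bigr => c _; rewrite bigXE.
  have [ek|nk] := eqVneq k k0.
    rewrite -[RHS]e; apply: eq_bigr => c _; rewrite -ek [g c == k]eq_sym.
    by case: eqP => _; rewrite ?mul1r // !mul0r mulr0.
  rewrite big1 // => c _; have [e1|ne] := eqVneq k (g c); last by rewrite mul0r mulr0.
  by rewrite -e1 (negbTE nk) !mul0r.
have ZE : (Z :=: Ker)%MS.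
  apply/eqmxP/andP; split; first exact/sub_kermxP.
  apply/submxP; exists (\matrix_(i, u) ((dec u).2 == i)%:R); apply/matrixP => i c.
  rewrite [RHS]mxE sum_mxvec (bigD1 (g c)) //= [X in _ + X]big1 ?addr0 => [|k nk]; last first.
    by rewrite big1 // => j _; rewrite [Z _ _]mxE decK /= eq_sym (negbTE nk) mul0r mulr0.
  rewrite (bigD1 i) //= big1 ?addr0 => [|j nj].
    by rewrite [Z _ _]mxE [X in X * _]mxE decK /= !eqxx !mul1r.
  by rewrite [X in X * _]mxE decK /= (negbTE nj) mul0r.
have rZ : \rank Z = (l - \rank (bigX g x))%N by rewrite ZE mxrank_ker.
pose q0 := rowsub (maxrankfun Z) Z.
have q0E : (q0 :=: Ker)%MS by apply: eqmx_trans (eq_maxrowsub Z) ZE.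
have q0f : row_free q0 by apply: maxrowsub_free.
have q0g : graded (fun c => (dec (maxrankfun Z c)).1) g q0.
  by move=> c' c; rewrite eq_sym !mxE => /negbTE ->; rewrite mul0r.
move: q0 q0E q0f q0g; move: (fun c => (dec (maxrankfun Z c)).1); rewrite rZ => g' q0 *.
by exists g', q0.
Qed.

Lemma rank_XB M l n (g : 'I_l -> 'I_K) (A : 'M[R]_(n, l)) (B : 'M[R]_(K * N, M)) (x : 'M[R]_(l, N)) :
  A *m bigX g x *m B = 0 ->
  (\rank (bigX g x *m B) + \rank (A *m bigX g x) <= \rank (bigX g x))%N.
Proof.
move=> h; set W := bigX g x; have WE := mulmx_base W.
have e1 : \rank (A *m W) = \rank (A *m col_base W).
  by rewrite -{1}WE mulmxA mxrankMfree // row_base_free.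
have z : (A *m col_base W) *m (row_base W *m B) = 0.
  by rewrite -mulmxA (mulmxA (col_base W)) WE mulmxA.
have := mulmx0_rank_max z; rewrite -e1 addnC; apply: leq_trans.
by rewrite leq_add2r -{1}WE -mulmxA; apply: mxrankM_maxr.
Qed.

(** Split each row of z by the idempotent onto the row space of its block of x. On the first part
    tau factors through y -> A' y X(x) B, whose rank is bounded by [rank_XB]; the second part has
    only the complementary dimensions left. *)
Lemma tau_upper M l n l' n' (g : 'I_l -> 'I_K) (g' : 'I_l' -> 'I_K)
    (A : 'M[R]_(n, l)) (B : 'M[R]_(K * N, M)) (x : 'M[R]_(l, N)) (A' : 'M[R]_(n', l')) :
  A *m bigX g x *m B = 0 ->
  (\rank (tau g' A' B) <= n' * (\rank (bigX g x) - \rank (A *m bigX g x)) +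
     \sum_c (N - \rank (xblk g x (g' c))))%N.
Proof.
move=> h; pose f k := pinvmx (xblk g x k) *m xblk g x k.
pose F1 := rowmap (fun c => f (g' c)); pose F2 := rowmap (fun c => 1%:M - f (g' c)).
have F12 : F1 + F2 = 1%:M.
  apply/row_matrixP => i; rewrite !rowE -[delta_mx 0 i]vec_mxK mulmxDr !rowmapE mulmx1 -linearD /=.
  congr mxvec; set z := vec_mx _; apply/matrixP => c j.
  have /matrixP/(_ 0 j) : row c z *m f (g' c) + row c z *m (1%:M - f (g' c)) = row c z.
    by rewrite -mulmxDr addrC subrK mulmx1.
  rewrite [RHS]mxE => <-; rewrite [LHS]mxE [RHS]mxE; congr (_ + _); by rewrite [LHS]mxE.
have -> : tau g' A' B = F1 *m tau g' A' B + F2 *m tau g' A' B by rewrite -mulmxDl F12 mul1mx.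
apply: leq_trans (mxrank_add _ _) _; apply: leq_add.
  apply: leq_trans (_ : \rank (lin_mulmxr (bigX g x *m B) : 'M_(n' * l, n' * M)) <= _)%N.
    apply: mxrankS; apply: submx_mxvec => z; rewrite mulmxA rowmapE tauE.
    set z1 := \matrix_(c, j) _.
    have : (bigX g' z1 <= bigX g x)%MS.
      apply/bigX_sub => c; have -> : row c z1 = row c z *m f (g' c) by apply/rowP => j; rewrite !mxE.
      by rewrite mulmxA submxMl.
    case/submxP => y ->; rewrite mulmxA -mulmxA -[_ *m (bigX g x *m B)]/(mulmxr (bigX g x *m B) (A' *m y)).
    by rewrite -mul_vec_lin submxMl.
  rewrite rank_lin_mulmxr leq_mul2l; apply/orP; right.
  by have := rank_XB h; lia.
apply: leq_trans (mxrankM_maxl _ _) _; apply: leq_trans (rank_rowmap _) _.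
apply: leq_sum => c _; rewrite -(leq_add2r (\rank (xblk g x (g' c)))) subnK ?rank_leq_col //.
rewrite addnC; apply: mulmx0_rank_max; rewrite mulmxBr mulmx1 mulmxA.
by rewrite mulmxKpV // subrr.
Qed.

Section Quotient.
Variables (M l n l' n' : nat) (g : 'I_l -> 'I_K) (g' : 'I_l' -> 'I_K).
Variables (A : 'M[R]_(n, l)) (B : 'M[R]_(K * N, M)) (x : 'M[R]_(l, N)).
Variables (p : 'M[R]_(n', n)) (q : 'M[R]_(l', l)).
Hypothesis hg : good g A B x.
Hypothesis pfree : row_free p.
Hypothesis qfree : row_free q.
Hypothesis qgr : graded g' g q.
Hypothesis qE : (q :=: kermx (bigX g x))%MS.
Hypothesis pE : (p :=: kermx (A *m bigX g x))%MS.
Local Notation X := (bigX g).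
Local Notation s := (\rank (X x)).
Local Notation rho0 := (\rank (A *m X x)).
Local Notation rho k := (\rank (xblk g x k)).

Let A2 := p *m A *m pinvmx q.

(** p and q are the quotient maps by the column spaces of A X(x) and X(x). As p A X(x) = 0, p A
    factors through q, and [A2] is the map induced by A. *)
Lemma quo_eq : p *m A = A2 *m q.
Proof.
rewrite mulmxKpV // qE; apply/sub_kermxP; rewrite -mulmxA; apply/sub_kermxP; by rewrite pE.
Qed.

Let qX (z : 'M[R]_(l, N)) : q *m X z = bigX g' (q *m z).
Proof. by rewrite (bigX_graded _ qgr). Qed.

Let qx0 (i : 'I_l') : row i q *m X x = 0.
Proof. by apply/sub_kermxP; rewrite -qE row_sub. Qed.

Let px0 (i : 'I_n') : row i p *m (A *m X x) = 0.
Proof. by apply/sub_kermxP; rewrite -pE row_sub. Qed.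

Lemma tangent_quo (y : 'M[R]_(l, N)) (D : 'M[R]_(n, l)) : tangent g A x y D ->
  (bigX g' (q *m y) <= X x)%MS /\
  ((p *m D *m X x + A2 *m bigX g' (q *m y))%R <= A *m X x)%MS.
Proof.
move=> [t1 t2]; split.
  by rewrite -qX; apply/row_subP => i; rewrite row_mul; apply: t1; apply: qx0.
have -> : p *m D *m X x + A2 *m bigX g' (q *m y) = p *m (D *m X x + A *m X y).
  by rewrite -qX mulmxDr !mulmxA quo_eq.
apply/row_subP => i; rewrite row_mul.
by apply: t2.
Qed.

(** Lift z to y; then A X(y) B lies in the column space of A X(x), say it is A X(x) C. Subtracting
    the tangent direction w that belongs to the direction -C of B gives a kernel element of tau
    itself. Both summands are tangent, hence so is y. *)
Lemma ker_tau2 (z : 'M[R]_(l', N)) : A2 *m bigX g' z *m B = 0 ->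
  (bigX g' z <= X x)%MS /\ (A2 *m bigX g' z <= A *m X x)%MS.
Proof.
move=> hz; pose y := pinvmx q *m z.
have qy : q *m y = z by rewrite mulmxA mulmxVp // mul1mx.
have pz : p *m (A *m X y *m B) = 0 by rewrite !mulmxA quo_eq -(mulmxA A2) qX qy.
have kp : (kermx (A *m X x) <= p)%MS by rewrite pE.
have [C hC] := colspace_of_kermx kp pz.
have [w hw tw] := good_tangent 0 (- C) hg.
have kw : A *m X (y - w) *m B = 0.
  rewrite bigXD bigXN mulmxDr mulmxN mulmxBl hC; move: hw; rewrite !mul0mx add0r mulmxN.
  by move/eqP; rewrite addrC subr_eq0 => /eqP ->; rewrite subrr.
have [t1 t2] := good_tangent_ker hg kw; have [u1 u2] := tw.
have ty : tangent g A x y 0.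
  have yE : X y = X (y - w) + X w by rewrite -bigXD subrK.
  split=> [v hv|v hv]; first by rewrite yE mulmxDr addmx_sub ?t1 ?u1.
  rewrite mul0mx add0r yE mulmxDr mulmxDr addmx_sub //.
    by have := t2 v hv; rewrite mul0mx add0r.
  by have := u2 v hv; rewrite mul0mx add0r.
have [h1 h2] := tangent_quo ty; move: h1 h2; rewrite qy => h1 h2; split=> //.
by move: h2; rewrite mulmx0 mul0mx add0r.
Qed.

(** By [ker_tau2] the kernel of the quotient tau lies in the image of [Y], of dimension at most the
    sum of the rho, and in the kernel of [Phi]. Tangent directions for arbitrary D show that [Phi]
    has rank at least n'(s - rho0) on that image. *)
Lemma lower_tau2 : (l' * N + n' * (s - rho0) <= \rank (tau g' A2 B) + \sum_c rho (g' c))%N.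
Proof.
pose f k := pinvmx (xblk g x k) *m xblk g x k; pose Y := rowmap (fun c => f (g' c)).
have Yfix z : (bigX g' z <= X x)%MS -> mxvec z *m Y = mxvec z.
  move/bigX_sub => h; rewrite rowmapE; congr mxvec; apply/matrixP => c j.
  by rewrite mxE mulmxA mulmxKpV // mxE.
pose cok := cokermx (A *m X x); pose Phi := tau g' A2 cok.
have kerle : (\rank (kermx (tau g' A2 B)) <= \rank (Y :&: kermx Phi)%MS)%N.
  apply: mxrankS; rewrite -[kermx _]mul1mx; apply: submx_mxvec => Z.
  rewrite mulmxA mulmx1; set u := mxvec Z *m _.
  have hu : u *m tau g' A2 B = 0 by rewrite /u -mulmxA mulmx_ker mulmx0.
  have : A2 *m bigX g' (vec_mx u) *m B = 0.
    by apply: (can_inj mxvecK); rewrite -tauE vec_mxK hu linear0.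
  case/ker_tau2 => h1 h2; rewrite sub_capmx; apply/andP; split.
    by rewrite -[u]vec_mxK -(Yfix _ h1) submxMl.
  apply/sub_kermxP; rewrite -[u]vec_mxK tauE; apply/eqP; rewrite mxvec_eq0.
  by move: h2; rewrite submxE.
pose H := X x *m cok.
have rH : (s - rho0 <= \rank H)%N.
  have := mxrank_mul_ker (X x) cok; rewrite -/H => <-; rewrite leq_subLR addnC leq_add2r.
  apply: mxrankS; rewrite submxE -/cok; apply/eqP.
  by apply/sub_kermxP; apply: capmxSr.
have surj : (n' * (s - rho0) <= \rank (Y *m Phi))%N.
  apply: leq_trans (_ : n' * \rank H <= _)%N; first by rewrite leq_mul2l rH orbT.
  rewrite -rank_lin_mulmxr; apply: mxrankS; apply: submx_mxvec => w.
  rewrite mul_vec_lin /=; pose D := pinvmx p *m w.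
  have pD : p *m D = w by rewrite mulmxA mulmxVp // mul1mx.
  have [y _ ty] := good_tangent D 0 hg; have [h1 h2] := tangent_quo ty.
  have -> : w *m H = - (A2 *m bigX g' (q *m y) *m cok).
    move: h2; rewrite pD submxE -/cok mulmxDl => /eqP/eqP; rewrite addr_eq0 => /eqP <-.
    by rewrite /H mulmxA.
  rewrite linearN /= -tauE -(Yfix _ h1) -mulmxA -mulNmx submxMl //.
have rY : (\rank Y <= \sum_c rho (g' c))%N.
  apply: leq_trans (rank_rowmap _) _; apply: leq_sum => c _; exact: mxrankM_maxr.
have e1 := mxrank_mul_ker Y Phi; have e2 := mxrank_ker (tau g' A2 B).
have e3 := rank_leq_row (tau g' A2 B).
move: kerle surj rY e1 e3; rewrite e2.
have arith (a b c d e r h : nat) :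
  (a - b <= c -> d <= e -> r <= h -> e + c = r -> b <= a -> a + d <= b + h)%N by lia.
exact: arith.
Qed.

(** Applying p maps the image of tau onto a space containing the image of the quotient tau. Varying
    B along C shows that all A X(x) C lie in the image of tau, and p kills them. *)
Lemma lower_tau : (rho0 * M + \rank (tau g' A2 B) <= \rank (tau g A B))%N.
Proof.
pose Pi : 'M[R]_(n * M, n' * M) := lin_mulmx p.
rewrite -(mxrank_mul_ker (tau g A B) Pi) addnC; apply: leq_add.
  apply: mxrankS; apply: submx_mxvec => z; rewrite tauE; pose y := pinvmx q *m z.
  have qy : q *m y = z by rewrite mulmxA mulmxVp // mul1mx.
  have -> : A2 *m bigX g' z *m B = p *m (A *m X y *m B).
    by rewrite -[z in bigX g' z]qy -qX !mulmxA quo_eq.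
  by rewrite -[p *m _]/(mulmx p _) -mul_vec_lin -tauE -mulmxA submxMl.
apply: leq_trans (rank_lin_mulmx M (A *m X x)) _; apply: mxrankS.
rewrite sub_capmx; apply/andP; split; last first.
  apply/sub_kermxP/row_matrixP => i; rewrite row_mul row0 rowE -[delta_mx 0 i]vec_mxK.
  rewrite mul_vec_lin /= mul_vec_lin /= mulmxA.
  have -> : p *m (A *m X x) = 0 by apply/row_matrixP => j; rewrite row_mul px0 row0.
  by rewrite mul0mx linear0.
apply: submx_mxvec => C; rewrite mul_vec_lin /=.
have [y hy _] := good_tangent 0 C hg.
have -> : A *m X x *m C = A *m X (- y) *m B.
  move: hy; rewrite !mul0mx add0r bigXN mulmxN mulNmx => /eqP; rewrite addr_eq0 => /eqP //.
by rewrite -tauE submxMl.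
Qed.

(* Moving B along the line to B' keeps the ranks of the kernel element generic, which
   bounds the rank of every tau on the quotient; the same number bounds the rank of
   tau A2 B from below. *)
Lemma good_delta (A' : 'M[R]_(n', l')) (B' : 'M[R]_(K * N, M)) :
  (rho0 * M + \rank (tau g' A' B') <= \rank (tau g A B))%N.
Proof.
have up : (\rank (tau g' A' B') <= n' * (s - rho0) + \sum_c (N - rho (g' c)))%N.
  have e0 m k (E F : 'M[R]_(m, k)) : evx 0 (lin_curve E F) = E.
    by rewrite evx_lin scale0r addr0.
  pose Bt := lin_curve B (B' - B).
  have [xt [_ x0 hc]] := good_curve hg (evx_cst 0 A) (e0 _ _ B (B' - B)).
  have c1 : cof (fun t => forall k, (rho k <= \rank (xblk g (evx t xt) k))%N).
    have ck k : cof (fun t => (rho k <= \rank (xblk g (evx t xt) k))%N).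
      pose xb : 'M[{poly R}]_(l, N) := \matrix_(c, j) ((g c == k)%:R * xt c j).
      have xbE t : evx t xb = xblk g (evx t xt) k.
        apply/matrixP => c j; rewrite !mxE /horner_eval hornerM.
        by case: (_ == _); rewrite ?hornerC ?horner0 // -[1%:R]/(1 : {poly R}) hornerC.
      by apply: cof_imp (cof_rank xb 0) => t; rewrite !xbE x0.
    have : forall r : seq 'I_K, cof (fun t => forall k, k \in r -> (rho k <= \rank (xblk g (evx t xt) k))%N).
      elim=> [|k r IH]; first exact: cof_true.
      apply: cof_imp (cof_and (ck k) IH) => t [h1 h2] k'.
      by rewrite inE => /orP[/eqP ->|/h2].
    by move=> /(_ (enum 'I_K)); apply: cof_imp => t h k; apply: h; rewrite mem_enum.
  have c2 := cof_rank (tau g' (cst A') Bt) 1.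
  (* A parameter t where the point is good, no block rank has dropped, and tau has at least the rank
     it has at t = 1, that is, at [B']. *)
  have [t [[hgt e1 e2] [h1 h2]]] := cof_ex (cof_and hc (cof_and c1 c2)).
  move: h2; rewrite !evx_tau !evx_cst; have -> : evx 1 Bt = B'.
    by rewrite evx_lin scale1r addrC subrK.
  move/leq_trans; apply; case: hgt => _; rewrite evx_cst => hk _.
  apply: leq_trans (tau_upper g' A' hk) _; rewrite e1; move: e2; rewrite evx_cst => ->.
  by rewrite leq_add2l; apply: leq_sum => c _; apply: leq_sub2l.
have sN : (\sum_c (N - rho (g' c)) + \sum_c rho (g' c) = l' * N)%N.
  rewrite -big_split /= (eq_bigr (fun=> N)) => [|c _]; last by rewrite subnK // rank_leq_col.
  by rewrite sum_nat_const card_ord.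
have := lower_tau2; have := lower_tau; lia.
Qed.

End Quotient.

End Delta.

(** * Orthonormalization respecting a grading *)

Section GramSchmidt.
Variables (K : nat) (R : rcfType).

Lemma graded_mul l1 l2 l3 (g1 : 'I_l1 -> 'I_K) (g2 : 'I_l2 -> 'I_K) (g3 : 'I_l3 -> 'I_K)
    (u : 'M[R]_(l1, l2)) (v : 'M[R]_(l2, l3)) :
  graded g1 g2 u -> graded g2 g3 v -> graded g1 g3 (u *m v).
Proof.
move=> hu hv i k ne; rewrite mxE big1 // => j _.
have [e|n1] := eqVneq (g1 i) (g2 j); last by rewrite (hu _ _ n1) mul0r.
by rewrite (hv j k) ?mulr0 // -e.
Qed.

Lemma graded_tr l1 l2 (g1 : 'I_l1 -> 'I_K) (g2 : 'I_l2 -> 'I_K) (u : 'M[R]_(l1, l2)) :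
  graded g1 g2 u -> graded g2 g1 u^T.
Proof. by move=> h i j ne; rewrite mxE h // eq_sym. Qed.

Lemma sqnorm_row n (v : 'rV[R]_n) : (v *m v^T) 0 0 = \sum_j v 0 j ^+ 2.
Proof. by rewrite mxE; apply: eq_bigr => j _; rewrite mxE expr2. Qed.

(** Rows of different colours have disjoint supports, so orthogonalization never mixes them and h
    stays graded. *)
Lemma graded_gram_schmidt l' l (g' : 'I_l' -> 'I_K) (g : 'I_l -> 'I_K) (q : 'M[R]_(l', l)) :
  row_free q -> graded g' g q ->
  exists h : 'M[R]_l', graded g' g' h /\ (h *m q) *m (h *m q)^T = 1%:M.
Proof.
elim: l' g' q => [|l' IH].
  by move=> g' q _ _; exists 0; split=> [[]//|]; apply/matrixP => -[].
rewrite -[l'.+1]/(1 + l')%N => g' q qf qg.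
pose v := usubmx q; pose u := dsubmx q; have qE : q = col_mx v u by rewrite vsubmxK.
pose gu := fun i : 'I_l' => g' (rshift 1 i); pose gv := fun i : 'I_1 => g' (lshift l' i).
have ug : graded gu g u by move=> i j ne; rewrite mxE qg.
have vg : graded gv g v by move=> i j ne; rewrite mxE qg.
have uf : row_free u.
  have /row_freeP[Q hQ] := qf; apply/row_freeP; exists (rsubmx Q); move: hQ.
  by rewrite qE -[Q]hsubmxK mul_col_row row_mxKr scalar_mx_block => /eq_block_mx[].
have [h1 [h1g h1o]] := IH gu u uf ug; set o := h1 *m u in h1o.
pose w := v - v *m o^T *m o.
have wo : w *m o^T = 0 by rewrite mulmxBl -(mulmxA _ o) h1o mulmx1 subrr.
have w0 : w != 0.
  apply/negP => /eqP w0.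
  have : row_mx 1%:M (- (v *m o^T *m h1)) *m q = 0.
    by rewrite qE mul_row_col mul1mx mulNmx -(mulmxA _ h1).
  move/(congr1 (mulmx^~ (pinvmx q))); rewrite -(mulmxA _ q) mulmxVp // mulmx1 mul0mx.
  rewrite -row_mx0 => /eq_row_mx[/matrixP/(_ 0 0)]; rewrite !mxE => /eqP.
  by rewrite oner_eq0.
pose s := (w *m w^T) 0 0.
have s0 : 0 < s.
  rewrite lt_def {2}/s sqnorm_row sumr_ge0 ?andbT => [|j _]; last exact: sqr_ge0.
  apply: contraNneq w0; rewrite /s sqnorm_row => /eqP.
  rewrite psumr_eq0 => [/allP h|j _]; last exact: sqr_ge0.
  by apply/eqP/rowP => j; rewrite [RHS]mxE; have := h j (mem_index_enum _); rewrite sqrf_eq0 => /eqP.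
have wE : w *m w^T = s%:M by apply/matrixP => i j; rewrite !ord1 [RHS]mxE eqxx.
pose a := (Num.sqrt s)^-1.
have as1 : a * (a * s) = 1.
  rewrite /a -{3}(sqr_sqrtr (ltW s0)) expr2; field.
  by rewrite gt_eqF // sqrtr_gt0.
exists (block_mx a%:M (- (a *: (v *m o^T *m h1))) 0 h1); split.
  have hg : graded gv gu (v *m o^T *m h1).
    exact: graded_mul (graded_mul vg (graded_tr (graded_mul h1g ug))) h1g.
  move=> i j; rewrite -[i]splitK -[j]splitK.
  case: (split i) => i'; case: (split j) => j' /= ne.
  - by move: ne; rewrite !ord1 eqxx.
  - by rewrite block_mxEur mxE mxE hg // mulr0 oppr0.
  - by rewrite block_mxEdl mxE.
  - by rewrite block_mxEdr h1g.
have -> : block_mx a%:M (- (a *: (v *m o^T *m h1))) 0 h1 *m q = col_mx (a *: w) o.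
  rewrite qE mul_block_col mul0mx add0r; congr col_mx.
  by rewrite mul_scalar_mx mulNmx -scalemxAl -(mulmxA _ h1) -scalerBr.
have ow : o *m w^T = 0 by rewrite -[o *m w^T]trmxK trmx_mul trmxK wo trmx0.
rewrite tr_col_mx mul_col_row linearZ /= -!scalemxAl -!scalemxAr wo wE h1o ow !scaler0.
by rewrite !scale_scalar_mx as1 -scalar_mx_block.
Qed.

End GramSchmidt.

Lemma gram_schmidt (R : rcfType) n' n (p : 'M[R]_(n', n)) : row_free p ->
  exists h : 'M[R]_n', (h *m p) *m (h *m p)^T = 1%:M.
Proof.
move=> pf; pose g m (_ : 'I_m) : 'I_1 := ord0.
have [|h [_ e]] := @graded_gram_schmidt 1 R n' n (@g n') (@g n) p pf; last by exists h.
by move=> i j; rewrite eqxx.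
Qed.

Lemma orthonormal_free (R : fieldType) m n (q : 'M[R]_(m, n)) : q *m q^T = 1%:M -> row_free q.
Proof. by move=> h; apply/row_freeP; exists q^T. Qed.

Lemma orthonormal_bound (R : rcfType) m n (q : 'M[R]_(m, n)) i j : q *m q^T = 1%:M -> `|q i j| <= 1.
Proof.
move=> /matrixP/(_ i i); rewrite !mxE eqxx => e.
have : q i j ^+ 2 <= 1.
  rewrite -[1]e (bigD1 j) //= mxE expr2 lerDl; apply: sumr_ge0 => k _.
  by rewrite mxE -expr2 sqr_ge0.
by rewrite -[_ ^+ 2]real_normK ?num_real // expr_le1 // normr_ge0.
Qed.

(** * Limits of quotients and semistability of tight frames *)

Section Closure.
Variable R : realType.

Lemma infinitely_often (T : finType) (h : nat -> T) :
  exists y phi, (forall j, (j <= phi j)%N) /\ forall j, h (phi j) = y.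
Proof.
have [y hy] : exists y, forall j0, exists j, (j0 <= j)%N /\ h j = y.
  apply: NNPP => hn.
  have hT (y : T) : exists j0, forall j, (j0 <= j)%N -> h j <> y.
    apply: NNPP => hy; apply: hn; exists y => j0; apply: NNPP => hj; apply: hy.
    by exists j0 => j le e; apply: hj; exists j.
  have [b hb] := fin_all_exists hT.
  by apply: (hb (h (\max_y b y)) (\max_y b y)) => //; apply: leq_bigmax.
have [phi hphi] := choice _ hy; exists y, phi; split=> j; by case: (hphi j).
Qed.

Definition cvgm m n (u : nat -> 'M[R]_(m, n)) (U : 'M[R]_(m, n)) :=
  forall i k, cvgs (fun j => u j i k) (U i k).

Lemma cvgm_const m n (U : 'M[R]_(m, n)) : cvgm (fun=> U) U.
Proof. by move=> i k; apply: cvgs_const. Qed.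

Lemma cvgm_sub m n u (U : 'M[R]_(m, n)) phi :
  (forall j, (j <= phi j)%N) -> cvgm u U -> cvgm (u \o phi) U.
Proof. by move=> h hu i k; apply: (cvgs_sub h (hu i k)). Qed.

Lemma cvgm_mul m n p u v (U : 'M[R]_(m, n)) (V : 'M[R]_(n, p)) :
  cvgm u U -> cvgm v V -> cvgm (fun j => u j *m v j) (U *m V).
Proof.
move=> hu hv i k; rewrite mxE.
apply: (@cvgs_ext _ (fun j => \sum_x u j i x * v j x k)) => [j|]; first by rewrite mxE.
by apply: cvgs_sum => x; apply: cvgsM.
Qed.

Lemma cvgm_tr m n u (U : 'M[R]_(m, n)) : cvgm u U -> cvgm (fun j => (u j)^T) U^T.
Proof. by move=> h i k; rewrite mxE; apply: cvgs_ext (h k i) => j; rewrite mxE. Qed.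

Lemma cvgm_uniq m n u v (U V : 'M[R]_(m, n)) :
  (forall j, u j = v j) -> cvgm u U -> cvgm v V -> U = V.
Proof.
move=> e hu hv; apply/matrixP => i k; apply: cvgs_uniq (hu i k) _.
by apply: cvgs_ext (hv i k) => j; rewrite e.
Qed.

Lemma bolzano_mx m n (u : nat -> 'M[R]_(m, n)) C : (forall j i k, `|u j i k| <= C) ->
  exists phi U, (forall j, (j <= phi j)%N) /\ cvgm (u \o phi) U.
Proof.
move=> hC; have [|phi [x [h1 h2]]] := @bolzano R (m * n) (fun j i => mxvec (u j) 0 i) C.
  by move=> j i; case/mxvec_indexP: i => a b; rewrite mxvecE.
exists phi, (vec_mx (\row_i x i)); split=> // i k; rewrite !mxE.
by apply: cvgs_ext (h2 (mxvec_index i k)) => j; rewrite mxvecE.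
Qed.

Lemma cof_near (P : R -> Prop) t0 e : cof P -> 0 < e -> exists t, `|t - t0| < e /\ P t.
Proof.
move=> [d d0 hd] e0; apply: NNPP => hn; case/eqP: d0.
(* Infinitely many distinct points near t0; [k.+2] keeps their distance strictly below e. *)
pose pt k : R := t0 + e / k.+2%:R.
apply: (@roots_geq_poly_eq0 R _ (mkseq pt (size d))); last by rewrite size_mkseq.
  apply/allP => y /mapP[k _ ->]; rewrite rootE; apply: contraT => /hd hP; case: hn.
  exists (pt k); split=> //; rewrite /pt addrC addKr.
  rewrite ger0_norm ?divr_ge0 ?(ltW e0) // ltr_pdivrMr // ltr_pMr // ltr1n.
  by [].
rewrite map_inj_uniq ?iota_uniq // => a b /addrI /(mulfI (lt0r_neq0 e0)) /invr_inj /eqP.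
by rewrite eqr_nat => /eqP[].
Qed.

Variables (K N M : nat).

(** Orthonormal rows bound p and q and make the induced map p A q^T, so that the relation becomes a
    closed condition; g' is a finite function so that a subsequence can fix it. *)
Lemma good_quotient l n (g : 'I_l -> 'I_K) (A : 'M[R]_(n, l)) (B : 'M[R]_(K * N, M)) x :
  good g A B x ->
  exists (g' : {ffun 'I_(l - \rank (bigX g x)) -> 'I_K})
    (p : 'M[R]_(n - \rank (A *m bigX g x), n)) (q : 'M[R]_(l - \rank (bigX g x), l)),
  [/\ p *m p^T = 1%:M, q *m q^T = 1%:M, graded g' g q, p *m A = p *m A *m q^T *m q &
    forall (A' : 'M[R]_(n - \rank (A *m bigX g x), _)) (B' : 'M[R]_(K * N, M)),
      (\rank (A *m bigX g x) * M + \rank (tau g' A' B') <= \rank (tau g A B))%N].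
Proof.
move=> hg; have [g0 [q0 [q0f q0g q0E]]] := graded_kernel g x.
have [p0 [p0f p0E]] : exists p0 : 'M[R]_(n - \rank (A *m bigX g x), n),
    row_free p0 /\ (p0 :=: kermx (A *m bigX g x))%MS.
  have := row_base_free (kermx (A *m bigX g x)); have := eq_row_base (kermx (A *m bigX g x)).
  by move: (row_base _); rewrite mxrank_ker => r *; exists r.
have [h [hgr ho]] := graded_gram_schmidt q0f q0g; have [k ko] := gram_schmidt p0f.
have hu : row_free h.
  rewrite -row_leq_rank; apply: leq_trans (mxrankM_maxl h q0).
  by rewrite row_leq_rank; apply: orthonormal_free.
have ku : row_free k.
  rewrite -row_leq_rank; apply: leq_trans (mxrankM_maxl k p0).
  by rewrite row_leq_rank; apply: orthonormal_free.
have qE : (h *m q0 :=: kermx (bigX g x))%MS.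
  by apply: eqmx_trans q0E; apply: eqmxMfull; rewrite row_full_unit -row_free_unit.
have pE : (k *m p0 :=: kermx (A *m bigX g x))%MS.
  by apply: eqmx_trans p0E; apply: eqmxMfull; rewrite row_full_unit -row_free_unit.
have gq : graded g0 g (h *m q0) by apply: graded_mul hgr q0g.
have g0E : finfun g0 =1 g0 by move=> c; rewrite ffunE.
exists (finfun g0), (k *m p0), (h *m q0); split=> //.
- by move=> c c'; rewrite g0E; apply: gq.
- have e := quo_eq qE pE; rewrite [in RHS]e -(mulmxA _ (h *m q0)) ho mulmx1; exact: e.
move=> A' B'.
have -> : tau (finfun g0) A' B' = tau g0 A' B' by apply/matrixP => i j; rewrite !mxE g0E.
exact: (good_delta hg (orthonormal_free ko) (orthonormal_free ho) gq qE pE).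
Qed.

(* Orthonormal bases of the quotients at A + t(At - A) converge along a subsequence
   as t -> 1 through the cofinitely many good parameters. *)
Lemma limit_quotient l n (g : 'I_l -> 'I_K) (A : 'M[R]_(n, l)) (B : 'M[R]_(K * N, M)) x (At : 'M[R]_(n, l)) :
  good g A B x ->
  exists (g' : 'I_(l - \rank (bigX g x)) -> 'I_K)
    (p : 'M[R]_(n - \rank (A *m bigX g x), n)) (q : 'M[R]_(l - \rank (bigX g x), l)),
  [/\ p *m p^T = 1%:M, q *m q^T = 1%:M, graded g' g q, p *m At = p *m At *m q^T *m q &
    forall (A' : 'M[R]_(n - \rank (A *m bigX g x), _)) (B' : 'M[R]_(K * N, M)),
      (\rank (A *m bigX g x) * M + \rank (tau g' A' B') <= \rank (tau g A B))%N].
Proof.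
move=> hg; have e0 m k (E F : 'M[R]_(m, k)) : evx 0 (lin_curve E F) = E.
  by rewrite evx_lin scale0r addr0.
have [xt [_ _ hc]] := good_curve hg (e0 _ _ A (At - A)) (evx_cst 0 B).
set l' := (l - _)%N; set n' := (n - _)%N.
pose T := (R * ({ffun 'I_l' -> 'I_K} * ('M[R]_(n', n) * 'M[R]_(l', l))))%type.
(* With the colouring fixed, the first four conditions are closed; the last depends on the colouring
   only. *)
pose S (t : T) := [/\ t.2.2.1 *m t.2.2.1^T = 1%:M, t.2.2.2 *m t.2.2.2^T = 1%:M, graded t.2.1 g t.2.2.2,
   t.2.2.1 *m (A + t.1 *: (At - A)) = t.2.2.1 *m (A + t.1 *: (At - A)) *m t.2.2.2^T *m t.2.2.2 &
   forall (A' : 'M[R]_(n', _)) (B' : 'M[R]_(K * N, M)),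
      (\rank (A *m bigX g x) * M + \rank (tau t.2.1 A' B') <= \rank (tau g A B))%N].
have hj (j : nat) : exists t : T, `|t.1 - 1| < j.+1%:R^-1 /\ S t.
  have [|t [lt [hgt r1 r2]]] := @cof_near _ 1 j.+1%:R^-1 hc; first by rewrite invr_gt0 ltr0n.
  have r3 : \rank (tau g (evx t (lin_curve A (At - A))) (evx t (cst B))) = \rank (tau g A B).
    by case: hgt => m1 _ _; case: hg => m2 _ _; apply/eqP; rewrite eqn_leq m1 m2.
  have := good_quotient hgt; rewrite r1 r2 r3 evx_lin => -[g' [p [q h]]].
  by exists (t, (g', (p, q))).
have [T_ hT] := choice _ hj.
have [g' [phi1 [le1 hg']]] := infinitely_often (fun j => (T_ j).2.1).
pose T1 j := T_ (phi1 j).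
have S1 j : S (T1 j) by have [] := hT (phi1 j).
have [|phi2 [P [le2 hP]]] := @bolzano_mx n' n (fun j => (T1 j).2.2.1) 1.
  by move=> j i k; apply: orthonormal_bound; case: (S1 j).
pose T2 j := T1 (phi2 j).
have S2 j : S (T2 j) by apply: S1.
have [|phi3 [Q [le3 hQ]]] := @bolzano_mx l' l (fun j => (T2 j).2.2.2) 1.
  by move=> j i k; apply: orthonormal_bound; case: (S2 j).
pose phi j := phi1 (phi2 (phi3 j)).
have le j : (j <= phi j)%N by apply: leq_trans (le3 j) (leq_trans (le2 _) (le1 _)).
have S3 j : S (T_ (phi j)) by have [] := hT (phi j).
have cP : cvgm (fun j => (T_ (phi j)).2.2.1) P by apply: cvgm_sub le3 hP.
have cQ : cvgm (fun j => (T_ (phi j)).2.2.2) Q by exact: hQ.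
have ct : cvgs (fun j => (T_ (phi j)).1) 1.
  move=> e e_gt0; have [j0 hj0] := @cvgs_invS R e e_gt0; exists j0 => j lej.
  have [lt _] := hT (phi j); apply: lt_trans lt _.
  have := hj0 _ (leq_trans lej (le j)); rewrite subr0 ger0_norm //.
  by rewrite invr_ge0 ler0n.
have cA : cvgm (fun j => A + (T_ (phi j)).1 *: (At - A)) At.
  move=> i k; have -> : At i k = A i k + 1 * (At i k - A i k) by rewrite mul1r addrC subrK.
  apply: (@cvgs_ext _ (fun j => A i k + (T_ (phi j)).1 * (At i k - A i k))).
    by move=> j; rewrite !mxE.
  by apply: cvgsD (cvgs_const _) (cvgsM ct (cvgs_const _)).
exists g', P, Q; split.
- apply: cvgm_uniq (cvgm_mul cP (cvgm_tr cP)) (cvgm_const _) => j; by case: (S3 j).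
- apply: cvgm_uniq (cvgm_mul cQ (cvgm_tr cQ)) (cvgm_const _) => j; by case: (S3 j).
- move=> c c' ne; apply: cvgs_uniq (cQ c c') _; apply: cvgs_ext (cvgs_const 0) => j.
  by case: (S3 j) => _ _ gr _ _; rewrite gr //; have := hg' (phi2 (phi3 j)) => /= ->.
- apply: cvgm_uniq (cvgm_mul cP cA) (cvgm_mul (cvgm_mul (cvgm_mul cP cA) (cvgm_tr cQ)) cQ) => j.
  by case: (S3 j).
by move=> A' B'; have := hg' 0%N => /= <-; case: (S1 0%N) => _ _ _ _ h; apply: h.
Qed.

(* A rank deficit of the generic tau is accounted for by a quotient of every At. *)
Lemma generic_quotient l n (g : 'I_l -> 'I_K) (At A : 'M[R]_(n, l)) (B : 'M[R]_(K * N, M)) :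
  tau_max g A B ->
  exists n' l' (g' : 'I_l' -> 'I_K) (p : 'M[R]_(n', n)) (q : 'M[R]_(l', l)) A',
  [/\ row_free p, row_free q, graded g' g q, p *m At = A' *m q &
    (n * M + N * l' <= n' * M + \rank (tau g A B))%N].
Proof.
have [k] := ubnP l; elim: k l n g At A B => // k IH l n g At A B lk hmax.
have [A1 [B1 [x hg]]] := @good_exists K N M R l n g.
have [m1 k1 h1] := hg.
have -> : \rank (tau g A B) = \rank (tau g A1 B1) by apply/eqP; rewrite eqn_leq m1 hmax.
(* If X(x) = 0, maximality leaves tau no kernel, and the whole space serves as its own quotient. *)
have [s0|s0] := posnP (\rank (bigX g x)).
  exists n, l, g, 1%:M, 1%:M, At; split.
  - by rewrite row_free_unit unitmx1.
  - by rewrite row_free_unit unitmx1.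
  - by move=> c c' ne; rewrite mxE; case: (c =P c') ne => [->|//]; rewrite eqxx.
  - by rewrite mul1mx mulmx1.
  rewrite leq_add2l mulnC; apply: eq_leq; apply/esym/eqP.
  apply/inj_row_free => v hv; rewrite -[v]vec_mxK; apply/eqP; rewrite mxvec_eq0.
  have : A1 *m bigX g (vec_mx v) *m B1 = 0.
    by apply: (can_inj mxvecK); rewrite -tauE vec_mxK hv linear0.
  move/(h1 _ _ _ m1); rewrite s0; have := mxrankM_maxr A1 (bigX g x); rewrite s0 leqn0 => /eqP ->.
  rewrite addn0 leqn0 addn_eq0 mxrank_eq0 => /andP[/eqP e _].
  apply/eqP; apply: (@bigX_inj K N R l g); rewrite e.
  by apply/esym/matrixP => i j; rewrite !mxE mulr0.
(* Otherwise the quotient has fewer columns: recurse on [At] compressed to it and add up the two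
   inequalities. *)
have [g1 [p1 [q1 [po qo qg e1 hd]]]] := limit_quotient At hg.
have [A2 [B2 m2]] := @tau_max_exists K N M R _ (n - \rank (A1 *m bigX g x)) g1.
have lk' : (l - \rank (bigX g x) < k)%N by move: lk s0 (rank_leq_row (bigX g x)); lia.
have [n3 [l3 [g3 [p3 [q3 [A3 [pf qf gr e3 le3]]]]]]] := IH _ _ g1 (p1 *m At *m q1^T) A2 B2 lk' m2.
exists n3, l3, g3, (p3 *m p1), (q3 *m q1), A3; split.
- by rewrite /row_free mxrankMfree // orthonormal_free.
- by rewrite /row_free mxrankMfree // orthonormal_free.
- exact: graded_mul gr qg.
- by rewrite -mulmxA e1 mulmxA e3 -mulmxA.
have arith (a b c d e r1 r2 : nat) :
  (b + c = a -> c + d <= e + r2 -> b + r2 <= r1 -> a + d <= e + r1)%N by lia.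
by apply: arith le3 (hd A2 B2); rewrite -mulnDl subnKC // rank_leq_row.
Qed.

(** The gap is the squared norm of y minus its projection p^T p y. *)
Lemma bessel m n (p : 'M[R]_(m, n)) (y : 'cV[R]_n) : p *m p^T = 1%:M ->
  ((p *m y)^T *m (p *m y)) 0 0 <= (y^T *m y) 0 0.
Proof.
move=> po; set z := p *m y; pose e := p^T *m z.
have zT : y^T *m p^T = z^T by rewrite trmx_mul.
have eT : e^T = z^T *m p by rewrite trmx_mul trmxK.
have dd : (y^T - e^T) *m (y - e) = y^T *m y - z^T *m z.
  have h1 : y^T *m e = z^T *m z by rewrite mulmxA zT.
  have h2 : e^T *m y = z^T *m z by rewrite eT -mulmxA.
  have h3 : e^T *m e = z^T *m z by rewrite eT -mulmxA (mulmxA p) po mul1mx.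
  by rewrite mulmxBl !mulmxBr h1 h2 h3 subrr subr0.
rewrite -subr_ge0; have -> : (y^T *m y) 0 0 - (z^T *m z) 0 0 = ((y - e)^T *m (y - e)) 0 0.
  by rewrite [(y - e)^T]linearB /= dd [RHS]mxE; congr (_ + _); rewrite [RHS]mxE.
by rewrite mxE; apply: sumr_ge0 => i _; rewrite mxE -expr2 sqr_ge0.
Qed.

(** For orthonormal p and q and A1 = p A q^T, a n' = tr(A1 A1^T) is the sum over the rows q_c of |p
    A q_c|^2 <= |A q_c|^2. Each q_c is supported in one block, where A has orthonormal columns; this
    bounds the contribution of c by |q_c|^2 = 1. *)
Lemma tight_semistable l n (g : 'I_l -> 'I_K) (A : 'M[R]_(n, l)) (a : R) :
  A *m A^T = a%:M -> (forall c e, g c = g e -> (A^T *m A) c e = (c == e)%:R) ->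
  forall n' l' (g' : 'I_l' -> 'I_K) (p : 'M[R]_(n', n)) (q : 'M[R]_(l', l)) A',
  row_free p -> row_free q -> graded g' g q -> p *m A = A' *m q -> a * n'%:R <= l'%:R.
Proof.
move=> AA Ag n' l' g' p q A' pf qf qg e.
have [h [hg ho]] := graded_gram_schmidt qf qg; have [k ko] := gram_schmidt pf.
set q1 := h *m q in ho; set p1 := k *m p in ko.
have hu : h \in unitmx.
  rewrite -row_free_unit -row_leq_rank; apply: leq_trans (mxrankM_maxl h q) => //.
  by rewrite row_leq_rank; apply: orthonormal_free.
pose A1 := k *m A' *m invmx h.
have e1 : p1 *m A = A1 *m q1 by rewrite /p1 /A1 /q1 -mulmxA e !mulmxA mulmxKV.
have A1E : A1 = p1 *m A *m q1^T by rewrite e1 -mulmxA ho mulmx1.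
have gq : graded g' g q1 by apply: graded_mul hg qg.
have t1 : a * n'%:R = \tr (A1^T *m A1).
  rewrite mxtrace_mulC; have -> : A1 *m A1^T = p1 *m (A *m A^T) *m p1^T.
    by rewrite [p1 *m _]mulmxA -[RHS]mulmxA -trmx_mul e1 (trmx_mul A1) [RHS]mulmxA -(mulmxA A1 q1) ho mulmx1.
  by rewrite AA mul_mx_scalar -scalemxAl ko mxtraceZ mxtrace1.
have -> : l'%:R = \sum_(c < l') (1 : R) by rewrite sumr_const card_ord.
rewrite t1 /mxtrace; apply: ler_sum => c _.
have -> : (A1^T *m A1) c c = ((p1 *m (A *m (row c q1)^T))^T *m (p1 *m (A *m (row c q1)^T))) 0 0.
  have -> : p1 *m (A *m (row c q1)^T) = col c A1.
    by rewrite A1E !mulmxA tr_row colE colE -!mulmxA.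
  by rewrite !mxE; apply: eq_bigr => i _; rewrite !mxE.
apply: le_trans (bessel _ ko) _; rewrite trmx_mul trmxK -mulmxA (mulmxA A^T).
have ho1 : \sum_j q1 c j * q1^T j c = 1.
  by have /matrixP/(_ c c) := ho; rewrite mxE [RHS]mxE eqxx.
rewrite mxE -[leRHS]ho1.
(* Only the coordinates d in the support of q_c matter, and there A^T A q_c agrees with q_c. *)
apply: ler_sum => d _; rewrite [row _ _ _ _]mxE [q1^T _ _]mxE.
have [gcd|ne] := eqVneq (g' c) (g d); last by rewrite gq // !mul0r.
suff -> : (A^T *m A *m (row c q1)^T) d 0 = q1 c d by [].
rewrite mxE (bigD1 d) //= Ag // eqxx mul1r big1 ?addr0 => [|d' nd]; first by rewrite !mxE.
rewrite [(row c q1)^T _ _]mxE [row _ _ _ _]mxE.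
have [gcd'|ne] := eqVneq (g' c) (g d'); last by rewrite gq // mulr0.
by rewrite Ag -?gcd -?gcd' // eq_sym (negbTE nd) mul0r.
Qed.

(** For N = n, the inequality n M + N l' <= n' M + rank of [generic_quotient] meets (M/n) n' <= l'
    and leaves rank >= n M. *)
Lemma tight_full_rank l n (g : 'I_l -> 'I_K) (At : 'M[R]_(n, l)) :
  (0 < n)%N -> At *m At^T = (M%:R / n%:R)%:M ->
  (forall c e, g c = g e -> (At^T *m At) c e = (c == e)%:R) -> N = n ->
  exists (A : 'M[R]_(n, l)) (B : 'M[R]_(K * N, M)), \rank (tau g A B) = (n * M)%N.
Proof.
move=> n0 AA Ag eN; have [A [B hmax]] := @tau_max_exists K N M R l n g.
have [n' [l' [g' [p [q [A' [pf qf qg e le]]]]]]] := generic_quotient At hmax.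
exists A, B; apply/eqP; rewrite eqn_leq rank_leq_col /=.
have := tight_semistable AA Ag pf qf qg e; rewrite mulrAC ler_pdivrMr ?ltr0n //.
rewrite -!natrM ler_nat => le2; have := congr1 (muln^~ l') eN; lia.
Qed.

End Closure.

(** * The determinantal invariant *)

Section DeterminantalInvariant.
Variables (R : realType) (K N l : nat) (g : 'I_l -> 'I_K).

Section OverRing.
Variable S : comNzRingType.

(** For M = l, transposing the values of tau makes its matrix square, with equal index types on both
    sides. *)
Definition sqtau (A : 'M[S]_(N, l)) (B : 'M[S]_(K * N, l)) : 'M[S]_(l * N) :=
  \matrix_(p, q) tau g A B p (mxvec_index (dec q).2 (dec q).1).

Lemma sqtauE A B z : mxvec z *m sqtau A B = mxvec (A *m bigX g z *m B)^T.
Proof.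
apply/rowP => q; case/mxvec_indexP: q => c a; rewrite mxvecE [RHS]mxE.
transitivity ((mxvec z *m tau g A B) 0 (mxvec_index a c)); last by rewrite tauE mxvecE.
by rewrite mxE [RHS]mxE; apply: eq_bigr => p _; rewrite [sqtau _ _ _ _]mxE decK.
Qed.

Lemma mxvec_ext m n p (F G : 'M[S]_(m * n, p)) :
  (forall z, mxvec z *m F = mxvec z *m G) -> F = G.
Proof. by move=> h; apply/row_matrixP => i; rewrite !rowE -[delta_mx 0 i]vec_mxK. Qed.

Lemma sqtau_left (P : 'M[S]_N) A B : sqtau (P *m A) B = sqtau A B *m lin_mulmxr P^T.
Proof.
apply: mxvec_ext => z; rewrite mulmxA !sqtauE mul_vec_lin /= -trmx_mul; congr (mxvec _^T).
by rewrite !mulmxA.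
Qed.

Lemma sqtau_right (h : 'M[S]_l) A B : graded g g h -> sqtau (A *m h) B = lin_mulmx h *m sqtau A B.
Proof.
by move=> hg; apply: mxvec_ext => z; rewrite mulmxA mul_vec_lin !sqtauE /= (bigX_graded _ hg) !mulmxA.
Qed.

Lemma mxtrace_lin m n (f : {linear 'M[S]_(m, n) -> 'M[S]_(m, n)}) :
  \tr (lin_mx f) = \sum_i \sum_j f (delta_mx i j) i j.
Proof.
rewrite /mxtrace sum_mxvec; apply: eq_bigr => i _; apply: eq_bigr => j _.
by rewrite !mxE /= vec_mx_delta mxvecE.
Qed.

Lemma tr_delta n (i j : 'I_n) : \tr (delta_mx i j : 'M[S]_n) = (i == j)%:R.
Proof.
rewrite /mxtrace (bigD1 i) //= mxE eqxx /= big1 ?addr0 // => k nk.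
by rewrite mxE (negbTE nk).
Qed.

Lemma mxtrace_mulmxr (Q : 'M[S]_N) : \tr (lin_mulmxr Q : 'M_(l * N)) = \tr Q *+ l.
Proof.
rewrite mxtrace_lin -[l in RHS]card_ord -sumr_const; apply: eq_bigr => c _.
apply: eq_bigr => j _; rewrite /= mxE (bigD1 j) //= mxE !eqxx mul1r big1 ?addr0 // => i ni.
by rewrite mxE (negbTE ni) andbF mul0r.
Qed.

Lemma mxtrace_mulmx (h : 'M[S]_l) : \tr (lin_mulmx h : 'M_(l * N)) = \tr h *+ N.
Proof.
rewrite mxtrace_lin /mxtrace -sumrMnl; apply: eq_bigr => c _.
rewrite -[N in RHS]card_ord -sumr_const; apply: eq_bigr => j _.
rewrite /= mxE (bigD1 c) //= mxE !eqxx mulr1 big1 ?addr0 // => i ni.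
by rewrite mxE (negbTE ni) mulr0.
Qed.

End OverRing.

Lemma deriv_prod_affine n (a b : 'I_n -> R) :
  (\prod_i ((a i)%:P + 'X * (b i)%:P))^`().[0] = \sum_i b i * \prod_(j | j != i) a j.
Proof.
have h (r : seq 'I_n) : uniq r ->
    (\prod_(i <- r) ((a i)%:P + 'X * (b i)%:P))^`().[0] = \sum_(i <- r) b i * \prod_(j <- r | j != i) a j.
  elim: r => [|i r IH] /=; first by rewrite !big_nil derivC horner0.
  case/andP=> ir ur; rewrite !big_cons derivM hornerD !hornerM (IH ur) derivD derivC add0r derivM derivX derivC.
  rewrite mulr0 addr0 mul1r !hornerE horner_prod; congr (_ + _).
    rewrite eqxx /=; congr (_ * _); rewrite big_seq [RHS]big_seq_cond; apply: eq_big => [j|j _].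
      by case jr: (j \in r); rewrite //=; case: eqP jr ir => // -> ->.
    by rewrite !hornerE.
  rewrite mulr_sumr; apply: eq_big_seq => j jr; rewrite big_cons.
  by case: eqP jr ir => [-> ->//|_ _ _]; rewrite mulrCA.
exact: h (index_enum_uniq _).
Qed.

(** Jacobi's formula at the identity. *)
Lemma deriv_det1 n (G : 'M[R]_n) : (\det (1%:M + 'X *: cst G))^`().[0] = \tr G.
Proof.
have E (s : 'S_n) : (\prod_i (1%:M + 'X *: cst G) i (s i))^`().[0] =
    \sum_i G i (s i) * \prod_(j | j != i) (j == s j)%:R.
  rewrite -deriv_prod_affine; congr (_^`()).[0]; apply: eq_bigr => i _; rewrite !mxE; congr (_ + _).
  by case: (_ == _).
rewrite /determinant (raddf_sum (@deriv R)) horner_sum (bigD1 1%g) //= [X in _ + X]big1 ?addr0 => [|s s1].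
  rewrite odd_perm1 expr0 mul1r E; apply: eq_bigr => i _.
  by rewrite perm1 big1 ?mulr1 // => j _; rewrite perm1 eqxx.
suff h : (\prod_i (1%:M + 'X *: cst G) i (s i))^`().[0] = 0.
  by rewrite mulr_sign; case: ifP => _; rewrite ?derivN ?hornerN h ?oppr0.
rewrite E big1 // => j _.
have [i ni] : exists i, s i != i.
  apply/existsP; apply: contraNT s1; rewrite negb_exists => /forallP h; apply/eqP/permP => i.
  by rewrite perm1; apply/eqP; rewrite -[_ == _]negbK h.
(* A permutation other than 1 moves at least two points, so besides the differentiated factor j
   another factor vanishes at 0. *)
have [k kj sk] : exists2 k, k != j & s k != k.
  have [ji|] := eqVneq i j; last by exists i.
  by exists (s i); [rewrite -ji | apply: contra ni => /eqP/perm_inj ->].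
by rewrite (bigD1 k) //= eq_sym (negbTE sk) mul0r mulr0.
Qed.

Variable B : 'M[R]_(K * N, l).

Definition detinv : {mpoly R[N * l]} :=
  \det (sqtau (\matrix_(a, c) 'X_(mxvec_index a c)) (map_mx (@mpolyC _ R) B)).

Lemma detinvE (A : 'M[R]_(N, l)) v : (forall a c, v (mxvec_index a c) = A a c) -> detinv.@[v] = \det (sqtau A B).
Proof.
move=> h; rewrite /detinv -det_map_mx; congr (\det _); apply/matrixP => p q.
by rewrite !mxE rmorphM /= mevalXU mevalC h.
Qed.

Lemma detinv_neq0 (A : 'M[R]_(N, l)) : \rank (tau g A B) = (N * l)%N -> detinv != 0.
Proof.
move=> h; apply/negP => /eqP f0.
have := detinvE (A := A) (v := fun x => mxvec A 0 x); rewrite f0 meval0.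
move=> /(_ (fun a c => mxvecE _ _ _))/esym/eqP; apply/negP; rewrite -unitfE -[_ \is a _]/(sqtau A B \in unitmx).
rewrite -row_free_unit; apply/inj_row_free => v hv.
have vt : v *m tau g A B = 0.
  apply/rowP => q; case/mxvec_indexP: q => a c; rewrite [RHS]mxE.
  have /rowP/(_ (mxvec_index c a)) := hv; rewrite [RHS]mxE => <-.
  by rewrite !mxE; apply: eq_bigr => p _; rewrite [sqtau _ _ _ _]mxE decK.
have rf : row_free (tau g A B) by rewrite /row_free h mulnC.
by apply/eqP; rewrite -(mulmx_free_eq0 _ rf) vt.
Qed.

(** Along the line A + t W(A) the invariant is det(1 + tH) times its value at A; its derivative at t
    = 0 produces the trace. *)
Lemma detinv_opG (G : 'M[R]_(N * l)) (W : 'M[R]_(N, l) -> 'M[R]_(N, l)) (H : 'M[R]_(l * N)) :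
  (forall A x c, vmul (fun u => mxvec A 0 u) G (mxvec_index x c) = W A x c) ->
  (forall A t, \det (sqtau (A + t *: W A) B) = \det (1%:M + t *: H) * \det (sqtau A B)) ->
  opG G detinv = \tr H *: detinv.
Proof.
move=> hW hdet; apply/eqP; rewrite -subr_eq0; apply/eqP/meval_eq0 => v.
pose A : 'M[R]_(N, l) := vec_mx (\row_i v i).
have vE : v =1 fun u => mxvec A 0 u by move=> u; rewrite vec_mxK mxE.
rewrite (meval_eq _ vE) rmorphB /= mevalZ meval_opG.
set v' := fun u => mxvec A 0 u; pose w := vmul v' G.
have lE : line detinv v' w = \det (1%:M + 'X *: cst H) * (\det (sqtau A B))%:P.
  apply/eqP; rewrite -subr_eq0; apply/eqP/poly_all0 => t.
  rewrite !hornerE lineE (@detinvE (A + t *: W A)) => [|a c]; last by rewrite /w /v' hW mxvecE !mxE.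
  rewrite hdet -[X in _ - X * _]/(horner_eval t _) -det_map_mx.
  have -> : map_mx (horner_eval t) (1%:M + 'X *: cst H) = 1%:M + t *: H.
    apply/matrixP => i j; rewrite !mxE /horner_eval !hornerE; congr (_ + _).
    by case: (_ == _); rewrite ?hornerC ?horner0 // -[1%:R]/(1 : {poly R}) hornerC.
  by rewrite subrr.
have /(congr1 (fun p : {poly R} => p^`().[0])) := lE.
rewrite deriv_line horner_sum derivM derivC mulr0 addr0 hornerM hornerC deriv_det1.
rewrite (detinvE (A := A)) => [<-|a c]; last by rewrite /v' mxvecE.
apply/eqP; rewrite subr_eq0; apply/eqP; apply: eq_bigr => i _; rewrite hornerZ lineE.
by congr (_ * _); apply: meval_eq => u; rewrite mul0r addr0.
Qed.

(** A row operation acts on each of the l rows of the transposed values, whence the trace l tr and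
    the weight det^l. *)
Lemma detinv_LL (a b : 'I_N) : opG (LL R l a b) detinv = (l * (a == b))%:R *: detinv.
Proof.
rewrite (@detinv_opG _ (mulmx (delta_mx b a)) (lin_mulmxr (delta_mx b a)^T)) => [|A x c|A t].
- by congr (_ *: _); rewrite mxtrace_mulmxr mxtrace_tr tr_delta eq_sym -mulrnA mulnC.
- rewrite vmul_LL mxE (bigD1 a) //= mxE eqxx andbT big1 ?addr0 // => i ni.
  by rewrite mxE (negbTE ni) andbF mul0r.
have -> : A + t *: (delta_mx b a *m A) = (1%:M + t *: delta_mx b a) *m A.
  by rewrite mulmxDl mul1mx scalemxAl.
rewrite sqtau_left det_mulmx mulrC; congr (\det _ * _); apply: mxvec_ext => z.
rewrite mulmxDr mulmx1 -scalemxAr !mul_vec_lin /= linearD /= linearZ /= trmx1 mulmxDr mulmx1.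
by rewrite -scalemxAr linearD linearZ.
Qed.

(** Column operations inside one block are graded, so they pass through X(z) and act on the N
    columns of z, whence the weight det^N. *)
Lemma detinv_RR (c e : 'I_l) : g c = g e -> opG (RR R N c e) detinv = (N * (c == e))%:R *: detinv.
Proof.
move=> ge; have hg : graded g g (delta_mx c e : 'M[R]_l).
  move=> x y ne; rewrite mxE; case: (x =P c) ne => [->|//]; case: (y =P e) => [->|//].
  by rewrite ge eqxx.
rewrite (@detinv_opG _ (mulmxr (delta_mx c e)) (lin_mulmx (delta_mx c e))) => [|A x z|A t].
- by congr (_ *: _); rewrite mxtrace_mulmx tr_delta -mulrnA mulnC.
- rewrite vmul_RR /= mxE (bigD1 c) //= mxE eqxx big1 ?addr0 1?mulrC // => i ni.
  by rewrite mxE (negbTE ni) mulr0.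
have -> : A + t *: mulmxr (delta_mx c e) A = A *m (1%:M + t *: delta_mx c e).
  by rewrite /= mulmxDr mulmx1 scalemxAr.
rewrite sqtau_right => [|x y ne]; last first.
  rewrite mxE [X in _ + X]mxE (hg _ _ ne) mulr0 addr0 mxE.
  by case: (x =P y) ne => [->|//]; rewrite eqxx.
rewrite det_mulmx; congr (\det _ * _); apply: mxvec_ext => z.
rewrite mulmxDr mulmx1 -scalemxAr !mul_vec_lin /= mulmxDl mul1mx.
by rewrite -scalemxAl linearD linearZ.
Qed.

End DeterminantalInvariant.

Lemma projection_factor (R : rcfType) N k (P : 'M[R]_N) :
  P^T = P -> P *m P = P -> \rank P = k ->
  exists Q : 'M[R]_(k, N), Q *m Q^T = 1%:M /\ Q^T *m Q = P.
Proof.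
move=> PT PP rP; have [Q0 [Q0f Q0E]] : exists Q0 : 'M[R]_(k, N), row_free Q0 /\ (Q0 :=: P)%MS.
  by case: _ / rP; exists (row_base P); split; [apply: row_base_free | apply: eq_row_base].
have [h ho] := gram_schmidt Q0f; set Q := h *m Q0 in ho; exists Q; split=> //.
have hu : h \in unitmx.
  rewrite -row_free_unit -row_leq_rank; apply: leq_trans (mxrankM_maxl h Q0) => //.
  by rewrite row_leq_rank; apply: orthonormal_free.
have QE : (Q :=: P)%MS.
  by apply: eqmx_trans Q0E; apply: eqmxMfull; rewrite row_full_unit.
have [Y hY] : exists Y, Q = Y *m P by apply/submxP; rewrite QE.
have [Z hZ] : exists Z, P = Z *m Q by apply/submxP; rewrite QE.
have QP : Q *m P = Q by rewrite hY -mulmxA PP.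
have PQ : P *m Q^T = Q^T by rewrite -[in LHS]PT -trmx_mul QP.
have ZE : Z = Q^T by rewrite -PQ [in RHS]hZ -mulmxA ho mulmx1.
by rewrite -ZE -hZ.
Qed.

(** The degenerate case M = 0, where all rectangles are empty and there are no variables. *)
Lemma LRcoef_empty lams : all (fun la => la == [::]) lams -> LRcoef lams [::] = 1.
Proof.
move=> h; rewrite (@LRcoefE _ _ 0) //; last by apply: sub_all h => la /eqP ->.
have s1 : schur 0 [::] = 1.
  rewrite schur_tab_sum tab_sum0; case: forallP => //= -[]; by case.
rewrite big_seq big1 => [|la /(allP h)/eqP -> //].
rewrite mulr1 /alternant det_mx00 mcoeff1; case: eqP => // -[]; by apply/mnmP => -[].
Qed.

(** * From invariants to projections and back *)

Section Frames.
Variables (R : realType) (K N : nat) (L : 'I_K -> nat).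
Local Notation Cs := {k : 'I_K & 'I_(L k)}.
Local Notation l := #|{: Cs}|.

Lemma sum_block (V : nmodType) (F : Cs -> V) :
  \sum_(c < l) F (enum_val c) = \sum_k \sum_(j < L k) F (Tagged (fun k => 'I_(L k)) j).
Proof.
rewrite -(big_enum_val F) sig_big_dep /=; apply: eq_big => // -[k j] _ //.
Qed.

Lemma frame_of_invariant (f : {mpoly R[N * l]}) :
  (0 < N)%N -> (0 < l)%N -> f != 0 -> invariant_poly (\sum_k L k) f ->
  exists P : 'I_K -> 'M[R]_N,
    (forall i, (P i)^T = P i /\ P i *m P i = P i /\ \rank (P i) = L i) /\
    \sum_(i < K) P i = ((\sum_k L k)%:R / N%:R)%:M.
Proof.
move=> N0 l0 f0 [h1 h2 h3 h4]; have [A [AA Ag]] := kempf_ness f0 h1 h2 h3 h4 N0 l0.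
(* [D i] selects the columns of block i, and P_i = A D_i A^T. Orthonormality inside the block reads
   D_i A^T A D_i = D_i, and the rank of P_i is the trace of this idempotent. *)
pose D i : 'M[R]_l := diag_mx (\row_c (block c == i)%:R).
have DE i c e : D i c e = ((block c == i) && (c == e))%:R.
  by rewrite !mxE; case: (c == e); rewrite ?andbT ?andbF ?mulr1n ?mulr0n.
have DD i : D i *m (A^T *m A) *m D i = D i.
  move: (A^T *m A) Ag => G Ag; apply/matrixP => c e; rewrite /D mul_diag_mx mul_mx_diag !mxE.
  case: (block c =P i) => [bc|_]; last by rewrite !mul0r mul0rn.
  case: (block e =P i) => [be|nb]; first by rewrite Ag ?bc // mul1r mulr1.
  by case: (c =P e) => [ce|_]; [case: nb; rewrite -ce | rewrite mulr0].
exists (fun i => A *m D i *m A^T); split=> [i|].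
  have PP : A *m D i *m A^T *m (A *m D i *m A^T) = A *m D i *m A^T.
    by rewrite -{3}DD !mulmxA.
  split; first by rewrite !trmx_mul trmxK tr_diag_mx mulmxA.
  split=> //; apply/eqP; rewrite -(eqr_nat R) -idempotent_trace // mxtrace_mulC mulmxA /mxtrace.
  move: (A^T *m A) Ag => G Ag.
  have -> : \sum_c (G *m D i) c c = \sum_k \sum_(j < L k) (k == i)%:R.
    rewrite -[RHS](sum_block (fun x : Cs => (tag x == i)%:R)).
    by apply: eq_bigr => c _; rewrite /D mul_mx_diag !mxE Ag // eqxx mul1r.
  rewrite (bigD1 i) //= eqxx sumr_const card_ord.
  by rewrite big1 ?addr0 // => k nk; rewrite big1 // => j _; rewrite (negbTE nk).
rewrite -mulmx_suml -mulmx_sumr; have -> : \sum_i D i = 1%:M.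
  apply/matrixP => c e; rewrite summxE (bigD1 (block c)) //= DE eqxx /= big1 ?addr0 ?mxE // => i ni.
  by rewrite DE eq_sym (negbTE ni).
by rewrite mulmx1 AA card_Cs.
Qed.

Lemma invariant_of_frame (P : 'I_K -> 'M[R]_N) : (0 < N)%N ->
  (forall i, (P i)^T = P i /\ P i *m P i = P i /\ \rank (P i) = L i) ->
  \sum_(i < K) P i = ((\sum_k L k)%:R / N%:R)%:M ->
  exists2 f : {mpoly R[N * l]}, f != 0 & invariant_poly (\sum_k L k) f.
Proof.
move=> N0 hP sP.
have hQ i : exists Q : 'M[R]_(L i, N), Q *m Q^T = 1%:M /\ Q^T *m Q = P i.
  by have [h1 [h2 h3]] := hP i; apply: projection_factor.
have [Q Qh] := fin_all_exists hQ.
pose q (x : Cs) a := Q (tag x) (tagged x) a.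
(* The columns of A are the orthonormal rows of all factors [Q k], so A A^T is the sum of the
   projections. *)
pose A : 'M[R]_(N, l) := \matrix_(a, c) q (enum_val c) a.
have lM : l = (\sum_k L k)%N by apply: card_Cs.
have AA : A *m A^T = (l%:R / N%:R)%:M.
  have -> : l%:R = (\sum_k L k)%:R :> R by rewrite lM.
  rewrite -sP; apply/matrixP => a b; rewrite !mxE summxE.
  under eq_bigr => c _ do rewrite !mxE.
  rewrite (sum_block (fun x => q x a * q x b)); apply: eq_bigr => k _.
  by have [_ <-] := Qh k; rewrite mxE; apply: eq_bigr => j _; rewrite !mxE.
have qq (x y : Cs) : tag x = tag y -> \sum_a q x a * q y a = (x == y)%:R.
  case: x y => [k j] [k' j'] /= e; case: _ / e j' => j'; rewrite eq_Tagged /=.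
  have [/matrixP/(_ j j') + _] := Qh k; rewrite !mxE => <-.
  by apply: eq_bigr => a _; rewrite !mxE.
have Ag c e : block c = block e -> (A^T *m A) c e = (c == e)%:R.
  move=> /qq; rewrite (inj_eq enum_val_inj) => <-; rewrite mxE.
  by apply: eq_bigr => a _; rewrite !mxE.
have [A1 [B rk]] := tight_full_rank (M := l) N0 AA Ag (erefl N).
exists (detinv (@block K L) B); first exact: detinv_neq0 rk.
split=> [a b ne|a|c e ne ge|c].
- by rewrite detinv_LL (negbTE ne) muln0 scale0r.
- by rewrite detinv_LL eqxx muln1 -lM.
- by rewrite detinv_RR // (negbTE ne) muln0 scale0r.
- by rewrite detinv_RR // eqxx muln1.
Qed.

End Frames.

Theorem theorem4p3 (R : realType) (N K : nat) (L : 'I_K -> nat)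
  (hN : (0 < N)%N)
  (hdec : forall i j : 'I_K, (i <= j)%N -> (L j <= L i)%N)
  (hL1 : forall i : 'I_K, (L i <= N)%N) :
  let M := (\sum_(i < K) L i)%N in
  let alpha : R := M%:R / N%:R in
  (exists P : 'I_K -> 'M[R]_N,
      (forall i, (P i)^T = P i /\ P i *m P i = P i /\ \rank (P i) = L i) /\
      \sum_(i < K) P i = alpha%:M)
  <-> LRcoef [seq rect N (L i) | i <- enum 'I_K] (rect M N) != 0.
Proof.
(* If M = 0 all ranks are 0, zero projections solve (1), and the coefficient is 1. *)
move=> M alpha; have [M0|M0] := posnP M.
  have L0 i : L i = 0%N by apply/eqP; move/eqP: M0; rewrite sum_nat_eq0 => /forallP/(_ i).
  rewrite M0 /= LRcoef_empty; last first.
    apply/allP => _ /mapP[i _ ->]; rewrite L0; by case: (N).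
  split=> // _; exists (fun=> 0); split=> [i|].
    by rewrite trmx0 mulmx0 mxrank0 L0.
  by rewrite big1 // /alpha M0 mul0r; apply/matrixP => i j; rewrite !mxE mul0rn.
apply: iff_trans (iff_sym (LR_invariant R hN M0 hL1)); split=> [[P [h1 h2]]|[f f0 hf]].
  exact: invariant_of_frame h1 h2.
by apply: frame_of_invariant hf => //; rewrite card_Cs.
Qed.
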